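(* Let $n\ge 2$ and let $p\in\mathbb{R}$ be such that $p\ge 0$ or $p<-n$. Then for all $k\in\mathbb{N}$: (i) $\mathcal{V}^p_k$ is homogeneous of degree $n\frac{n-p}{n+p}-k$ on $\mathcal{C}^n$, i.e. $\mathcal{V}^p_k(aK)=a^{n\frac{n-p}{n+p}-k}\,\mathcal{V}^p_k(K)$ for every $K\in\mathcal{C}^n$ and every $a>0$; (ii) $\mathcal{V}^p_k$ is invariant under rotations and reflections, i.e. $\mathcal{V}^p_k(TK)=\mathcal{V}^p_k(K)$ for every $K\in\mathcal{C}^n$ and every rotation or reflection $T$ of $\mathbb{R}^n$ (linear, fixing the origin); (iii) $\mathcal{V}^p_k$ is a valuation on the set $\mathcal{C}^n$.
   Context: $\mathbb{N}=\{1,2,\dots\}$. A convex body is a compact convex subset of $\mathbb{R}^n$ with nonempty interior; $\mathcal{K}^n_o$ is the set of convex bodies in $\mathbb{R}^n$ containing the origin in their interior. For a convex body $K$ and $x\in\partial K$, $N(x)$ is the outer unit normal of $K$ at $x$ (unique for $\mathcal{H}^{n-1}$-almost all $x$), $k_1(x),\dots,k_{n-1}(x)$ are the (generalized) principal curvatures, which exist for $\mathcal{H}^{n-1}$-almost all $x\in\partial K$, and $H_j=\binom{n-1}{j}^{-1}\sum_{1\le i_1<\dots<i_j\le n-1}k_{i_1}\cdots k_{i_j}$ for $1\le j\le n-1$, $H_0=1$. $\mathcal{H}^{n-1}$ is the surface area measure on $\partial K$. $B^n_2(y,r)$ is the closed Euclidean ball with center $y$ and radius $r$. $K$ admits an inner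 rolling ball if there is $r>0$ with $B^n_2(x-rN(x),r)\subseteq K$ for every $x\in\partial K$, and an outer rolling ball if there is $R>0$ with $K\subseteq B^n_2(x-RN(x),R)$ for every $x\in\partial K$ (where $N(x)$ is an outer unit normal at $x$). $\mathcal{C}^n$ is the set of $K\in\mathcal{K}^n_o$ admitting both an inner and an outer rolling ball. For $\alpha\in\mathbb{R}$: $\binom{\alpha}{0}=1$, $\binom{\alpha}{k}=\frac{\alpha(\alpha-1)\cdots(\alpha-k+1)}{k!}$ for integers $k>0$, and $\binom{\alpha}{k}=0$ for $k<0$. For non-negative integers $i_1,\dots,i_{n-1}$ with $i_1+2i_2+\dots+(n-1)i_{n-1}=m$ put $$c(n,p,i(m))=\binom{\frac{n}{n+p}}{i_1+\dots+i_{n-1}}\frac{(i_1+\dots+i_{n-1})!}{i_1!\,i_2!\cdots i_{n-1}!}.$$ For real $p\ne -n$ and integers $k,m\ge 0$, $$\mathcal{W}^p_{m,k}(K)=\int_{\partial K}\langle x,N(x)\rangle^{m-k+\frac{n(1-p)}{n+p}}H_{n-1}^{\frac{p}{n+p}}\sum_{\substack{i_1,\dots,i_{n-1}\ge 0\\ i_1+2i_2+\dots+(n-1)i_{n-1}=m}}c(n,p,i(m))\prod_{j=1}^{n-1}\binom{n-1}{j}^{i_j}H_j^{i_j}\,d\mathcal{H}^{n-1},$$ and the $L_p$-Steiner quermassintegrals are $$\mathcal{V}^p_k(K)=\sum_{m=0}^{k}\binom{\frac{n(1-p)}{n+p}}{k-m}\mathcal{W}^p_{m,k}(K).$$ A functional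 $\mu$ is a valuation on $\mathcal{C}^n$ if $\mu(K\cup L)+\mu(K\cap L)=\mu(K)+\mu(L)$ for all $K,L\in\mathcal{C}^n$ with $K\cup L$ convex. *)

(* Defs.v *)
From HB Require Import structures.
From mathcomp Require Import all_boot all_order all_algebra.
From mathcomp Require Import all_classical all_reals all_analysis.

Set Implicit Arguments.
Unset Strict Implicit.
Unset Printing Implicit Defensive.
Import Order.TTheory GRing.Theory Num.Theory.
Import numFieldNormedType.Exports.

Local Open Scope classical_set_scope.
Local Open Scope ring_scope.

Section euclidean.
Context {R : realType} {n : nat}.
Implicit Types (x y c : 'rV[R]_n) (K A : set 'rV[R]_n).

Definition dot x y : R := \sum_i x 0 i * y 0 i.

(* The library norm on row vectors is the sup norm; it induces the same
   topology, but balls and diameters below must be Euclidean. *)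
Definition enorm x : R := Num.sqrt (dot x x).

Definition eball c (r : R) : set 'rV[R]_n := [set y | enorm (y - c) <= r].

Definition boundary K : set 'rV[R]_n := closure K `\` interior K.

Definition ediam A : \bar R :=
  ereal_sup [set (enorm (xy.1 - xy.2))%:E | xy in A `*` A].

End euclidean.

(* Volume of the Euclidean unit ball of R^s,
   i.e. pi ^ (s / 2) / Gamma (s / 2 + 1). *)
Fixpoint ball_volume (R : realType) (s : nat) : R :=
  match s with
  | 0 => 1
  | 1 => 2
  | s'.+2 => 2 * pi / s'.+2%:R * ball_volume R s'
  end.

Section hausdorff.
Local Open Scope ereal_scope.
Context {R : realType} {n : nat}.
Variable s : nat.
Implicit Types (A C : set 'rV[R]_n) (delta : R).

(* Normalized so that the s-dimensional measure is the Lebesgue one on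
   s-dimensional affine subspaces. *)
Definition hausdorff_gauge C : \bar R :=
  if C == set0 then 0 else (ball_volume R s / 2 ^+ s)%:E * ediam C ^+ s.

Definition hausdorff_premeasure delta A : \bar R :=
  ereal_inf [set \sum_(i <oo) hausdorff_gauge (C i) | C in
    [set C : (set 'rV[R]_n)^nat | A `<=` \bigcup_i C i /\
                                  forall i, ediam (C i) <= delta%:E]].

Definition hausdorff A : \bar R :=
  ereal_sup [set hausdorff_premeasure delta A | delta in [set d | (0 < d)%R]].

Lemma ball_volume_ge0 : (0 <= ball_volume R s)%R.
Proof.
suff H m : (0 <= ball_volume R m)%R /\ (0 <= ball_volume R m.+1)%R.
  by case: (H s).
elim: m => [|m [h1 h2]]; first by split => //=; rewrite ler01.
split=> //=; rewrite !mulr_ge0 ?invr_ge0 ?ler0n ?pi_ge0 //.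
Qed.

Lemma hausdorff_gauge0 : hausdorff_gauge set0 = 0.
Proof. by rewrite /hausdorff_gauge eqxx. Qed.

Lemma hausdorff_gauge_ge0 C : 0 <= hausdorff_gauge C.
Proof.
rewrite /hausdorff_gauge; case: eqP => // /eqP /set0P[x Cx].
apply: mule_ge0; first by rewrite lee_fin divr_ge0 ?ball_volume_ge0 ?exprn_ge0.
apply: expe_ge0; apply: le_trans (_ : (enorm (x - x))%:E <= _).
  by rewrite lee_fin sqrtr_ge0.
by apply: ereal_sup_ubound; exists (x, x).
Qed.

Let cut delta C := if ediam C <= delta%:E then hausdorff_gauge C else +oo.

Let cut_ge0 delta C : 0 <= cut delta C.
Proof. by rewrite /cut; case: ifP => // _; exact: hausdorff_gauge_ge0. Qed.

Let cut0 delta : cut delta set0 = 0.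
Proof.
rewrite /cut hausdorff_gauge0 (_ : ediam _ <= _) //.
by apply: ge_ereal_sup => _ [[? ?] [[]]].
Qed.

Let E := g_sigma_algebraType [set: set 'rV[R]_n].

Let premeasureE delta A :
  hausdorff_premeasure delta A = @mu_ext _ E R (cut delta) A.
Proof.
apply/eqP; rewrite eq_le; apply/andP; split; apply: le_ereal_inf_tmp.
  move=> _ [C [mC AC] <-].
  have [h|] := pselect (forall i, ediam (C i) <= delta%:E).
    apply: ereal_inf_lbound; exists C => //.
    by apply: eq_eseriesr => i _; rewrite /cut h.
  move=> /existsNP[i /negP h].
  rewrite (@eseries_pinfty _ _ xpredT i) ?leey // /cut ?(negbTE h) // => j _.
  by rewrite -ltNye (lt_le_trans _ (cut_ge0 delta _)).
move=> _ [C [AC dC] <-]; apply: ereal_inf_lbound; exists C.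
  by split=> // i; exact: sub_gen_smallest.
by apply: eq_eseriesr => i _; rewrite /cut dC.
Qed.

Let premeasure0 delta : hausdorff_premeasure delta set0 = 0.
Proof. by rewrite premeasureE; exact: (@mu_ext0 _ E R _ (cut0 _) (cut_ge0 _)). Qed.

Let premeasure_ge0 delta A : 0 <= hausdorff_premeasure delta A.
Proof. by rewrite premeasureE; exact: (@mu_ext_ge0 _ E R _ (cut_ge0 _)). Qed.

Lemma hausdorff0 : hausdorff set0 = 0.
Proof.
apply/eqP; rewrite eq_le; apply/andP; split.
  by apply: ge_ereal_sup => _ [d _ <-]; rewrite premeasure0.
by apply: ereal_sup_ubound; exists 1%R => //=; rewrite premeasure0.
Qed.

Lemma hausdorff_ge0 A : 0 <= hausdorff A.
Proof.
by apply: le_trans (premeasure_ge0 1 A) _; apply: ereal_sup_ubound; exists 1%R => /=.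
Qed.

Lemma le_hausdorff : {homo hausdorff : A B / A `<=` B >-> A <= B}.
Proof.
move=> A B AB; apply: ge_ereal_sup => _ [d d0 <-].
apply: le_trans (_ : hausdorff_premeasure d B <= _).
  by rewrite !premeasureE; exact: le_mu_ext.
by apply: ereal_sup_ubound; exists d.
Qed.

Lemma hausdorff_sigma_subadditive : sigma_subadditive hausdorff.
Proof.
move=> F; apply: ge_ereal_sup => _ [d d0 <-].
apply: le_trans (_ : \sum_(i <oo) hausdorff_premeasure d (F i) <= _).
  rewrite premeasureE (eq_eseriesr (fun i _ => premeasureE d (F i))).
  exact: (@mu_ext_sigma_subadditive _ E R _ (cut_ge0 d)).
apply: lee_nneseries => i _; first by move=> _; exact: premeasure_ge0.
by apply: ereal_sup_ubound; exists d.
Qed.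

HB.instance Definition _ := isOuterMeasure.Build R 'rV[R]_n hausdorff
  hausdorff0 hausdorff_ge0 le_hausdorff hausdorff_sigma_subadditive.

End hausdorff.

Section convex_bodies.
Context {R : realType} {n : nat}.
Implicit Types (x y u : 'rV[R]_n) (K : set 'rV[R]_n).

Definition convex K : Prop := convex_set (K : set (convex_lmodType 'rV[R]_n)).

Definition convex_body K : Prop := [/\ compact K, convex K & interior K !=set0].

Definition convex_body_o K : Prop := convex_body K /\ interior K 0.

Definition outer_unit_normal K x u : Prop :=
  enorm u = 1 /\ forall y, K y -> dot (y - x) u <= 0.

Definition normal K x : 'rV[R]_n := xget 0 [set u | outer_unit_normal K x u].

Definition inner_rolling_ball K : Prop := exists2 r : R, 0 < r &
  forall x, boundary K x -> eball (x - r *: normal K x) r `<=` K.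

Definition outer_rolling_ball K : Prop := exists2 r : R, 0 < r &
  forall x, boundary K x -> K `<=` eball (x - r *: normal K x) r.

Definition rolling_body : set (set 'rV[R]_n) :=
  [set K | [/\ convex_body_o K, inner_rolling_ball K & outer_rolling_ball K]].

(* Near x, K is the epigraph of this function over the tangent hyperplane
   x + (normal K x)^\perp, heights being measured along the inner normal; the
   value is +oo when the line through x + y in direction normal K x misses K. *)
Definition height K x y : \bar R :=
  ereal_inf [set t%:E | t in [set t : R | K (x + y - t *: normal K x)]].

(* A is the Hessian at 0 of the function above, in the sense of a second-order
   Taylor expansion, extended by 0 in the normal direction. *)
Definition boundary_hessian K x (A : 'M[R]_n) : Prop :=
  [/\ A^T = A, normal K x *m A = 0 &
    forall eps : R, 0 < eps ->
      \forall y \near (0 : 'rV[R]_n), dot y (normal K x) = 0 ->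
        (`|height K x y - (2^-1 * dot (y *m A) y)%:E|
           <= (eps * dot y y)%:E)%E].

(* The generalized principal curvatures, listed with multiplicity: the
   eigenvalues of the Hessian on the tangent hyperplane. The factor 'X accounts
   for the normal direction. The order of the list is arbitrary; the value is 0
   where the second-order expansion does not exist. *)
Definition curvatures K x : 'rV[R]_n.-1 :=
  xget 0 [set k : 'rV[R]_n.-1 | exists2 A, boundary_hessian K x A &
    char_poly A = 'X * \prod_(i < n.-1) ('X - (k 0 i)%:P)].

Definition mean_curvature (j : nat) K x : R :=
  'C(n.-1, j)%:R^-1 *
  \sum_(I : {set 'I_n.-1} | #|I| == j) \prod_(i in I) curvatures K x 0 i.

Definition valuation_on (C : set (set 'rV[R]_n)) (mu : set 'rV[R]_n -> R) :=
  forall K L, C K -> C L -> convex (K `|` L) ->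
    mu (K `|` L) + mu (K `&` L) = mu K + mu L.

End convex_bodies.

Definition gbinom {R : realType} (alpha : R) (k : nat) : R :=
  (\prod_(i < k) (alpha - i%:R)) / k`!%:R.

(* The measure induced by an outer measure on its Caratheodory-measurable
   sets. *)
Definition caratheodory_measure {R : realType} {T : pointedType}
    (mu : {outer_measure set T -> \bar R}) :
    {measure set (caratheodory_type mu) -> \bar R} := mu.

Definition surface_measure {R : realType} {n : nat} :=
  caratheodory_measure (@hausdorff R n n.-1).

Section steiner.
Context {R : realType} {n : nat}.
Implicit Types (p : R) (K : set 'rV[R]_n) (m k : nat).

(* In the next two definitions the multi-index (i_1, ..., i_(n-1)) is a function
   on 'I_n.-1, so that i_j is the value at the ordinal j - 1. *)
Definition steiner_coef p (i : 'I_n.-1 -> nat) : R :=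
  gbinom (n%:R / (n%:R + p)) (\sum_j i j)%N *
  ((\sum_j i j)%N`!%:R / \prod_j (i j)`!%:R).

(* Every i_j is at most m, so the multi-indices can be taken in a finite type. *)
Definition steiner_sum p m K (x : 'rV[R]_n) : R :=
  \sum_(i : {ffun 'I_n.-1 -> 'I_m.+1} | (\sum_(j < n.-1) j.+1 * i j)%N == m)
    steiner_coef p (fun j => i j) *
    \prod_(j < n.-1) ('C(n.-1, j.+1)%:R ^+ i j * mean_curvature j.+1 K x ^+ i j).

Definition steiner_W p m k K : R :=
  \int[surface_measure]_(x in boundary K)
    (dot x (normal K x) `^ (m%:R - k%:R + n%:R * (1 - p) / (n%:R + p)) *
     mean_curvature n.-1 K x `^ (p / (n%:R + p)) *
     steiner_sum p m K x).

Definition steiner_V p k K : R :=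
  \sum_(m < k.+1)
    gbinom (n%:R * (1 - p) / (n%:R + p)) (k - m) * steiner_W p m k K.

End steiner.

(* Main.v *)
Require Import Defs.
From HB Require Import structures.
From mathcomp Require Import all_boot all_order all_algebra.
From mathcomp Require Import all_classical all_reals all_analysis.
From mathcomp Require Import measurable_realfun zify ring lra.

Set Implicit Arguments.
Unset Strict Implicit.
Unset Printing Implicit Defensive.
Import Order.TTheory GRing.Theory Num.Theory.
Import numFieldNormedType.Exports.
Local Open Scope classical_set_scope.
Local Open Scope ring_scope.

(** Homogeneity and invariance under isometries come from one change of
variables. The map x |-> a (x T), with T orthogonal, multiplies the surface
measure by a^(n-1), the support function by a and each curvature by 1/a, and
the exponents in the integrand add up to n(n-p)/(n+p) - k for every m
[similarity_exponent]. Curvatures are defined by an arbitrary choice, so one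
needs that the Hessian is unique [boundary_hessian_unique] and that the mean
curvatures depend only on its characteristic polynomial
[elementary_symmetric_roots]; they are nonnegative because the body is convex,
so that their real powers are multiplicative.

For the valuation property, let U and I be the union and the intersection of K
and L, with U convex. Where the boundary of K is outside of L, the sets K and U
coincide, and where it is inside of L, the sets K and I coincide; there the
integrands agree by locality [outside_union, inside_intersection]. The matter is
the common boundary A. At its points the rolling balls force the normals of K
and L to be equal [common_normal], but curvatures may exist for one body and
not for another one. This does not happen at a point where A is not porous:
seen from the tangent hyperplane, the lowest point p of U over x + y is then at
distance o(|y|) of some z in A, the ball that rolls in both K and L touches I
at z, and so I has a point at height O(|p - z|^2) = o(|y|^2) above p
[filled_sandwich]. Since U contains K and L, which contain I, the four bodies
have the same expansion at x, or none of them has one.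

The set of points at which a set is porous is negligible [porous_null]. In a
bi-Lipschitz chart, dyadic cells around such a point meet holes of a fixed
relative size infinitely often, and discarding them r times covers the porous
points by cells of total volume at most (1 - c)^r. The charts are central
projections to the faces of a cube, whose inverses are Lipschitz because the
bodies have supporting hyperplanes at a positive distance from the origin
[central_chart_lipschitz]; they also show that the boundary has finite measure
[boundary_finite].

So outside a null set the four integrands are restrictions of one bounded
function, and the identity follows by cutting the four boundaries into common
pieces [boundary_integral_valuation]. The integral of a function that need not
be measurable is defined as a difference of lower integrals; these are additive
over measurable sets and compatible with similarities for all functions, so that
only the pieces have to be measurable, and they are because the Hausdorff
measure is a metric outer measure [closed_caratheodory]. *)

(** * Euclidean geometry of row vectors *)

Section euclidean_theory.
Context {R : realType} {n : nat}.
Implicit Types x y z : 'rV[R]_n.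

Lemma dotC x y : dot x y = dot y x.
Proof. by apply: eq_bigr => i _; rewrite mulrC. Qed.

Lemma dotDl x y z : dot (x + y) z = dot x z + dot y z.
Proof. by rewrite /dot -big_split; apply: eq_bigr => i _; rewrite mxE mulrDl. Qed.

Lemma dotZl a x y : dot (a *: x) y = a * dot x y.
Proof. by rewrite /dot mulr_sumr; apply: eq_bigr => i _; rewrite mxE mulrA. Qed.

Lemma dotNl x y : dot (- x) y = - dot x y.
Proof. by rewrite -scaleN1r dotZl mulN1r. Qed.

Lemma dotDr x y z : dot z (x + y) = dot z x + dot z y.
Proof. by rewrite dotC dotDl !(dotC z). Qed.

Lemma dotZr a x y : dot y (a *: x) = a * dot y x.
Proof. by rewrite dotC dotZl (dotC y). Qed.

Lemma dotNr x y : dot y (- x) = - dot y x.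
Proof. by rewrite dotC dotNl (dotC y). Qed.

Lemma dot0l x : dot 0 x = 0.
Proof. by rewrite -(scale0r x) dotZl mul0r. Qed.

Definition dotE := (dotDl, dotDr, dotNl, dotNr, dotZl, dotZr).

Lemma dotxx_ge0 x : 0 <= dot x x.
Proof. by apply: sumr_ge0 => i _; rewrite -expr2 sqr_ge0. Qed.

Lemma dotxx_eq0 x : (dot x x == 0) = (x == 0).
Proof.
apply/eqP/eqP => [|->]; last by rewrite dot0l.
move=> /psumr_eq0P h; apply/rowP => i; rewrite mxE.
have /eqP := h (fun i _ => sqr_ge0 (x 0 i)) i isT.
by rewrite mulf_eq0 orbb => /eqP.
Qed.

Lemma enorm_ge0 x : 0 <= enorm x.
Proof. exact: sqrtr_ge0. Qed.

Lemma sqr_enorm x : enorm x ^+ 2 = dot x x.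
Proof. by rewrite sqr_sqrtr ?dotxx_ge0. Qed.

Lemma enorm0 : enorm (0 : 'rV[R]_n) = 0.
Proof. by rewrite /enorm dot0l sqrtr0. Qed.

Lemma enorm_eq0 x : (enorm x == 0) = (x == 0).
Proof. by rewrite -sqrf_eq0 sqr_enorm dotxx_eq0. Qed.

Lemma enormZ a x : enorm (a *: x) = `|a| * enorm x.
Proof.
by rewrite /enorm dotZl dotZr mulrA -expr2 sqrtrM ?sqr_ge0// sqrtr_sqr.
Qed.

Lemma enormN x : enorm (- x) = enorm x.
Proof. by rewrite -scaleN1r enormZ normrN1 mul1r. Qed.

Lemma enormB x y : enorm (x - y) = enorm (y - x).
Proof. by rewrite -opprB enormN. Qed.

Lemma enorm_le x (r : R) : 0 <= r -> (enorm x <= r) = (dot x x <= r ^+ 2).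
Proof. by move=> r0; rewrite -sqr_enorm ler_sqr ?nnegrE ?enorm_ge0. Qed.

Lemma enorm1_dot x : enorm x = 1 -> dot x x = 1.
Proof. by rewrite -sqr_enorm => ->; rewrite expr1n. Qed.

Lemma cauchy_schwarz x y : dot x y <= enorm x * enorm y.
Proof.
have [->|/eqP y0] := eqVneq y 0; first by rewrite dotC dot0l enorm0 mulr0.
rewrite (le_trans (ler_norm _))// -ler_sqr ?nnegrE ?mulr_ge0 ?enorm_ge0//.
rewrite exprMn !sqr_enorm real_normK ?num_real//.
have yy : 0 < dot y y by rewrite lt0r dotxx_eq0 dotxx_ge0 andbT; apply/eqP.
have := dotxx_ge0 (dot y y *: x - dot x y *: y).
rewrite !dotE (dotC y x) => h.
rewrite -subr_ge0 -(pmulr_rge0 _ yy); apply: le_trans h _.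
by rewrite le_eqVlt; apply/orP; left; apply/eqP; ring.
Qed.

Lemma cauchy_schwarz_norm x y : `|dot x y| <= enorm x * enorm y.
Proof.
rewrite ler_norml cauchy_schwarz andbT lerNl -dotNl.
by rewrite (le_trans (cauchy_schwarz _ _))// enormN.
Qed.

Lemma enormD x y : enorm (x + y) <= enorm x + enorm y.
Proof.
rewrite enorm_le ?addr_ge0 ?enorm_ge0// sqrrD !sqr_enorm !dotE (dotC y x).
have := cauchy_schwarz x y; lra.
Qed.

Lemma enorm_dist x y z : enorm (x - z) <= enorm (x - y) + enorm (y - z).
Proof. by have := enormD (x - y) (y - z); rewrite addrA subrK. Qed.

Lemma coord_le_enorm x i : `|x 0 i| <= enorm x.
Proof.
rewrite -ler_sqr ?nnegrE ?enorm_ge0// sqr_enorm real_normK ?num_real//.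
rewrite /dot (bigD1 i)//= -expr2 lerDl sumr_ge0// => j _.
by rewrite -expr2 sqr_ge0.
Qed.

Lemma enorm_le_sum x : enorm x <= \sum_i `|x 0 i|.
Proof.
rewrite enorm_le ?sumr_ge0// expr2 mulr_suml ler_sum// => i _.
rewrite (le_trans (ler_norm _))// normrM ler_wpM2l//.
by rewrite (bigD1 i)//= lerDl sumr_ge0.
Qed.

End euclidean_theory.

Section euclidean_topology.
Context {R : realType} {n : nat}.
Implicit Types x y z : 'rV[R]_n.

Lemma coord_le_norm (m : nat) (x : 'rV[R]_m) i : `|x 0 i| <= `|x|.
Proof.
by rewrite [`|x|]mx_normrE (@le_bigmax _ _ _ 0 (fun i => `|x i.1 i.2|) (0, i)).
Qed.

Lemma norm_le_coord (m : nat) (x : 'rV[R]_m) (r : R) :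
  0 <= r -> (forall i, `|x 0 i| <= r) -> `|x| <= r.
Proof.
move=> r0 h; rewrite [`|x|]mx_normrE; apply: bigmax_le => // -[i j] _ /=.
by rewrite (ord1 i).
Qed.

Lemma enorm_le_norm x : enorm x <= n%:R * `|x|.
Proof.
apply: le_trans (enorm_le_sum x) _.
rewrite mulr_natl -[X in _ *+ X]card_ord -sumr_const ler_sum// => i _.
exact: coord_le_norm.
Qed.

Lemma norm_le_enorm x : `|x| <= enorm x.
Proof. by apply: norm_le_coord; [exact: enorm_ge0|exact: coord_le_enorm]. Qed.

Lemma nbhs_enorm x (A : set 'rV[R]_n) :
  nbhs x A <-> exists2 e : R, 0 < e & forall y, enorm (y - x) < e -> A y.
Proof.
split=> [|[e e0 h]].
  move=> /nbhs_ballP[e /= e0 h]; exists e => // y xy; apply: h; rewrite -ball_normE /=.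
  by rewrite distrC (le_lt_trans (norm_le_enorm _)).
apply/nbhs_ballP; exists (e / n.+1%:R) => /=; first by rewrite divr_gt0.
move=> y; rewrite -ball_normE /= => xy; apply: h; rewrite (le_lt_trans (enorm_le_norm _))//.
move: xy; rewrite ltr_pdivlMr// distrC => xy.
by apply: le_lt_trans xy; rewrite mulrC ler_wpM2l// ler_nat.
Qed.

Lemma interior_enorm (A : set 'rV[R]_n) x : interior A x <->
  exists2 e : R, 0 < e & forall y, enorm (y - x) < e -> A y.
Proof. exact: nbhs_enorm. Qed.

Lemma rV_compact_closed (K : set 'rV[R]_n) : compact K -> closed K.
Proof. by apply: compact_closed; exact: norm_hausdorff. Qed.

Lemma boundary_closed (K : set 'rV[R]_n) : closed (boundary K).
Proof.
by rewrite /boundary setDE; apply: closedI; [exact: closed_closure|exact: open_closedC (open_interior K)].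
Qed.

Lemma closed_boundaryP (K : set 'rV[R]_n) x : closed K ->
  boundary K x <-> K x /\ ~ interior K x.
Proof. by move=> /closure_id cK; rewrite /boundary -cK. Qed.

End euclidean_topology.

(** * Hausdorff measures *)

Section hausdorff_theory.
Local Open Scope ereal_scope.
Context {R : realType} {n : nat}.
Variable s : nat.
Implicit Types (A B C : set 'rV[R]_n) (delta : R).

Local Notation gauge := (@hausdorff_gauge R n s).
Local Notation premeasure := (@hausdorff_premeasure R n s).
Local Notation hausdorff := (@hausdorff R n s).

Lemma ediam_ge A x y : A x -> A y -> (enorm (x - y))%:E <= ediam A.
Proof. by move=> Ax Ay; apply: ereal_sup_ubound; exists (x, y). Qed.

Lemma ediam_le A (d : \bar R) :
  (forall x y, A x -> A y -> (enorm (x - y))%:E <= d) -> ediam A <= d.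
Proof. by move=> h; apply: ge_ereal_sup => _ [[x y] [/= Ax Ay] <-]; exact: h. Qed.

Lemma ediam0 (d : \bar R) : ediam (set0 : set 'rV[R]_n) <= d.
Proof. exact: ediam_le. Qed.

Lemma ediam_ge0 A x : A x -> 0 <= ediam A.
Proof.
by move=> Ax; apply: le_trans (ediam_ge Ax Ax); rewrite lee_fin enorm_ge0.
Qed.

Let gamma : R := (ball_volume R s / 2 ^+ s)%R.

Let gamma_ge0 : (0 <= gamma)%R.
Proof. by rewrite divr_ge0 ?ball_volume_ge0// exprn_ge0. Qed.

Lemma hausdorff_gauge_le A (d : R) : (0 <= d)%R -> ediam A <= d%:E ->
  gauge A <= (ball_volume R s / 2 ^+ s * d ^+ s)%:E.
Proof.
move=> d0 Ad; rewrite /hausdorff_gauge; case: eqP => [_|/eqP/set0P[x Ax]].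
  by rewrite lee_fin mulr_ge0// exprn_ge0.
rewrite [leRHS]EFinM; apply: lee_wpmul2l; first by rewrite lee_fin.
have := ediam_ge0 Ax; case: (ediam A) Ad => [r| |]//.
by rewrite !lee_fin => rd r0; rewrite -EFin_expe lee_fin lerXn2r// nnegrE.
Qed.

Lemma ediam_lipschitz (phi : 'rV[R]_n -> 'rV[R]_n) (a : R) A :
  (0 < a)%R -> (forall x y, enorm (phi x - phi y) <= a * enorm (x - y))%R ->
  ediam (phi @` A) <= a%:E * ediam A.
Proof.
move=> a0 lip; apply: ediam_le => _ _ [x Ax <-] [y Ay <-].
apply: (@le_trans _ _ (a * enorm (x - y))%:E); first by rewrite lee_fin.
rewrite EFinM; apply: lee_wpmul2l; first by rewrite lee_fin ltW.
exact: ediam_ge.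
Qed.

Lemma hausdorff_gauge_lipschitz (phi : 'rV[R]_n -> 'rV[R]_n) (a : R) A :
  (0 < a)%R -> (forall x y, enorm (phi x - phi y) <= a * enorm (x - y))%R ->
  gauge (phi @` A) <= (a ^+ s)%:E * gauge A.
Proof.
move=> a0 lip; rewrite /hausdorff_gauge.
have [->|/set0P[x Ax]] := eqVneq A set0; first by rewrite image_set0 eqxx mule0.
rewrite ifF; last by apply/negbTE/set0P; exists (phi x), x.
rewrite muleCA; apply: lee_wpmul2l; first by rewrite lee_fin.
have : 0 <= ediam (phi @` A) by apply: (@ediam_ge0 _ (phi x)); exists x.
have := ediam_lipschitz A a0 lip.
move: (ediam_ge0 Ax); case: (ediam A) => [d| |]// d0.
  case: (ediam _) => [r| |]//; rewrite !lee_fin => rd r0.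
  by rewrite -!EFin_expe -EFinM lee_fin -exprMn lerXn2r// nnegrE (le_trans r0).
case: s => [|m]; first by rewrite !expe0 expr0 mul1e.
by rewrite (_ : +oo ^+ m.+1 = +oo) ?gt0_muley ?leey// ?lte_fin ?exprn_gt0//;
  elim: m => // m ih; rewrite expeS ih.
Qed.

(* The content that generates the premeasure in the sense of Caratheodory. *)
Let cut delta C := if ediam C <= delta%:E then gauge C else +oo.

Let cut_ge0 delta C : 0 <= cut delta C.
Proof. by rewrite /cut; case: ifP => // _; exact: hausdorff_gauge_ge0. Qed.

Let cut0 delta : cut delta set0 = 0.
Proof. by rewrite /cut ediam0 hausdorff_gauge0. Qed.

Let E := g_sigma_algebraType [set: set 'rV[R]_n].

Let premeasureE delta : premeasure delta = @mu_ext _ E R (cut delta).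
Proof.
apply/funext => A; apply/eqP; rewrite eq_le; apply/andP; split;
  apply: le_ereal_inf_tmp.
- move=> _ [C [mC AC] <-].
  have [h|/existsNP[i /negP h]] := pselect (forall i, ediam (C i) <= delta%:E).
    apply: ereal_inf_lbound; exists C => //.
    by apply: eq_eseriesr => i _; rewrite /cut h.
  rewrite (@eseries_pinfty _ _ xpredT i) ?leey /cut ?(negbTE h)// => j _.
  by rewrite -ltNye (lt_le_trans _ (cut_ge0 delta _)).
- move=> _ [C [AC dC] <-]; apply: ereal_inf_lbound; exists C.
    by split=> // i; exact: sub_gen_smallest.
  by apply: eq_eseriesr => i _; rewrite /cut dC.
Qed.

Lemma premeasure0 delta : premeasure delta set0 = 0.
Proof. by rewrite premeasureE; exact: (@mu_ext0 _ E R _ (cut0 _) (cut_ge0 _)). Qed.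

Lemma premeasure_ge0 delta A : 0 <= premeasure delta A.
Proof. by rewrite premeasureE; exact: (@mu_ext_ge0 _ E R _ (cut_ge0 _)). Qed.

Lemma le_premeasure delta : {homo premeasure delta : A B / A `<=` B >-> A <= B}.
Proof. by move=> A B AB; rewrite premeasureE; exact: le_mu_ext. Qed.

Lemma premeasure_sigma_subadditive delta : sigma_subadditive (premeasure delta).
Proof.
rewrite premeasureE; exact: (@mu_ext_sigma_subadditive _ E R _ (cut_ge0 delta)).
Qed.

Lemma premeasure_le_gauge delta A :
  ediam A <= delta%:E -> premeasure delta A <= gauge A.
Proof.
move=> dA; apply: ereal_inf_lbound; exists (fun i => if i == 0%N then A else set0).
  split=> [x Ax|[|i]]//; [by exists 0%N|exact: ediam0].
rewrite (@nneseries_split _ _ 0 1); last by move=> k _; exact: hausdorff_gauge_ge0.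
rewrite add0n big_nat1 eseries0 ?adde0// => -[]// i _ _; exact: hausdorff_gauge0.
Qed.

(** Each premeasure is the outer measure generated by a content, hence it is
    subadditive at a fixed scale delta. *)
Lemma premeasure_le_bigsum delta (I : Type) (r : seq I) (F : I -> set 'rV[R]_n) :
  premeasure delta (\big[setU/set0]_(i <- r) F i) <=
    \sum_(i <- r) premeasure delta (F i).
Proof.
elim: r => [|i r ih]; first by rewrite !big_nil premeasure0.
rewrite !big_cons (le_trans _ (leeD2l _ ih))//.
pose G (k : nat) := nth set0 [:: F i; \big[setU/set0]_(j <- r) F j] k.
have := @premeasure_sigma_subadditive delta G.
rewrite (@nneseries_split _ _ 0 2); last by move=> k _; exact: premeasure_ge0.
rewrite add0n eseries0 ?adde0; last first.
  by move=> [|[|k]]// _ _; rewrite /G/= nth_nil premeasure0.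
rewrite big_nat_recr//= big_nat1 /G/= => h; apply: le_trans h.
by apply: le_premeasure => x [Fx|Fx]; [exists 0%N|exists 1%N].
Qed.

Lemma premeasure_le_hausdorff delta A :
  (0 < delta)%R -> premeasure delta A <= hausdorff A.
Proof. by move=> d0; apply: ereal_sup_ubound; exists delta. Qed.

Lemma premeasure_anti A (d d' : R) :
  (d <= d')%R -> premeasure d' A <= premeasure d A.
Proof.
move=> dd; apply: le_ereal_inf_tmp => _ [C [AC dC] <-].
apply: ereal_inf_lbound; exists C => //; split=> // i.
by rewrite (le_trans (dC i)).
Qed.

Lemma hausdorff_lipschitz (phi : 'rV[R]_n -> 'rV[R]_n) (a : R) A :
  (0 < a)%R -> (forall x y, enorm (phi x - phi y) <= a * enorm (x - y))%R ->
  hausdorff (phi @` A) <= (a ^+ s)%:E * hausdorff A.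
Proof.
move=> a0 lip; apply: ge_ereal_sup => _ [d /= d0 <-].
apply: (@le_trans _ _ ((a ^+ s)%:E * premeasure (d / a) A)); last first.
  apply: lee_wpmul2l; first by rewrite lee_fin exprn_ge0// ltW.
  by apply: premeasure_le_hausdorff; rewrite divr_gt0.
rewrite -lee_pdivrMl ?exprn_gt0//; apply: le_ereal_inf_tmp => _ [C [AC dC] <-].
rewrite lee_pdivrMl ?exprn_gt0// -nneseriesZl; last first.
  by move=> i _; exact: hausdorff_gauge_ge0.
apply: (@le_trans _ _ (\sum_(i <oo) gauge (phi @` C i))); last first.
  apply: lee_nneseries => i _; first by move=> _; exact: hausdorff_gauge_ge0.
  exact: hausdorff_gauge_lipschitz.
apply: ereal_inf_lbound; exists (fun i => phi @` C i) => //; split=> [_ [x Ax <-]|i].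
  by have [i _ Cx] := AC x Ax; exists i => //; exists x.
apply: le_trans (ediam_lipschitz (C i) a0 lip) _.
by rewrite -lee_pdivlMl// -EFinM mulrC.
Qed.

Lemma premeasure_separated A B (d e : R) : (d < e)%R ->
  (forall x y, A x -> B y -> e <= enorm (x - y))%R ->
  premeasure d A + premeasure d B <= premeasure d (A `|` B).
Proof.
move=> de sep; apply: le_ereal_inf_tmp => _ [C [ABC dC] <-].
pose meets i := `[< C i `&` A !=set0 >].
pose C1 i := if meets i then C i else set0.
pose C2 i := if meets i then set0 else C i.
rewrite (_ : \sum_(i <oo) _ = \sum_(i <oo) (gauge (C1 i) + gauge (C2 i))); last first.
  apply: eq_eseriesr => i _; rewrite /C1 /C2.
  by case: ifP => _; rewrite hausdorff_gauge0 ?adde0 ?add0e.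
rewrite nneseriesD; try by move=> i _ _; exact: hausdorff_gauge_ge0.
apply: leeD; apply: ereal_inf_lbound.
- exists C1 => //; split=> [x Ax|i]; last by rewrite /C1; case: ifP => // _; exact: ediam0.
  have [i _ Cx] := ABC x (or_introl Ax); exists i => //; rewrite /C1 ifT//.
  by apply/asboolP; exists x.
- exists C2 => //; split=> [y By|i]; last by rewrite /C2; case: ifP => // _; exact: ediam0.
  have [i _ Cy] := ABC y (or_intror By); exists i => //; rewrite /C2 ifF//.
  apply/negbTE/negP => /asboolP[x [Cx Ax]].
  have := le_trans (ediam_ge Cx Cy) (dC i); rewrite lee_fin leNgt.
  by rewrite (lt_le_trans de)// sep.
Qed.

(** Covers by sets of diameter less than the gap split into two parts. *)
Lemma hausdorff_separated A B (e : R) : (0 < e)%R ->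
  (forall x y, A x -> B y -> e <= enorm (x - y))%R ->
  hausdorff A + hausdorff B <= hausdorff (A `|` B).
Proof.
move=> e0 sep.
have [->|ABoo] := eqVneq (hausdorff (A `|` B)) +oo; first by rewrite leey.
have fin C : C `<=` A `|` B -> hausdorff C \is a fin_num.
  move=> CAB; rewrite ge0_fin_numE ?hausdorff_ge0//.
  by apply: le_lt_trans (le_hausdorff _ CAB) _; rewrite ltey.
have fA := fin A (@subsetUl _ _ _); have fB := fin B (@subsetUr _ _ _).
apply/lee_addgt0Pr => r r0; have r20 : (0 < r / 2)%R by rewrite divr_gt0.
have [_ [dA /= dA0 <-]] := ub_ereal_sup_adherent r20 fA.
have [_ [dB /= dB0 <-]] := ub_ereal_sup_adherent r20 fB.
rewrite -!/(hausdorff _) => hB hA.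
pose d := (Num.min (Num.min dA dB) (e / 2))%R.
have dle : [/\ (d <= dA)%R, (d <= dB)%R, (d < e)%R & (0 < d)%R].
  rewrite /d !ge_min !lexx ?orbT/= gt_min !lt_min dA0 dB0 divr_gt0//.
  by split=> //; apply/orP; right; lra.
have [ddA ddB de d0] := dle.
have := premeasure_separated de sep.
move=> /le_trans/(_ (premeasure_le_hausdorff (A `|` B) d0)) h.
rewrite -leeBlDr//; apply: le_trans h.
rewrite (splitr r) EFinD fin_num_oppeD// addeACA.
by apply: leeD; [apply: le_trans (premeasure_anti A ddA)|
  apply: le_trans (premeasure_anti B ddB)]; exact: ltW.
Qed.

End hausdorff_theory.

(** * Closed sets are measurable *)

Section caratheodory_closed.
Local Open Scope ereal_scope.
Context {R : realType} {n : nat}.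
Variable s : nat.
Local Notation hausdorff := (@hausdorff R n s).

Lemma hausdorff_separated_seq (D : nat -> set 'rV[R]_n) (X : set 'rV[R]_n) :
  (forall k, D k `<=` X) ->
  (forall i j, (i < j)%N -> exists2 e : R, (0 < e)%R &
     forall x y, D i x -> D j y -> (e <= enorm (x - y))%R) ->
  forall N, \sum_(0 <= k < N) hausdorff (D k) <= hausdorff X.
Proof.
move=> DX sep N.
suff h : \sum_(0 <= k < N) hausdorff (D k) <=
    hausdorff (\big[setU/set0]_(0 <= k < N) D k).
  apply: le_trans h (le_hausdorff _ _); rewrite big_mkord => x.
  by rewrite -bigcup_mkord => -[k _ /DX].
elim: N => [|N ih]; first by rewrite !big_nil hausdorff0.
rewrite !big_nat_recr//= (le_trans (leeD2r _ ih))//.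
suff [e e0 he] : exists2 e : R, (0 < e)%R & forall x y,
    (\big[setU/set0]_(0 <= k < N) D k) x -> D N y -> (e <= enorm (x - y))%R.
  exact: hausdorff_separated e0 he.
have H : forall M, (M <= N)%N -> exists2 e : R, (0 < e)%R & forall x y,
    (\big[setU/set0]_(0 <= k < M) D k) x -> D N y -> (e <= enorm (x - y))%R.
  elim=> [_|M ihM MN]; first by exists 1%R => // x y; rewrite big_nil.
  have [e e0 he] := ihM (ltnW MN); have [e' e'0 he'] := sep _ _ MN.
  exists (Num.min e e'); first by rewrite lt_min e0.
  move=> x y; rewrite big_nat_recr//= => -[xD|xD] yD.
    by rewrite ge_min he.
  by rewrite ge_min he' ?orbT.
exact: H.
Qed.

(** Caratheodory's criterion for metric outer measures. The part of X outside
    the closed set C is exhausted by the layers at distance at least 1/(k+1)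
    from C; the successive differences of the layers are separated as soon as
    their indices differ by two, so that their measures form a convergent
    series. *)
Lemma closed_caratheodory (C : set 'rV[R]_n) :
  closed C -> hausdorff.-caratheodory C.
Proof.
move=> cC; apply: le_caratheodory_measurable => X.
rewrite -[leRHS]/(hausdorff X) -![_ (_ `&` _)]/(hausdorff _).
have [->|Xoo] := eqVneq (hausdorff X) +oo; first by rewrite leey.
have Xfin : hausdorff X < +oo by rewrite ltey.
have fin Y : Y `<=` X -> hausdorff Y \is a fin_num.
  by move=> YX; rewrite ge0_fin_numE ?hausdorff_ge0// (le_lt_trans (le_hausdorff _ YX)).
pose layer k := [set x | X x /\ forall c, C c -> (k.+1%:R^-1 <= enorm (x - c))%R].
have layerS k : layer k `<=` layer k.+1.
  move=> x [Xx h]; split=> // c /h; apply: le_trans.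
  by rewrite lef_pV2 ?posrE// ler_nat.
pose D k := layer k.+1 `\` layer k.
have layerX k : layer k `<=` X by move=> x [].
have DX k : D k `<=` X by move=> x [/layerX].
have sep i j : (i.+1 < j)%N -> exists2 e : R, (0 < e)%R &
    forall x y, D i x -> D j y -> (e <= enorm (x - y))%R.
  move=> ij; exists (i.+2%:R^-1 - j.+1%:R^-1)%R.
    by rewrite subr_gt0 ltf_pV2 ?posrE// ltr_nat.
  move=> x y [[_ hx] _] [[Xy _] hy].
  have /existsNP[c /not_implyP[Cc /negP]] :
      ~ forall c, C c -> (j.+1%:R^-1 <= enorm (y - c))%R by move=> h; apply: hy.
  rewrite -ltNge => yc.
  have h1 := hx c Cc; have h2 := enorm_dist x y c.
  rewrite lerBlDr; apply: le_trans h1 _; apply: le_trans h2 _; rewrite lerD2l; exact: ltW.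
have sumD : \sum_(0 <= k <oo) hausdorff (D k) < +oo.
  apply: (@le_lt_trans _ _ (hausdorff X + hausdorff X)); last exact: lte_add_pinfty.
  apply: lime_le.
    by apply: is_cvg_nneseries => k _ _; exact: hausdorff_ge0.
  near=> N.
  apply: (@le_trans _ _ (\sum_(0 <= k < N.*2) hausdorff (D k))).
    rewrite (@big_cat_nat _ _ _ N 0 N.*2)//= -?addnn ?leq_addr//.
    by rewrite leeDl// sume_ge0// => k _; exact: hausdorff_ge0.
  have -> : \sum_(0 <= k < N.*2) hausdorff (D k) =
     \sum_(0 <= k < N) hausdorff (D k.*2) + \sum_(0 <= k < N) hausdorff (D k.*2.+1).
    elim: {+}N => [|M ih]; first by rewrite !big_nil adde0.
    by rewrite doubleS !big_nat_recr//= ih addeACA addeA.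
  by apply: leeD; apply: (hausdorff_separated_seq (D := fun k => D _)) => //
    i j ij; apply: sep; rewrite ?ltnS ?ltn_double// -doubleS leq_double.
have XC : X `&` ~` C = \bigcup_k layer k.
  apply/seteqP; split=> [x [Xx Cx]|x [k _ [Xx h]]].
    have /nbhs_enorm[e e0 he] : nbhs x (~` C).
      by apply: open_nbhs_nbhs; split=> //; exact: closed_openC.
    exists (Num.truncn e^-1) => //; split=> // c Cc.
    rewrite leNgt; apply/negP => xc; apply: (he c) => //.
    rewrite enormB (lt_trans xc)// invf_plt ?posrE//.
    exact: Num.Theory.truncnS_gt.
  split=> // Cx; have := h x Cx.
  by rewrite subrr enorm0 leNgt invr_gt0 ltr0n.
have layer_sub k : X `&` ~` C `<=` layer k `|` \bigcup_(j in ~` `I_k) D j.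
  rewrite XC => x [m _].
  elim: m => [|m ih] h.
    by left; elim: k => // k; exact: layerS.
  have [/ih//|xm] := pselect (layer m x).
  have [km|mk] := leqP k m; first by right; exists m => //=; apply/negP; rewrite -leqNgt.
  left; rewrite -(subnK mk) addnC.
  by elim: (k - m.+1)%N => [|i ihi]; rewrite ?addn0// addnS; exact: layerS.
apply/lee_addgt0Pr => r r0.
have [k tail] : exists k, \sum_(k <= j <oo) hausdorff (D j) < r%:E.
  have /(_ [set x | x < r%:E]) := nneseries_tail_cvg sumD (fun k _ => hausdorff_ge0 s (D k)).
  case=> [|k _ hk]; last by exists k; apply: hk => /=.
  by apply: open_nbhs_nbhs; split; [exact: open_ereal_lt_ereal|rewrite /= lte_fin].
have hXC : hausdorff (X `&` ~` C) <= hausdorff (layer k) + r%:E.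
  apply: le_trans (le_hausdorff _ (layer_sub k)) _.
  apply: le_trans (outer_measureU2 _ _ _) _; apply: leeD2l.
  by apply: le_trans (outer_measure_sigma_subadditive_tail _ _ _) (ltW tail).
apply: (le_trans (leeD2l _ hXC)); rewrite addeA; apply: leeD2r.
have sepk : forall x y, (X `&` C) x -> layer k y -> (k.+1%:R^-1 <= enorm (x - y))%R.
  by move=> x y [_ Cx] [_ h]; rewrite enormB h.
apply: le_trans (@hausdorff_separated _ _ _ _ _ _ _ sepk) _; first by rewrite invr_gt0.
by apply: le_hausdorff => x [[]|/layerX].
Unshelve. all: by end_near. Qed.

End caratheodory_closed.

(** * The integral of functions that need not be measurable *)

Section lower_integral.
Local Open Scope ereal_scope.
Context d (T : measurableType d) (R : realType) (mu : {measure set T -> \bar R}).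
Import HBNNSimple.
Implicit Types (f g : T -> \bar R) (D : set T).

Lemma ge0_integral_bounded D f (M : R) : measurable D -> (0 <= M)%R ->
  (forall x, D x -> 0 <= f x <= M%:E) -> \int[mu]_(x in D) f x <= M%:E * mu D.
Proof.
move=> mD M0 fM; rewrite ge0_integralE; last by move=> x /fM/andP[].
apply: ge_ereal_sup => _ [h /= hf <-].
pose k := scale_nnsfun (indic_nnsfun R mD) M0.
have -> : M%:E * mu D = sintegral mu k.
  rewrite -(sintegral_indic mu D) (_ : \1_D = indic_nnsfun R mD :> (T -> R))//.
  by rewrite -sintegralrM.
apply: le_sintegral => x; rewrite -lee_fin (le_trans (hf x))// /k /=.
rewrite mindicE /patch; case: ifPn => [|_]; last by rewrite mulr0.
by rewrite inE mulr1 => /fM/andP[].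
Qed.

Lemma ge0_integral_null D f : measurable D -> mu D = 0 ->
  (forall x, 0 <= f x) -> \int[mu]_(x in D) f x = 0.
Proof.
move=> mD D0 f0; apply/eqP; rewrite eq_le integral_ge0// andbT.
rewrite ge0_integralE//; apply: ge_ereal_sup => _ [h /= hf <-].
have -> : sintegral mu h = sintegral mu (proj_nnsfun h mD).
  apply: eq_sintegral => x /=; rewrite mindicE.
  have [_|xD] := boolP (x \in D); first by rewrite mulr1.
  rewrite mulr0; apply/eqP; rewrite eq_le fun_ge0 andbT -lee_fin.
  by rewrite (le_trans (hf x))// /patch (negbTE xD).
rewrite sintegralE fsbig1// => r _; have [->|r0] := eqVneq r 0%R; first by rewrite mul0e.
rewrite (_ : mu _ = 0) ?mule0//; apply/eqP; rewrite eq_le measure_ge0 andbT -D0.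
apply: le_measure; rewrite ?inE//.
move=> x /=; rewrite mindicE; have [|] := boolP (x \in D); first by rewrite inE.
by move=> _; rewrite mulr0 => /esym/eqP; rewrite (negbTE r0).
Qed.

Lemma ereal_supD_le (A B : set (\bar R)) (M : \bar R) :
  A !=set0 -> B !=set0 ->
  (forall a, A a -> 0 <= a) -> (forall b, B b -> 0 <= b) ->
  (forall a b, A a -> B b -> a + b <= M) -> ereal_sup A + ereal_sup B <= M.
Proof.
move=> [a0 Aa0] [b0 Bb0] A0 B0 ABM.
have [->|Moo] := eqVneq M +oo; first by rewrite leey.
have leM a b : A a -> B b -> a <= M /\ b <= M.
  move=> Aa Bb; have := ABM _ _ Aa Bb => h; split; apply: le_trans h.
    by rewrite leeDl ?B0.
  by rewrite leeDr ?A0.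
have fin x : 0 <= x -> x <= M -> x \is a fin_num.
  by move=> x0 xM; rewrite ge0_fin_numE// (le_lt_trans xM)// ltey.
have finA : ereal_sup A \is a fin_num.
  apply: fin; first by apply: le_trans (A0 _ Aa0) _; exact: ereal_sup_ubound.
  by apply: ge_ereal_sup => a Aa; have [] := leM a b0 Aa Bb0.
rewrite addeC -leeBrDr//; apply: ge_ereal_sup => b Bb.
have finb : b \is a fin_num by apply: fin; [exact: B0|have [] := leM _ _ Aa0 Bb].
rewrite leeBrDr// addeC -leeBrDr//; apply: ge_ereal_sup => a Aa.
by rewrite leeBrDr// ABM.
Qed.

(** No measurability of f is needed: the restrictions of a simple function to
    two measurable sets are simple. *)
Lemma ge0_lower_integral_setU D1 D2 f : measurable D1 -> measurable D2 ->
  D1 `&` D2 = set0 -> (forall x, 0 <= f x) ->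
  \int[mu]_(x in D1 `|` D2) f x = \int[mu]_(x in D1) f x + \int[mu]_(x in D2) f x.
Proof.
move=> mD1 mD2 D12 f0; have dis x : x \in D1 -> x \in D2 = false.
  by rewrite inE => x1; apply/negbTE; rewrite notin_setE => x2; rewrite -[False]/(set0 x) -D12.
rewrite !ge0_integralE//; apply/eqP; rewrite eq_le; apply/andP; split.
- apply: ge_ereal_sup => _ [h /= hf <-].
  have -> : sintegral mu h =
      sintegral mu (proj_nnsfun h mD1) + sintegral mu (proj_nnsfun h mD2).
    rewrite -sintegralD; apply: eq_sintegral => x /=; rewrite !mindicE.
    have := hf x; rewrite /patch in_setU.
    have [/dis ->|x1 /=] := boolP (x \in D1); first by rewrite mulr1 mulr0 addr0.
    case: (x \in D2) => /= [_|]; first by rewrite mulr0 mulr1 add0r.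
    by rewrite lee_fin mulr0 addr0 => h0; apply/eqP; rewrite eq_le h0 fun_ge0.
  have hD D (mD : measurable D) x : D `<=` D1 `|` D2 ->
      (proj_nnsfun h mD x)%:E <= (f \_ D) x.
    move=> DD; have := hf x; rewrite /= mindicE /patch.
    have [xD|xD] := boolP (x \in D); last by rewrite mulr0.
    by rewrite mem_set ?mulr1//; apply: DD; rewrite -inE.
  by apply: leeD; apply: ereal_sup_ubound; eexists; try reflexivity;
    move=> x; apply: hD => y; [left|right].
- apply: ereal_supD_le; try by (exists (sintegral mu (@nnsfun0 _ T R)); exists nnsfun0 => //= x;
    rewrite /patch; case: ifP).
  + by move=> _ [h _ <-]; exact: sintegral_ge0.
  + by move=> _ [h _ <-]; exact: sintegral_ge0.
  move=> _ _ [h /= hf <-] [k /= kf <-]; rewrite -sintegralD.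
  apply: ereal_sup_ubound; exists (add_nnsfun h k) => //= x.
  have := hf x; have := kf x; rewrite /patch in_setU EFinD.
  case: (boolP (x \in D1)) => [/dis ->|x1] /=.
    by move=> ? ?; rewrite -[leRHS]adde0 leeD.
  by case: ifP => _ ? ?; rewrite -[leRHS]add0e leeD.
Qed.

End lower_integral.

Section comp_nnsfun.
Context d (T : measurableType d) (R : realType).
Import HBNNSimple.
Variables (h : {nnsfun T >-> R}) (psi : T -> T) (mpsi : measurable_fun setT psi).

Lemma comp_nnsfun_exists : exists k : {nnsfun T >-> R}, k =1 h \o psi.
Proof.
have mk : measurable_fun setT (h \o psi) by apply: measurableT_comp.
have fk : finite_set (range (h \o psi)).
  by apply: sub_finite_set (@fimfunP _ _ h) => _ [x _ <-]; exists (psi x).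
have k0 x : 0 <= (h \o psi) x by exact: fun_ge0.
pose m := isMeasurableFun.Build _ _ T R (h \o psi) mk.
pose i := FiniteImage.Build T R (h \o psi) fk.
pose n := @isNonNegFun.Build T R (h \o psi) k0.
pose k : {nnsfun T >-> R} := HB.pack (h \o psi) m i n.
by exists k.
Qed.
End comp_nnsfun.

Section transport.
Local Open Scope ereal_scope.
Context d (T : measurableType d) (R : realType) (mu : {measure set T -> \bar R}).
Import HBNNSimple.
Variables (phi psi : T -> T) (c : R).
Hypothesis psiK : cancel psi phi.
Hypothesis mpsi : measurable_fun setT psi.
Hypothesis c_ge0 : (0 <= c)%R.
Hypothesis mu_psi : forall S, measurable S -> mu (psi @^-1` S) = c%:E * mu S.

(** A simple function below f is transported to a simple function below g. *)
Lemma ge0_lower_integral_transport_le (D : set T) (f g : T -> \bar R) (b : R) :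
  (0 <= b)%R -> (forall x, 0 <= f x) -> (forall x, 0 <= g x) ->
  (forall x, D x -> g (phi x) = b%:E * f x) ->
  (b * c)%:E * \int[mu]_(x in D) f x <= \int[mu]_(x in psi @^-1` D) g x.
Proof.
move=> b0 f0 g0 gf.
have [->|bc0] := eqVneq (b * c)%R 0%R; first by rewrite mul0e integral_ge0.
have bc : (0 < b * c)%R by rewrite lt0r bc0 mulr_ge0.
rewrite -lee_pdivlMl// !ge0_integralE//; apply: ge_ereal_sup => _ [h /= hf <-].
rewrite lee_pdivlMl//; have [k kE] := comp_nnsfun_exists h mpsi.
apply: ereal_sup_ubound; exists (scale_nnsfun k b0) => [x|] /=.
  rewrite kE /=; have := hf (psi x); rewrite /patch.
  have -> : (x \in psi @^-1` D) = (psi x \in D) by apply/idP/idP; rewrite !inE.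
  case: ifPn => [|_].
    by rewrite inE => /gf; rewrite psiK => ->; rewrite EFinM; exact: lee_wpmul2l.
  by rewrite !lee_fin => h0; rewrite mulr_ge0_le0.
rewrite sintegralrM EFinM -muleA; congr (_ * _).
rewrite (eq_sintegral (h \o psi))// !sintegralET ge0_mule_fsumr; last first.
  by move=> r; exact: nnsfun_mulemu_ge0.
apply: eq_fsbigr => r _; rewrite comp_preimage mu_psi; last exact: measurable_sfunP.
by rewrite muleCA.
Qed.
End transport.

Section lower_Rintegral.
Context d (T : measurableType d) (R : realType) (mu : {measure set T -> \bar R}).
Implicit Types (f g : T -> R) (D N : set T).

Lemma RintegralE f D : \int[mu]_(x in D) f x =
  fine (\int[mu]_(x in D) (Num.max (f x) 0)%:E -
        \int[mu]_(x in D) (Num.max (- f x) 0)%:E)%E.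
Proof.
rewrite /Rintegral integralE; congr (fine (_ - _)%E); apply: eq_integral => x _.
  by rewrite funeposE -EFin_max.
by rewrite funenegE -EFin_max.
Qed.

(** The bound makes the integrals of the positive and negative parts finite, so
    that no indeterminate difference is taken. *)
Lemma lower_Rintegral_setU D1 D2 f (M : R) : measurable D1 -> measurable D2 ->
  D1 `&` D2 = set0 -> (mu D1 < +oo)%E -> (mu D2 < +oo)%E ->
  (forall x, (D1 `|` D2) x -> `|f x| <= M) ->
  \int[mu]_(x in D1 `|` D2) f x = \int[mu]_(x in D1) f x + \int[mu]_(x in D2) f x.
Proof.
move=> mD1 mD2 D12 D1oo D2oo fM.
have fin D (g : T -> R) : measurable D -> D `<=` D1 `|` D2 -> (mu D < +oo)%E ->
    (forall x, g x <= `|f x|) ->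
    (\int[mu]_(x in D) (Num.max (g x) 0)%:E)%E \is a fin_num.
  move=> mD DD Doo gf; rewrite ge0_fin_numE; last first.
    by apply: integral_ge0 => x _; rewrite lee_fin le_max lexx orbT.
  apply: (@le_lt_trans _ _ ((`|M|)%:E * mu D)%E).
    apply: ge0_integral_bounded => // x Dx.
    rewrite !lee_fin le_max lexx orbT ge_max normr_ge0 andbT/=.
    by rewrite (le_trans (gf x))// (le_trans (fM _ (DD _ Dx)))// ler_norm.
  by rewrite lte_mul_pinfty// ?lee_fin.
have pos x : f x <= `|f x| by exact: ler_norm.
have neg x : - f x <= `|f x| by rewrite -normrN ler_norm.
have s1 : D1 `<=` D1 `|` D2 by exact: subsetUl.
have s2 : D2 `<=` D1 `|` D2 by exact: subsetUr.
rewrite !RintegralE !ge0_lower_integral_setU//; try by move=> x;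
  rewrite lee_fin le_max lexx orbT.
have p1 := fin D1 f mD1 s1 D1oo pos; have p2 := fin D2 f mD2 s2 D2oo pos.
have n1 := fin D1 (\- f) mD1 s1 D1oo neg; have n2 := fin D2 (\- f) mD2 s2 D2oo neg.
move: p1 p2 n1 n2 => /= /fineK <- /fineK <- /fineK <- /fineK <-.
rewrite -!EFinD -?EFinN -?EFinD /=.
ring.
Qed.

Lemma lower_Rintegral_ae D N f g : measurable D -> measurable N ->
  N `<=` D -> mu N = 0%E -> (forall x, (D `\` N) x -> f x = g x) ->
  \int[mu]_(x in D) f x = \int[mu]_(x in D) g x.
Proof.
move=> mD mN ND N0 fg.
suff h (f' g' : T -> R) : (forall x, (D `\` N) x -> f' x = g' x) ->
    (\int[mu]_(x in D) (Num.max (f' x) 0)%:E =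
     \int[mu]_(x in D) (Num.max (g' x) 0)%:E)%E.
  rewrite !RintegralE (h f g)// (h (\- f) (\- g))// => x Dx /=.
  by rewrite fg.
move=> {}fg; rewrite -(setDUK ND).
rewrite !ge0_lower_integral_setU//; first last.
- by move=> x; rewrite lee_fin le_max lexx orbT.
- by rewrite setDE setICA setICr setI0.
- exact: measurableD.
- by move=> x; rewrite lee_fin le_max lexx orbT.
- by rewrite setDE setICA setICr setI0.
- exact: measurableD.
congr (_ + _)%E; last by apply: eq_integral => x; rewrite inE => /fg ->.
by rewrite !ge0_integral_null// => x; rewrite lee_fin le_max lexx orbT.
Qed.

Lemma lower_Rintegral_transport (phi psi : T -> T) (b c : R) D f g :
  cancel phi psi -> cancel psi phi ->
  measurable_fun setT phi -> measurable_fun setT psi -> 0 < b -> 0 < c ->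
  (forall S, measurable S -> mu (psi @^-1` S) = c%:E * mu S)%E ->
  (forall x, D x -> g (phi x) = b * f x) ->
  \int[mu]_(x in psi @^-1` D) g x = b * c * \int[mu]_(x in D) f x.
Proof.
move=> phiK psiK mphi mpsi b0 c0 mu_psi gf.
have bc : 0 < b * c by rewrite mulr_gt0.
suff h (f' g' : T -> R) : (forall x, D x -> g' (phi x) = b * f' x) ->
    (\int[mu]_(x in psi @^-1` D) (Num.max (g' x) 0)%:E =
     (b * c)%:E * \int[mu]_(x in D) (Num.max (f' x) 0)%:E)%E.
  rewrite !RintegralE (h f g)// (h (\- f) (\- g)); last first.
    by move=> x /gf /= ->; rewrite mulrN.
  case: integral => [x| |]; case: integral => [y| |];
    rewrite ?gt0_muley ?gt0_muleNy ?lte_fin//= ?mulr0//.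
  ring.
move=> {}gf; apply/eqP; rewrite eq_le; apply/andP; split.
  rewrite -lee_pdivrMl// invfM.
  have {2}-> : D = phi @^-1` (psi @^-1` D).
    by apply/seteqP; split=> x; rewrite /preimage/= phiK.
  apply: (@ge0_lower_integral_transport_le _ T R mu psi phi) => //.
  - by rewrite invr_ge0 ltW.
  - move=> S mS; rewrite -[in RHS](_ : psi @^-1` (phi @^-1` S) = S); last first.
      by apply/seteqP; split=> x; rewrite /preimage/= psiK.
    rewrite mu_psi; last by rewrite -[_ @^-1` _]setTI; exact: mphi.
    by rewrite muleA -EFinM mulVf ?gt_eqF// mul1e.
  - by rewrite invr_ge0 ltW.
  - by move=> x; rewrite lee_fin le_max lexx orbT.
  - by move=> x; rewrite lee_fin le_max lexx orbT.
  - move=> x /gf; rewrite psiK => ->.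
    by rewrite -EFinM maxr_pMr ?invr_ge0 ?ltW// mulr0 mulKf// gt_eqF.
apply: ge0_lower_integral_transport_le => //.
- exact: ltW.
- exact: ltW.
- by move=> x; rewrite lee_fin le_max lexx orbT.
- by move=> x; rewrite lee_fin le_max lexx orbT.
- by move=> x /gf ->; rewrite -EFinM maxr_pMr ?ltW// mulr0.
Qed.

End lower_Rintegral.

(** * Surface integrals *)

Section surface_similarity.
Context {R : realType} {n : nat}.
Variables (phi psi : 'rV[R]_n -> 'rV[R]_n) (a : R).
Hypotheses (phiK : cancel phi psi) (psiK : cancel psi phi) (a_gt0 : 0 < a).
Hypothesis phi_sim : forall x y, enorm (phi x - phi y) = a * enorm (x - y).

Let psi_sim x y : enorm (psi x - psi y) = a^-1 * enorm (x - y).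
Proof. by rewrite -{2}(psiK x) -{2}(psiK y) phi_sim mulKf// gt_eqF. Qed.

Let preimageE (f g : 'rV[R]_n -> 'rV[R]_n) (S : set 'rV[R]_n) :
  cancel f g -> cancel g f -> g @^-1` S = f @` S.
Proof.
move=> fK gK; apply/seteqP; split=> [x Sx|_ [y Sy <-]].
  by exists (g x) => //; rewrite gK.
by rewrite /preimage/= fK.
Qed.

Lemma hausdorff_similarity s (S : set 'rV[R]_n) :
  hausdorff s (psi @^-1` S) = ((a ^+ s)%:E * hausdorff s S)%E.
Proof.
apply/eqP; rewrite eq_le (preimageE _ phiK psiK); apply/andP; split.
  by apply: hausdorff_lipschitz => // x y; rewrite phi_sim.
rewrite -lee_pdivlMl ?exprn_gt0// -exprVn.
have {1}-> : S = psi @` (phi @` S).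
  by rewrite -(preimageE _ phiK psiK) -(preimageE _ psiK phiK);
    apply/seteqP; split=> x; rewrite /preimage/= phiK.
by apply: hausdorff_lipschitz; rewrite ?invr_gt0// => x y; rewrite psi_sim.
Qed.

Lemma caratheodory_similarity s (S : set 'rV[R]_n) :
  (@hausdorff R n s).-caratheodory S ->
  (@hausdorff R n s).-caratheodory (psi @^-1` S).
Proof.
move=> mS X; have <- : psi @^-1` (phi @^-1` X) = X.
  by apply/seteqP; split=> x; rewrite /preimage/= psiK.
rewrite preimage_setC -!preimage_setI.
move: (mS (phi @^-1` X)); rewrite -![OuterMeasure.sort _ _]/(hausdorff s _).
rewrite !hausdorff_similarity => ->; rewrite ge0_muleDr ?hausdorff_ge0//.
Qed.
End surface_similarity.

Lemma surface_integral_similarity (R : realType) (n : nat)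
    (phi psi : 'rV[R]_n -> 'rV[R]_n) (a b : R) (D : set 'rV[R]_n)
    (f g : 'rV[R]_n -> R) :
  cancel phi psi -> cancel psi phi -> 0 < a -> 0 < b ->
  (forall x y, enorm (phi x - phi y) = a * enorm (x - y)) ->
  (forall x, D x -> g (phi x) = b * f x) ->
  \int[surface_measure]_(x in phi @` D) g x =
  b * a ^+ n.-1 * \int[surface_measure]_(x in D) f x.
Proof.
move=> phiK psiK a0 b0 sim gf.
have psi_sim x y : enorm (psi x - psi y) = a^-1 * enorm (x - y).
  by rewrite -{2}(psiK x) -{2}(psiK y) sim mulKf// gt_eqF.
have -> : phi @` D = psi @^-1` D.
  apply/seteqP; split=> [_ [y Sy <-]|x Sx]; first by rewrite /preimage/= phiK.
  by exists (psi x) => //; rewrite psiK.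
have mphi : @measurable_fun _ _ (caratheodory_type (@hausdorff R n n.-1))
    (caratheodory_type (@hausdorff R n n.-1)) setT phi.
  move=> _ S mS; rewrite setTI.
  have ai : 0 < a^-1 by rewrite invr_gt0.
  exact: (caratheodory_similarity psiK phiK ai psi_sim).
have mpsi : @measurable_fun _ _ (caratheodory_type (@hausdorff R n n.-1))
    (caratheodory_type (@hausdorff R n n.-1)) setT psi.
  move=> _ S mS; rewrite setTI.
  exact: (caratheodory_similarity phiK psiK a0 sim).
have an0 : 0 < a ^+ n.-1 by rewrite exprn_gt0.
exact: (@lower_Rintegral_transport _ _ R surface_measure phi psi b (a ^+ n.-1)
  D f g phiK psiK mphi mpsi b0 an0
  (fun S _ => hausdorff_similarity phiK psiK a0 sim n.-1 S) gf).
Qed.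

Lemma closed_surface_measurable (R : realType) (n : nat) (C : set 'rV[R]_n) :
  closed C -> measurable (C : set (caratheodory_type (@hausdorff R n n.-1))).
Proof. exact: closed_caratheodory. Qed.

Lemma open_surface_measurable (R : realType) (n : nat) (C : set 'rV[R]_n) :
  open C -> measurable (C : set (caratheodory_type (@hausdorff R n n.-1))).
Proof.
move=> oC; rewrite -[C]setCK; apply: measurableC.
exact: closed_surface_measurable (open_closedC oC).
Qed.

Lemma null_surface_measurable (R : realType) (n : nat) (C : set 'rV[R]_n) :
  hausdorff n.-1 C = 0%E ->
  measurable (C : set (caratheodory_type (@hausdorff R n n.-1))).
Proof.
move=> C0; apply: le_caratheodory_measurable => X.
rewrite -[leRHS]add0e; apply: leeD; last first.
  by apply: le_outer_measure => x [].
by rewrite -C0; apply: le_outer_measure => x [].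
Qed.

(** * Interior touching balls *)

Section touching_ball.
Context {R : realType} {n : nat}.
Implicit Types (x y z w u : 'rV[R]_n) (K : set 'rV[R]_n) (r : R).

Definition touching_ball K r x u : Prop :=
  outer_unit_normal K x u /\ eball (x - r *: u) r `<=` K.

Lemma eball_dot c r y : 0 <= r -> eball c r y <-> dot (y - c) (y - c) <= r ^+ 2.
Proof. by move=> r0; rewrite /eball/= enorm_le. Qed.

Lemma unit_dot_ge1 u v : enorm u = 1 -> enorm v = 1 -> 1 <= dot u v -> u = v.
Proof.
move=> /enorm1_dot uu /enorm1_dot vv uv; apply/eqP; rewrite -subr_eq0 -dotxx_eq0.
rewrite eq_le dotxx_ge0 andbT !dotE (dotC v u) uu vv; lra.
Qed.

(** Test the point of the ball in direction v from its centre. *)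
Lemma touching_ball_normals K r x u v : 0 < r -> touching_ball K r x u ->
  forall z, outer_unit_normal K z v -> r * (1 - dot u v) <= enorm (z - x).
Proof.
move=> r0 [[u1 _] ballK] z [v1 hv].
have /hv : K (x - r *: u + r *: v).
  apply: ballK; rewrite /eball/= addrC addKr enormZ v1 mulr1.
  by rewrite ger0_norm// ltW.
have := cauchy_schwarz (z - x) v; rewrite v1 mulr1.
have := enorm1_dot v1; rewrite !dotE => vv h1 h2.
by apply: le_trans h1; rewrite vv in h2; lra.
Qed.

Lemma touching_ball_normalE K r x u : 0 < r -> touching_ball K r x u ->
  normal K x = u.
Proof.
move=> r0 tb; rewrite /normal; case: xgetP => [v _ nv|/(_ u)]; last first.
  by case: tb.
have := touching_ball_normals r0 tb nv; rewrite subrr enorm0 pmulr_rle0// => h.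
by rewrite [RHS](@unit_dot_ge1 u v)//; [case: tb.1|case: nv|lra].
Qed.

Lemma touching_ball_shrink K r r' x u : 0 <= r' -> r' <= r ->
  touching_ball K r x u -> touching_ball K r' x u.
Proof.
move=> r'0 rr' [[u1 hu] ballK]; split=> // y yb; apply: ballK.
rewrite /eball/= in yb *.
rewrite (_ : y - _ = (y - (x - r' *: u)) + (r - r') *: u); last first.
  by apply/rowP => i; rewrite !mxE; ring.
apply: le_trans (enormD _ _) _; rewrite enormZ u1 mulr1 ger0_norm ?subr_ge0//.
lra.
Qed.

Lemma touching_ball_subset K L r x u : touching_ball K r x u ->
  outer_unit_normal L x u -> K `<=` L -> touching_ball L r x u.
Proof. by move=> [_ bK] nL KL; split=> //; exact: subset_trans KL. Qed.

Lemma outer_unit_normal_subset K L x u : K `<=` L ->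
  outer_unit_normal L x u -> outer_unit_normal K x u.
Proof. by move=> KL [u1 hu]; split=> // y /KL/hu. Qed.

(** The default value 0 of the normal would make the ball of the definition
    centred at x, and x an interior point; hence the normal exists. *)
Lemma inner_rolling_touching K : closed K -> inner_rolling_ball K ->
  exists2 r, 0 < r & forall x, boundary K x -> touching_ball K r x (normal K x).
Proof.
move=> cK [r r0 hr]; exists r => // x bx; split; last exact: hr.
rewrite /normal; case: xgetP => [v _ //|nov].
have /closed_boundaryP[//|_ []] := bx; apply/interior_enorm; exists r => // y xy.
have := hr x bx; apply; rewrite /eball/= /normal; case: xgetP => [v _ /nov//|_].
by rewrite scaler0 subr0 ltW.
Qed.

Lemma support_ge K r x u : 0 <= r -> eball 0 r `<=` K ->
  outer_unit_normal K x u -> r <= dot x u.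
Proof.
move=> r0 rK [u1 hu]; have /hu : K (r *: u).
  by apply: rK; rewrite /eball/= subr0 enormZ u1 mulr1 ger0_norm.
by rewrite !dotE (enorm1_dot u1); lra.
Qed.

Lemma interior_eball K x : interior K x ->
  exists2 r, 0 < r & eball x r `<=` K.
Proof.
move=> /interior_enorm[e e0 he]; exists (e / 2); first by rewrite divr_gt0.
by move=> y; rewrite /eball/= => xy; apply: he; apply: le_lt_trans xy _; lra.
Qed.

Lemma normal_boundary K x u : closed K -> K x -> outer_unit_normal K x u ->
  boundary K x.
Proof.
move=> cK Kx [u1 hu]; apply/closed_boundaryP => //; split=> //.
move=> /interior_eball[r r0 rK]; have /hu : K (x + r *: u).
  by apply: rK; rewrite /eball/= addrC addKr enormZ u1 mulr1 ger0_norm// ltW.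
by rewrite addrC addKr dotZl (enorm1_dot u1); lra.
Qed.

(** The sphere of radius r is at height at most |y|^2 / r over its tangent plane
    as long as |y| <= r. *)
Lemma touching_ball_sagitta K r x u y : 0 < r -> touching_ball K r x u ->
  dot y u = 0 -> enorm y <= r -> K (x + y - (dot y y / r) *: u).
Proof.
move=> r0 [[u1 _] bK] yu yr; apply/bK/eball_dot; first exact: ltW.
rewrite (_ : _ - _ - _ = y + (r - dot y y / r) *: u); last first.
  by apply/rowP => i; rewrite !mxE; ring.
have uu := enorm1_dot u1; rewrite !dotE (dotC u y) yu uu !(mulr0, addr0, add0r).
set q := dot y y; have q0 : 0 <= q by exact: dotxx_ge0.
have qr : q <= r ^+ 2 by rewrite -enorm_le// ltW.
have -> : q + (r - q / r) * ((r - q / r) * 1) = r ^+ 2 - q * (1 - q / r ^+ 2).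
  by field; rewrite gt_eqF.
rewrite gerBl mulr_ge0// subr_ge0 ler_pdivrMr ?mul1r//.
by rewrite exprn_gt0.
Qed.

Lemma tangent_height_ge0 K x u y t : outer_unit_normal K x u ->
  dot y u = 0 -> K (x + y - t *: u) -> 0 <= t.
Proof.
move=> [u1 hu] yu /hu; have uu := enorm1_dot u1.
rewrite !dotE yu uu; lra.
Qed.

(** A point p = z + w near a touching ball at z, on the right side of the
    tangent plane at z, enters the ball when it is moved by 4 |w|^2 / r along
    any direction close enough to the inner normal at z. *)
Lemma touching_ball_enter K r z v u w : 0 < r -> touching_ball K r z v ->
  enorm u = 1 -> 2^-1 <= dot u v -> dot w v <= 0 -> enorm w <= r / 4 ->
  K (z + w - (4 * dot w w / r) *: u).
Proof.
move=> r0 [[v1 _] bK] u1 uv wv wr; apply/bK/eball_dot; first exact: ltW.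
set s := 4 * dot w w / r; set e := enorm w.
have ee : dot w w = e ^+ 2 by rewrite sqr_enorm.
have e0 : 0 <= e by exact: enorm_ge0.
have rs : r * s = 4 * e ^+ 2.
  by rewrite /s ee; field; rewrite gt_eqF.
have s0 : 0 <= s by rewrite /s mulr_ge0 ?invr_ge0 ?(ltW r0)// mulr_ge0// dotxx_ge0.
have se : s <= e.
  rewrite -(ler_pM2l r0) rs; rewrite expr2 !mulrA ler_wpM2r//.
  by move: wr; rewrite -/e ler_pdivlMr//; lra.
rewrite (_ : _ - _ - _ = w - s *: u + r *: v); last first.
  by apply/rowP => i; rewrite !mxE; ring.
have wu : - dot w u <= e.
  by rewrite (le_trans (ler_norm _))// normrN -[leRHS]mulr1 -u1 cauchy_schwarz_norm.
rewrite !dotE (dotC u w) (dotC v w) (dotC v u) (enorm1_dot u1) (enorm1_dot v1) ee.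
have h1 : s * - dot w u <= e * e.
  by apply: (@le_trans _ _ (s * e)); [exact: ler_wpM2l|exact: ler_wpM2r].
have h2 : r * dot w v <= 0 by rewrite pmulr_rle0.
have h3 : r * s * 2^-1 <= r * s * dot u v by rewrite ler_wpM2l// mulr_ge0// ltW.
have h4 : s * s <= e * e by rewrite ler_pM.
lra.
Qed.

End touching_ball.

Section hessian_sandwich.
Context {R : realType} {n : nat}.
Implicit Types (x y z w u : 'rV[R]_n) (I U : set 'rV[R]_n).

Lemma abse_sub_le (a b : \bar R) (q e e' : R) : (a <= b + e%:E)%E ->
  (b <= a + e%:E)%E -> (`|a - q%:E| <= e'%:E)%E -> (`|b - q%:E| <= (e + e')%:E)%E.
Proof.
case: a b => [a| |] [b| |]//=; rewrite !lee_fin => h1 h2; rewrite !ler_norml; lra.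
Qed.

(** When the lower boundaries of two nested sets agree up to o(|y|^2) over the
    tangent plane, their second-order expansions are the same, including the
    existence of the expansion. *)
Lemma boundary_hessian_sandwich I U x u : I `<=` U ->
  normal I x = u -> normal U x = u ->
  (forall e : R, 0 < e -> \forall y \near (0 : 'rV[R]_n), dot y u = 0 ->
    forall t, U (x + y - t *: u) ->
      exists2 s, s <= t + e * dot y y & I (x + y - s *: u)) ->
  forall A, boundary_hessian I x A <-> boundary_hessian U x A.
Proof.
move=> IU nI nU near_IU A.
have UI y : (height U x y <= height I x y)%E.
  rewrite /height nI nU; apply: le_ereal_inf => _ [t It <-]; exists t => //.
  exact: IU.
have hIU (e : R) : 0 < e -> \forall y \near (0 : 'rV[R]_n), dot y u = 0 ->
    (height I x y <= height U x y + (e * dot y y)%:E)%E.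
  move=> /near_IU; apply: filterS => y h yu; have {}h := h yu.
  rewrite -leeBlDr//; rewrite {2}/height; apply: le_ereal_inf_tmp => _ [t Ut <-].
  rewrite nU in Ut; have [s st Is] := h t Ut.
  rewrite leeBlDr//; apply: (@le_trans _ _ s%:E); last by rewrite -EFinD lee_fin.
  by apply: ereal_inf_lbound; exists s => //; rewrite /= nI.
have ge0 (e : R) y : 0 < e -> 0 <= e * dot y y.
  by move=> e0; rewrite mulr_ge0 ?dotxx_ge0// ltW.
have key (V W : set 'rV[R]_n) : normal V x = u -> normal W x = u ->
    (forall e : R, 0 < e -> \forall y \near (0 : 'rV[R]_n), dot y u = 0 ->
      (height V x y <= height W x y + (e * dot y y)%:E)%E /\
      (height W x y <= height V x y + (e * dot y y)%:E)%E) ->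
    boundary_hessian V x A -> boundary_hessian W x A.
  move=> nV nW VW [AT uA hV]; split=> //; first by rewrite nW -nV.
  move=> e e0; have e20 : 0 < e / 2 by rewrite divr_gt0.
  have := hV _ e20; have := VW _ e20; apply: filterS2 => y h1 h2.
  rewrite nW => yu; have [h3 h4] := h1 yu; rewrite nV in h2.
  have := abse_sub_le h3 h4 (h2 yu); rewrite -mulrDl.
  by rewrite (_ : e / 2 + e / 2 = e)//; lra.
by split; apply: key => // e e0; have := hIU _ e0; apply: filterS => y h yu;
  split; [exact: h|by rewrite (le_trans (UI y))// leeDl// lee_fin ge0|
   by rewrite (le_trans (UI y))// leeDl// lee_fin ge0|exact: h].
Qed.

Lemma curvatures_eq I U x :
  (forall A, boundary_hessian I x A <-> boundary_hessian U x A) ->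
  curvatures I x = curvatures U x.
Proof.
move=> h; rewrite /curvatures; congr (xget 0 _); apply/seteqP.
by split=> k [A /h hA kA]; exists A.
Qed.

End hessian_sandwich.

(** * Boundaries of unions and intersections *)

Section convex_comb.
Context {R : realType} {n : nat}.

Lemma convex_comb (K : set 'rV[R]_n) x y (t : R) : convex K -> K x -> K y ->
  0 <= t -> t <= 1 -> K (x + t *: (y - x)).
Proof.
move=> cK Kx Ky t0 t1; have := cK y x (Itv01 t0 t1).
rewrite !inE => /(_ Ky Kx); congr (K _).
transitivity (t *: y + (1 - t) *: x); first by [].
by apply/rowP => i; rewrite !mxE; ring.
Qed.

Lemma near_norm_lt (e : R) : 0 < e ->
  \forall y \near (0 : 'rV[R]_n), enorm y < e.
Proof. by move=> e0; apply/nbhs_enorm; exists e => // y; rewrite subr0. Qed.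

End convex_comb.

Section local_hessian.
Context {R : realType} {n : nat}.
Implicit Types (x y z w u : 'rV[R]_n) (I U K L : set 'rV[R]_n).

(** The lines through points near x in the normal direction enter the larger
    set near x, hence where both sets coincide. *)
Lemma local_hessian I U r x u : 0 < r -> I `<=` U ->
  touching_ball I r x u -> outer_unit_normal U x u ->
  (exists2 d : R, 0 < d & forall z, enorm (z - x) < d -> U z -> I z) ->
  [/\ normal I x = u, normal U x = u & curvatures I x = curvatures U x].
Proof.
move=> r0 IU tI nU [d d0 hd].
have tU : touching_ball U r x u by exact: touching_ball_subset tI nU IU.
have u1 := nU.1.
have nIE := touching_ball_normalE r0 tI; have nUE := touching_ball_normalE r0 tU.
split=> //; apply/curvatures_eq/(@boundary_hessian_sandwich _ _ _ _ _ u) => // e e0.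
have d20 : 0 < d / 2 by rewrite divr_gt0.
near=> y => yu t Ut.
have yr : enorm y < r by near: y; exact: near_norm_lt.
have yd : enorm y < d / 2 by near: y; exact: near_norm_lt.
have t0 := tangent_height_ge0 nU yu Ut.
have ey : 0 <= e * dot y y by rewrite mulr_ge0 ?dotxx_ge0// ltW.
have [t1|t1] := leP (dot y y / r) t.
  exists (dot y y / r); first by rewrite (le_trans t1)// lerDl.
  by apply: touching_ball_sagitta => //; exact: ltW.
exists t; first by rewrite lerDl.
apply: hd => //; rewrite (_ : _ - x = y + (- t) *: u); last first.
  by apply/rowP => i; rewrite !mxE; ring.
apply: le_lt_trans (enormD _ _) _; rewrite enormZ u1 mulr1 normrN ger0_norm//.
have : dot y y / r <= enorm y.
  by rewrite -sqr_enorm ler_pdivrMr// expr2 ler_wpM2l// ?enorm_ge0// ltW.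
lra.
Unshelve. all: by end_near. Qed.

End local_hessian.

Section union_intersection.
Context {R : realType} {n : nat}.
Variables (K L : set 'rV[R]_n) (r rho : R).
Hypotheses (r0 : 0 < r) (rho0 : 0 < rho).
Hypothesis touchK : forall x, boundary K x -> touching_ball K r x (normal K x).
Hypothesis touchL : forall x, boundary L x -> touching_ball L r x (normal L x).
Hypotheses (rhoK : eball 0 rho `<=` K) (rhoL : eball 0 rho `<=` L).
Hypothesis cvxU : convex (K `|` L).

Implicit Types (x y z w u : 'rV[R]_n).

(** Two distinct touching balls at x would have, in the convex hull of their
    union, a point outside of both supporting half-spaces. The normals are not
    opposite because both half-spaces contain the origin in their interior. *)
Lemma common_normal x : boundary K x -> boundary L x -> normal L x = normal K x.
Proof.
move=> bK bL; set u := normal K x; set v := normal L x.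
have [nu ballK] := touchK bK; have [nv ballL] := touchL bL.
rewrite -/u -/v in nu nv ballK ballL.
have u1 := nu.1; have v1 := nv.1.
have xu := support_ge (ltW rho0) rhoK nu; have xv := support_ge (ltW rho0) rhoL nv.
have uu := enorm1_dot u1; have vv := enorm1_dot v1.
(* The convex union contains the midpoint of the points of the two balls in the
   direction of a from their centres; it lies beyond x in the direction of a. *)
set a := u + v; set c := enorm a.
have a0 : a != 0.
  apply/eqP => a0; have : dot x a = 0 by rewrite a0 dotC dot0l.
  rewrite /a dotDr => h; suff : (0 : R) < 0 by rewrite ltxx.
  by have h0 := rho0; lra.
have c0 : 0 < c by rewrite lt0r enorm_eq0 a0 enorm_ge0.
have cc : c ^+ 2 = 2 + 2 * dot u v.
  by rewrite sqr_enorm !dotE uu vv (dotC v u); ring.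
have [uv|uv] := leP 1 (dot u v); first by rewrite [RHS](unit_dot_ge1 u1 v1).
have c2 : c < 2.
  by rewrite -(@ltr_pXn2r _ 2)// ?nnegrE ?ltW// cc; lra.
have w1 : enorm (c^-1 *: a) = 1.
  by rewrite enormZ ger0_norm ?invr_ge0 ?ltW// mulVf// gt_eqF.
have inball (S : set 'rV[R]_n) (N : 'rV[R]_n) : eball (x - r *: N) r `<=` S ->
    S (x - r *: N + r *: (c^-1 *: a)).
  by apply; rewrite /eball/= addrC addKr enormZ w1 mulr1 ger0_norm// ltW.
have := convex_comb cvxU (or_introl (inball _ _ ballK)) (or_intror (inball _ _ ballL)).
move=> /(_ 2^-1); set mid := (X in _ -> _ -> _ X).
have midE : mid - x = (r * (c^-1 - 2^-1)) *: a.
  by apply/rowP => i; rewrite /mid !mxE; field; rewrite gt_eqF.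
have k0 : 0 < r * (c^-1 - 2^-1) by rewrite mulr_gt0// subr_gt0 ltf_pV2 ?posrE.
have out N : dot a N = 1 + dot u v -> dot (mid - x) N <= 0 -> False.
  move=> aN; rewrite midE dotZl aN pmulr_rle0//.
  have : 0 < c ^+ 2 by rewrite exprn_gt0.
  rewrite cc; lra.
have i0 : 0 <= 2^-1 :> R by lra.
have i1 : 2^-1 <= 1 :> R by lra.
move=> Umid; have [/nu.2|/nv.2] := Umid i0 i1.
  by move=> h; exfalso; apply: out h; rewrite !dotE uu (dotC v u).
by move=> h; exfalso; apply: out h; rewrite !dotE vv addrC.
Qed.

Lemma outer_normal_setU x u : outer_unit_normal K x u ->
  outer_unit_normal L x u -> outer_unit_normal (K `|` L) x u.
Proof. by move=> [u1 hK] [_ hL]; split=> // y [/hK|/hL]. Qed.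

Lemma common_touching_ball x : boundary K x -> boundary L x ->
  touching_ball (K `&` L) r x (normal K x) /\
  outer_unit_normal (K `|` L) x (normal K x).
Proof.
move=> bK bL; have [nu ballK] := touchK bK; have [nv ballL] := touchL bL.
rewrite common_normal// in nv ballL.
split; last exact: outer_normal_setU.
split; last by move=> y yb; split; [exact: ballK|exact: ballL].
exact: outer_unit_normal_subset nu.
Qed.

End union_intersection.

Section one_sided.
Context {R : realType} {n : nat}.
Variables (K L : set 'rV[R]_n) (r : R).
Hypotheses (r0 : 0 < r) (cK : closed K) (cL : closed L).
Hypothesis touchK : forall x, boundary K x -> touching_ball K r x (normal K x).
Implicit Types (x y z w u : 'rV[R]_n).

Let away x : ~ L x -> exists2 d : R, 0 < d & forall z, enorm (z - x) < d -> ~ L z.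
Proof.
move=> Lx; apply/nbhs_enorm; apply: open_nbhs_nbhs; split=> //.
exact: closed_openC.
Qed.

(** By convexity, a normal of the union can be tested near x, where the union
    coincides with K. *)
Lemma outer_normal_outside x u : convex (K `|` L) -> K x -> ~ L x ->
  outer_unit_normal K x u -> outer_unit_normal (K `|` L) x u.
Proof.
move=> cvxU Kx Lx [u1 hu]; split=> // y Uy; have [d d0 hd] := away Lx.
set e := enorm (y - x); have e0 : 0 <= e by exact: enorm_ge0.
pose t := d / (d + e + 1).
have t0 : 0 < t by rewrite divr_gt0//; lra.
have t1 : t <= 1 by rewrite ler_pdivrMr ?mul1r; lra.
have zE : x + t *: (y - x) - x = t *: (y - x) by rewrite addrC addKr.
have [/hu|] := convex_comb cvxU (or_introl Kx) Uy (ltW t0) t1.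
  by rewrite zE dotZl pmulr_rle0.
move=> Lz; exfalso; apply: hd Lz; rewrite zE enormZ gtr0_norm// -/e.
rewrite /t mulrAC ltr_pdivrMr; last lra.
rewrite ltr_pM2l//; lra.
Qed.

Lemma outside_union x : convex (K `|` L) -> boundary K x -> ~ L x ->
  [/\ normal (K `|` L) x = normal K x,
      curvatures (K `|` L) x = curvatures K x &
      outer_unit_normal (K `|` L) x (normal K x)].
Proof.
move=> cvxU bx Lx; have /closed_boundaryP[//|Kx _] := bx.
have nU := outer_normal_outside cvxU Kx Lx (touchK bx).1.
have near_eq : exists2 d : R, 0 < d & forall z, enorm (z - x) < d -> (K `|` L) z -> K z.
  have [d d0 hd] := away Lx; exists d => // z zx [//|Lz].
  by case: (hd z zx Lz).
by have [_ nU' ->] := local_hessian r0 (@subsetUl _ K L) (touchK bx) nU near_eq.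
Qed.

Lemma inside_intersection x : boundary K x -> interior L x ->
  [/\ normal (K `&` L) x = normal K x &
      curvatures (K `&` L) x = curvatures K x].
Proof.
move=> bx Lx; have [e e0 eL] := interior_eball Lx.
have [nK ballK] := touchK bx.
pose r' := Num.min r (e / 2).
have r'0 : 0 < r' by rewrite lt_min r0 divr_gt0.
have r'r : r' <= r by rewrite ge_min lexx.
have r'e : r' <= e / 2 by rewrite ge_min lexx orbT.
have [_ ballK'] := touching_ball_shrink (ltW r'0) r'r (touchK bx).
have tI : touching_ball (K `&` L) r' x (normal K x).
  split; first exact: outer_unit_normal_subset nK.
  move=> y yb; split; first exact: ballK'.
  apply: eL; rewrite /eball/= in yb *.
  rewrite (_ : y - x = (y - (x - r' *: normal K x)) - r' *: normal K x); last first.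
    by apply/rowP => i; rewrite !mxE; ring.
  apply: le_trans (enormD _ _) _; rewrite enormN enormZ nK.1 mulr1 gtr0_norm//.
  lra.
have near_eq : exists2 d : R, 0 < d & forall z, enorm (z - x) < d -> K z -> (K `&` L) z.
  have [d d0 hd] := (interior_enorm _ _).1 Lx; exists d => // z zx Kz.
  by split=> //; exact: hd.
by have [nI _ ->] := local_hessian r'0 (@subIsetl _ K L) tI nK near_eq.
Qed.

End one_sided.

Section boundary_decomposition.
Context {R : realType} {n : nat}.
Implicit Types (K L : set 'rV[R]_n) (x : 'rV[R]_n).

Lemma boundary_split K L : closed L -> boundary K =
  (boundary K `&` boundary L) `|` (boundary K `&` ~` L) `|` (boundary K `&` interior L).
Proof.
move=> cL; apply/seteqP; split=> [x bx|x [[[]|[]]|[]]]//.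
have [Lx|Lx] := pselect (L x); last by left; right.
have [iLx|iLx] := pselect (interior L x); first by right.
by left; left; split=> //; apply/closed_boundaryP.
Qed.

Lemma boundary_setI K L : closed K -> closed L -> boundary (K `&` L) =
  (boundary K `&` boundary L) `|` (boundary K `&` interior L)
    `|` (boundary L `&` interior K).
Proof.
move=> cK cL; have cI := closedI cK cL.
apply/seteqP; split=> x.
  move=> /closed_boundaryP-/(_ cI)[[Kx Lx]]; rewrite interiorI => /not_andP ni.
  have [iK|iK] := pselect (interior K x).
    right; split=> //; apply/closed_boundaryP => //; split=> // iL.
    by case: ni => [/(_ iK)|/(_ iL)].
  have [iL|iL] := pselect (interior L x).
    by left; right; split=> //; apply/closed_boundaryP.
  by left; left; split; apply/closed_boundaryP.
move=> h; apply/closed_boundaryP => //; rewrite interiorI.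
case: h => [[]|].
- by move=> [/closed_boundaryP-/(_ cK)[Kx iK] /closed_boundaryP-/(_ cL)[Lx _]]; split=> // -[].
- by move=> [/closed_boundaryP-/(_ cK)[Kx iK] /interior_subset Lx]; split=> // -[].
- by move=> [/closed_boundaryP-/(_ cL)[Lx iL] /interior_subset Kx]; split=> // -[].
Qed.

(** Only an inclusion in general: common boundary points of two adjacent bodies
    may be interior to the union. *)
Lemma boundary_setU_sub K L : closed K -> closed L -> boundary (K `|` L) `<=`
  (boundary K `&` boundary L) `|` (boundary K `&` ~` L) `|` (boundary L `&` ~` K).
Proof.
move=> cK cL x /closed_boundaryP-/(_ (closedU cK cL))[Ux nU].
have nK : ~ interior K x by move=> h; apply: nU; apply: interiorS h => y; left.
have nL : ~ interior L x by move=> h; apply: nU; apply: interiorS h => y; right.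
have [Kx|Kx] := pselect (K x); have [Lx|Lx] := pselect (L x).
- by left; left; split; apply/closed_boundaryP.
- by left; right; split=> //; apply/closed_boundaryP.
- by right; split=> //; apply/closed_boundaryP.
- by case: Ux.
Qed.

End boundary_decomposition.

(** * Porous sets *)

Section dyadic_cells.
Context {R : realType} {d : nat}.
Variables (tau : 'rV[R]_d).
Implicit Types (u v : 'rV[R]_d) (k l : nat).

Definition dyadic_index k u : {ffun 'I_d -> int} :=
  [ffun j => Num.floor (2 ^+ k * (u 0 j - tau 0 j))].

Definition cell := (nat * {ffun 'I_d -> int})%type.

Definition in_cell (Q : cell) u := dyadic_index Q.1 u = Q.2.

Definition subcell l (Q : cell) (b : {ffun 'I_d -> 'I_(2 ^ l)}) : cell :=
  ((Q.1 + l)%N, [ffun j => (2 ^ l)%N%:Z * Q.2 j + (b j)%:Z]).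

Definition cell_weight (Q : cell) : R := 2^-1 ^+ (Q.1 * d).

Lemma cell_weight_ge0 Q : 0 <= cell_weight Q.
Proof. by rewrite exprn_ge0. Qed.

Lemma cell_norm Q u v : in_cell Q u -> in_cell Q v -> `|u - v| <= 2^-1 ^+ Q.1.
Proof.
move=> Qu Qv; apply: norm_le_coord => [|j]; first by rewrite exprn_ge0.
have := congr1 (fun f : {ffun _} => f j) (etrans Qu (esym Qv)).
rewrite !ffunE !mxE => e.
have p0 : 0 < 2 ^+ Q.1 :> R by rewrite exprn_gt0.
rewrite exprVn -[leRHS]mul1r ler_pdivlMr// -[X in _ * X](gtr0_norm p0) -normrM.
have h1 := floor_le (2 ^+ Q.1 * (u 0 j - tau 0 j)).
have h2 := floorD1_gt (2 ^+ Q.1 * (u 0 j - tau 0 j)).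
have h3 := floor_le (2 ^+ Q.1 * (v 0 j - tau 0 j)).
have h4 := floorD1_gt (2 ^+ Q.1 * (v 0 j - tau 0 j)).
move: h1 h2; rewrite e => h1 h2.
rewrite intrD in h2 h4.
rewrite ler_norml; apply/andP; split; lra.
Qed.

Lemma subcell_of l Q u : in_cell Q u -> 
  exists b : {ffun 'I_d -> 'I_(2 ^ l)}, in_cell (subcell Q b) u.
Proof.
move=> Qu.
have H j : exists b : 'I_(2 ^ l), Num.floor (2 ^+ (Q.1 + l) * (u 0 j - tau 0 j)) =
    (2 ^ l)%N%:Z * Q.2 j + b%:Z.
  have := congr1 (fun f : {ffun _} => f j) Qu; rewrite ffunE => <-.
  set y := u 0 j - tau 0 j.
  rewrite exprD mulrAC -/y; set x := 2 ^+ Q.1 * y.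
  have p0 : 0 < 2 ^+ l :> R by rewrite exprn_gt0.
  set f := Num.floor (x * 2 ^+ l).
  have cE : ((2 ^ l)%N%:Z)%:~R = 2 ^+ l :> R by rewrite -pmulrn natrX.
  have b0 : (2 ^ l)%N%:Z * Num.floor x <= f.
    rewrite floor_ge_int intrM cE mulrC ler_pM2r//; exact: floor_le.
  have b1 : f < (2 ^ l)%N%:Z * Num.floor x + (2 ^ l)%N%:Z.
    rewrite -(ltr_int R) intrD intrM cE.
    apply: le_lt_trans (floor_le _) _.
    have := floorD1_gt x; rewrite intrD => h.
    by rewrite -[X in _ < _ + X]mulr1 -mulrDr mulrC ltr_pM2l.
  have : 0 <= f - (2 ^ l)%N%:Z * Num.floor x by rewrite subr_ge0.
  case E : (f - _) => [m|//] _.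
  have ml : (m < 2 ^ l)%N by rewrite -ltz_nat -E; lia.
  by exists (Ordinal ml) => /=; rewrite -E addrC subrK.
have [b hb] := choice H; exists [ffun j => b j].
by apply/ffunP => j; rewrite !ffunE hb.
Qed.

Lemma sum_subcell_weight l Q :
  \sum_(b : {ffun 'I_d -> 'I_(2 ^ l)}) cell_weight (subcell Q b) = cell_weight Q.
Proof.
rewrite /cell_weight /= sumr_const card_ffun !card_ord mulnDl exprD.
rewrite -[RHS]mulr1 -mulrnAr; congr (_ * _).
rewrite -mulr_natr exprM !natrX -exprMn -exprMn mulVf ?expr1n//.
Qed.

End dyadic_cells.
Section porous_cover.
Context {R : realType} {d : nat}.
Variables (tau : 'rV[R]_d) (S : set 'rV[R]_d) (l : nat).
Implicit Types (u v : 'rV[R]_d) (k : nat).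
Local Notation cell := (@cell d).
Local Notation weight := (@cell_weight R d).
Local Notation mem_cell := (in_cell tau).

Definition has_hole (Q : cell) : Prop :=
  exists b : {ffun 'I_d -> 'I_(2 ^ l)}, forall u, S u -> ~ mem_cell (subcell Q b) u.

Definition hole (Q : cell) : option {ffun 'I_d -> 'I_(2 ^ l)} :=
  [pick b | `[< forall u, S u -> ~ mem_cell (subcell Q b) u >]].

(** One step of the descent from a cell that has r.+1 holes still to be
    crossed: a hole is discarded if there is one, and the cell is halved
    otherwise. *)
Definition refine (Q : cell) (r : nat) : seq (cell * nat) :=
  if hole Q is Some b0
  then [seq (subcell Q b, r) | b <- enum {ffun 'I_d -> 'I_(2 ^ l)} & b != b0]
  else [seq (subcell Q b, r.+1) | b <- enum {ffun 'I_d -> 'I_(2 ^ 1)}].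

(** The cells reached after j steps, once r holes have been crossed. *)
Fixpoint descent (Q : cell) (r j : nat) {struct j} : seq cell :=
  match j, r with
  | 0, 0 => [:: Q]
  | 0, _.+1 => [::]
  | _.+1, 0 => [::]
  | j'.+1, r'.+1 => flatten [seq descent p.1 p.2 j' | p <- refine Q r']
  end.

(** The proportion of the volume of a cell that remains when one of its subcells
    of depth l is discarded. *)
Definition hole_ratio : R := 1 - 2^-1 ^+ (l * d).

Lemma hole_ratio_ge0 : 0 <= hole_ratio.
Proof. by rewrite subr_ge0 exprn_ile1// invf_le1// ler1n. Qed.

Lemma hole_ratio_lt1 : hole_ratio < 1.
Proof. by rewrite gtrBl exprn_gt0. Qed.

Lemma refine_weight Q r :
  \sum_(p <- refine Q r) hole_ratio ^+ p.2 * weight p.1 <= hole_ratio ^+ r.+1 * weight Q.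
Proof.
rewrite /refine; case: (hole Q) => [b0|]; rewrite big_map.
  rewrite big_filter big_enum_cond -big_distrr/= exprSr -mulrA.
  rewrite ler_wpM2l ?exprn_ge0 ?hole_ratio_ge0//.
  have := @sum_subcell_weight R d l Q; rewrite (bigD1 b0)//= => e.
  rewrite le_eqVlt; apply/orP; left; apply/eqP.
  apply: (addrI (weight (subcell Q b0))); rewrite e /hole_ratio.
  by rewrite /cell_weight /= mulnDl exprD; ring.
rewrite big_enum /= -big_distrr/=.
by rewrite (@sum_subcell_weight R d 1 Q).
Qed.

(** The cells produced at all steps form a packing of Q, which loses a fixed
    proportion of its volume each time that a hole is crossed. *)
Lemma descent_weight j Q r :
  \sum_(i < j) \sum_(P <- descent Q r i) weight P <= hole_ratio ^+ r * weight Q.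
Proof.
elim: j Q r => [|j ih] Q r.
  by rewrite big_ord0 mulr_ge0 ?exprn_ge0 ?hole_ratio_ge0 ?cell_weight_ge0.
rewrite big_ord_recl; case: r => [|r] /=.
  by rewrite big_seq1 expr0 mul1r big1 ?addr0// => i _; rewrite big_nil.
rewrite big_nil add0r; apply: le_trans (refine_weight Q r).
under eq_bigr do rewrite big_flatten big_map.
rewrite exchange_big/=; apply: ler_sum => p _; exact: ih.
Qed.

Lemma descent_weight_le j Q r P :
  P \in descent Q r j -> weight P <= hole_ratio ^+ r * weight Q.
Proof.
move=> PQ; apply: le_trans (descent_weight j.+1 Q r).
rewrite big_ord_recr/= (big_rem _ PQ)/= addrCA lerDl addr_ge0//.
  by apply: sumr_ge0 => i _; apply: sumr_ge0 => *; exact: cell_weight_ge0.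
by apply: sumr_ge0 => *; exact: cell_weight_ge0.
Qed.

(** Points of S are never in a discarded hole, and a hole is met infinitely
    often along the cells of u. *)
Lemma descent_cover u r Q : S u ->
  (forall k0, exists2 k, (k0 <= k)%N & has_hole (k, dyadic_index tau k u)) ->
  mem_cell Q u -> exists j, exists2 P, P \in descent Q r j & mem_cell P u.
Proof.
move=> Su holes; elim: r Q => [|r ihr] Q Qu.
  by exists 0%N, Q => //=; rewrite mem_seq1.
have [k Qk hk] := holes Q.1.
elim: (k - Q.1)%N {-2}Q (erefl (k - Q.1)%N) Qk Qu => {Q} [|m ihm] Q km Qk Qu.
  have {hk} : has_hole Q.
    have <- : (k, dyadic_index tau k u) = Q => //.
    have -> : k = Q.1 by lia.
    by rewrite Qu; case: (Q).
  case=> b hb; have [b1 b1u] := subcell_of l Qu.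
  have [j [P PT Pu]] := ihr _ b1u; exists j.+1, P => //=.
  apply/flatten_mapP; exists (subcell Q b1, r) => //=.
  rewrite /refine /hole; case: pickP => [b0 /asboolP hb0|/(_ b)]; last first.
    by move/negbT/asboolPn; case.
  apply/mapP; exists b1 => //; rewrite mem_filter mem_enum andbT.
  by apply/eqP => b10; apply: (hb0 u Su); rewrite -b10.
have [hQ|nhQ] := pselect (exists b0, hole Q = Some b0).
  have [b0 hb0] := hQ; have [b1 b1u] := subcell_of l Qu.
  have [j [P PT Pu]] := ihr _ b1u; exists j.+1, P => //=.
  apply/flatten_mapP; exists (subcell Q b1, r) => //=.
  rewrite /refine hb0; apply/mapP; exists b1 => //.
  rewrite mem_filter mem_enum andbT; apply/eqP => b10.
  move: hb0; rewrite /hole; case: pickP => // b2 /asboolP hb2 [b20].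
  by apply: (hb2 u Su); rewrite b20 -b10.
have [b1 b1u] := subcell_of 1 Qu.
have [||j [P PT Pu]] := ihm (subcell Q b1) _ _ b1u; [by rewrite /=; lia|by rewrite /=; lia|].
exists j.+1, P => //=; apply/flatten_mapP; exists (subcell Q b1, r.+1) => //=.
rewrite /refine; case E : (hole Q) => [b0|]; first by case: nhQ; exists b0.
by apply/mapP; exists b1 => //; rewrite mem_enum.
Qed.

End porous_cover.
Section chart_covers.
Context {R : realType} {n d : nat}.
Variables (X : set 'rV[R]_n) (h : 'rV[R]_n -> 'rV[R]_d) (C : R).
Hypothesis C_gt0 : 0 < C.
Hypothesis chart : forall x y, X x -> X y -> enorm (x - y) <= C * `|h x - h y|.
Local Notation cell := (@cell d).
Local Notation weight := (@cell_weight R d).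
Local Notation premeasure := (@hausdorff_premeasure R n d).
Local Notation hausdorff := (@hausdorff R n d).

Let gamma : R := ball_volume R d / 2 ^+ d * C ^+ d.

Let gamma_ge0 : 0 <= gamma.
Proof.
by rewrite mulr_ge0 ?divr_ge0 ?ball_volume_ge0 ?exprn_ge0// ltW.
Qed.

Lemma chart_cell_premeasure tau (Q : cell) delta : C * 2^-1 ^+ Q.1 <= delta ->
  (premeasure delta [set x | X x /\ in_cell tau Q (h x)] <= (gamma * weight Q)%:E)%E.
Proof.
move=> Qd; set A := [set x | _].
have dA : (ediam A <= (C * 2^-1 ^+ Q.1)%:E)%E.
  apply: ediam_le => x y [Xx Qx] [Xy Qy]; rewrite lee_fin.
  apply: le_trans (chart Xx Xy) _; rewrite ler_wpM2l ?(ltW C_gt0)//.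
  exact: cell_norm Qx Qy.
apply: le_trans (premeasure_le_gauge _ _) _.
  by apply: le_trans dA _; rewrite lee_fin.
apply: le_trans (hausdorff_gauge_le d _ dA) _.
  by rewrite mulr_ge0 ?exprn_ge0// ltW.
by rewrite lee_fin /gamma /cell_weight exprM exprMn mulrA.
Qed.

Lemma chart_cells_premeasure tau (s : seq cell) delta :
  (forall Q, Q \in s -> C * 2^-1 ^+ Q.1 <= delta) ->
  (premeasure delta (\bigcup_(Q in [set` s]) [set x | X x /\ in_cell tau Q (h x)])
     <= (gamma * \sum_(Q <- s) weight Q)%:E)%E.
Proof.
move=> sd; rewrite bigcup_seq.
apply: le_trans (premeasure_le_bigsum _ _ _ _) _.
rewrite mulr_sumr -sumEFin big_seq [leRHS]big_seq; apply: lee_sum => Q Qs.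
exact: chart_cell_premeasure (sd Q Qs).
Qed.

Lemma half_power_lt (e : R) : 0 < e -> exists l, 2^-1 ^+ l < e.
Proof.
move=> e0; have : (2^-1 : R) ^+ l @[l --> \oo] --> 0.
  by apply: cvg_expr; rewrite ger0_norm// invf_lt1// ltr1n.
move=> /cvgrPdist_lt/(_ e e0)[l _ /(_ l (leqnn l))].
by rewrite /= sub0r normrN ger0_norm ?exprn_ge0// => ?; exists l.
Qed.

Lemma chart_unit_cell_finite c :
  (hausdorff [set x | X x /\ in_cell 0 (0%N, c) (h x)] < +oo)%E.
Proof.
apply: (@le_lt_trans _ _ gamma%:E); last by rewrite ltry.
apply: ge_ereal_sup => _ [delta /= d0 <-].
have [|l hl] := @half_power_lt (delta / C); first by rewrite divr_gt0.
pose s : seq cell := [seq subcell (0%N, c) b | b <- enum {ffun 'I_d -> 'I_(2 ^ l)}].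
have sd Q : Q \in s -> C * 2^-1 ^+ Q.1 <= delta.
  by case/mapP => b _ -> /=; rewrite add0n mulrC -ler_pdivlMr// ltW.
have := chart_cells_premeasure 0 sd; rewrite big_map big_enum/=.
rewrite (@sum_subcell_weight R d l (0%N, c)) /cell_weight/= mul0n expr0 mulr1.
apply: le_trans; apply: le_premeasure => x [Xx cx].
by have [b bx] := subcell_of l cx; exists (subcell (0%N, c) b) => //=;
  apply: map_f; rewrite mem_enum.
Qed.

(** The cells of the descent that cross r holes cover E and have total weight
    at most (1 - 2^(-ld))^r. *)
Lemma chart_null tau (S : set 'rV[R]_d) l (E : set 'rV[R]_n) :
  (0 < d)%N -> E `<=` X -> (forall x, E x -> S (h x)) ->
  (forall x, E x -> forall k0, exists2 k, (k0 <= k)%N &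
     has_hole tau S l (k, dyadic_index tau k (h x))) ->
  hausdorff E = 0%E.
Proof.
move=> d0 EX ES holes; set th := hole_ratio (R := R) (d := d) l.
have th0 : 0 <= th by exact: hole_ratio_ge0.
have small (e : R) : 0 < e -> exists r, th ^+ r < e.
  move=> e0; have : th ^+ r @[r --> \oo] --> 0.
    by apply: cvg_expr; rewrite ger0_norm//; exact: hole_ratio_lt1.
  move=> /cvgrPdist_lt/(_ e e0)[r _ /(_ r (leqnn r))].
  by rewrite /= sub0r normrN ger0_norm ?exprn_ge0// => ?; exists r.
pose F i := [set x | E x /\ pickle (dyadic_index tau 0 (h x)) = i].
have EF : E `<=` \bigcup_i F i.
  by move=> x Ex; exists (pickle (dyadic_index tau 0 (h x))).
apply/eqP; rewrite eq_le hausdorff_ge0 andbT.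
apply: le_trans (le_hausdorff _ EF) _.
apply: le_trans (hausdorff_sigma_subadditive _ _) _.
rewrite eseries0// => i _ _; apply/eqP; rewrite eq_le hausdorff_ge0 andbT.
have [[x0 [_ x0i]]|F0] := pselect (F i !=set0); last first.
  rewrite (_ : F i = set0) ?hausdorff0//; apply/seteqP; split=> // x Fx.
  by apply: F0; exists x.
pose Q : cell := (0%N, dyadic_index tau 0 (h x0)).
have FQ x : F i x -> in_cell tau Q (h x).
  by move=> [_ xi]; apply: (pcan_inj pickleK); rewrite /= xi x0i.
apply: ge_ereal_sup => _ [delta /= delta0 <-].
apply/lee_addgt0Pr => e e0; rewrite add0e.
have [r hr] : exists r, th ^+ r < (delta / C) ^+ d /\ gamma * th ^+ r <= e.
  have [|r hr] := small (Num.min ((delta / C) ^+ d) (e / (gamma + 1))).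
    by rewrite lt_min exprn_gt0 ?divr_gt0//= ltr_pwDr.
  exists r; move: hr; rewrite lt_min => /andP[-> h2]; split=> //.
  have g1 : 0 < gamma + 1 by rewrite ltr_pwDr.
  move: h2; rewrite ltr_pdivlMr// => h2; apply: le_trans (ltW h2).
  by rewrite mulrC ler_wpM2l ?exprn_ge0// lerDl.
have [hr1 hr2] := hr.
have wQ : weight Q = 1 by rewrite /cell_weight mul0n.
pose T j := descent tau S l Q r j.
have Td j P : P \in T j -> C * 2^-1 ^+ P.1 <= delta.
  move=> /descent_weight_le; rewrite wQ mulr1 => h1.
  rewrite mulrC -ler_pdivlMr// -(@ler_pXn2r _ d)// ?nnegrE ?exprn_ge0 ?divr_ge0 ?ltW//.
  by rewrite -exprM (le_lt_trans h1).
pose G j := \bigcup_(P in [set` T j]) [set x | X x /\ in_cell tau P (h x)].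
have FG : F i `<=` \bigcup_j G j.
  move=> x Fx; have [Ex _] := Fx.
  have [j [P PT Px]] := descent_cover r (ES x Ex) (holes x Ex) (FQ x Fx).
  by exists j => //; exists P => //; split=> //; exact: EX.
apply: le_trans (le_premeasure _ _ FG) _.
apply: le_trans (premeasure_sigma_subadditive _ _ _) _.
apply: lime_le; first by apply: is_cvg_nneseries => j _ _; exact: premeasure_ge0.
near=> J; apply: (@le_trans _ _ (\sum_(0 <= j < J) (gamma * \sum_(P <- T j) weight P)%:E)%E).
  by apply: lee_sum => j _; exact: chart_cells_premeasure (Td j).
rewrite sumEFin lee_fin -mulr_sumr big_mkord; apply: le_trans hr2.
rewrite ler_wpM2l// (le_trans (descent_weight _ _ _ _ _ _))// wQ mulr1//.
Unshelve. all: by end_near. Qed.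

End chart_covers.
Section porosity.
Context {R : realType} {d : nat}.
Implicit Types (S : set 'rV[R]_d) (u v w : 'rV[R]_d).

(** The negation of porosity of S at u: near u, the distance to S is
    negligible with respect to the distance to u. *)
Definition filled_at S u : Prop := forall e : R, 0 < e ->
  \forall v \near u, exists2 w, S w & `|w - v| <= e * `|v - u|.

Definition third_shift (b : {ffun 'I_d -> bool}) : 'rV[R]_d :=
  \row_j (if b j then 3^-1 else 0).

(** The dyadic points of order k and their translates by 1/3 are at distance
    at least 2^(-k)/3 from each other, because 3 does not divide 2^k. *)
Lemma third_shift_separates (x y : R) k : `|x - y| * 3 < 2^-1 ^+ k ->
  exists b : bool, let t := if b then 3^-1 else 0 in
    Num.floor (2 ^+ k * (x - t)) = Num.floor (2 ^+ k * (y - t)).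
Proof.
wlog xy : x y / x <= y => [hw|].
  have [xy|/ltW yx] := leP x y; first exact: hw.
  by rewrite distrC => /(hw _ _ yx)[b hb]; exists b.
have p0 : 0 < 2 ^+ k :> R by rewrite exprn_gt0.
rewrite ler0_norm ?subr_le0// exprVn -[ltRHS]mul1r ltr_pdivlMr// => close.
have [e0|n0] := eqVneq (Num.floor (2 ^+ k * (x - 0))) (Num.floor (2 ^+ k * (y - 0))).
  by exists false.
have [e1|n1] := eqVneq (Num.floor (2 ^+ k * (x - 3^-1))) (Num.floor (2 ^+ k * (y - 3^-1))).
  by exists true.
exfalso.
have lt t : Num.floor (2 ^+ k * (x - t)) != Num.floor (2 ^+ k * (y - t)) ->
    exists z : int, 2 ^+ k * (x - t) < z%:~R <= 2 ^+ k * (y - t).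
  move=> ne; have le : Num.floor (2 ^+ k * (x - t)) <= Num.floor (2 ^+ k * (y - t)).
    by apply: le_floor; rewrite ler_pM2l// lerD2r.
  exists (Num.floor (2 ^+ k * (y - t))); rewrite floor_le andbT -floor_lt_int.
  by rewrite lt_neqAle ne.
have [z0 /andP[h1 h2]] := lt _ n0; have [z1 /andP[h3 h4]] := lt _ n1.
rewrite subr0 in h1 h2.
set q := 2 ^+ k in p0 close h1 h2 h3 h4.
have qE : q = ((2 ^ k)%N%:Z)%:~R by rewrite /q -pmulrn natrX.
have e3 : 3 * (z0 - z1) = (2 ^ k)%N%:Z.
  have l1 : (3 * (z0 - z1) < (2 ^ k)%N%:Z + 1)%R.
    by rewrite -(ltr_int R) !(intrM, intrD, rmorphN) /= -qE; lra.
  have l2 : ((2 ^ k)%N%:Z < 3 * (z0 - z1) + 1)%R.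
    by rewrite -(ltr_int R) !(intrM, intrD, rmorphN) /= -qE; lra.
  lia.
have : (3 %| 2 ^ k)%N.
  by apply/dvdnP; exists `|z0 - z1|%N; lia.
by rewrite Euclid_dvdX.
Qed.

(** The ball around v that avoids S contains a cell, and one of the shifted grids
    puts u and v in the same cell of size comparable to |v - u|. *)
Lemma not_filled_hole S u : S u -> ~ filled_at S u -> exists l, forall k0,
  exists k b, (k0 <= k)%N /\
    has_hole (third_shift b) S l (k, dyadic_index (third_shift b) k u).
Proof.
move=> Su /existsNP[e /not_implyP[e0 nnear]].
have [|l hl] := @half_power_lt R (e / 6); first by rewrite divr_gt0.
exists l => k0.
have [v [uv hv]] : exists v, `|v - u| < 2^-1 ^+ k0 / 3 /\
    forall w, S w -> e * `|v - u| < `|w - v|.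
  apply: contrapT => nov; apply: nnear; apply/nbhs_ballP.
  exists (2^-1 ^+ k0 / 3) => /=; first by rewrite divr_gt0// exprn_gt0.
  move=> v; rewrite -ball_normE /= distrC => uv; apply: contrapT => now.
  apply: nov; exists v; split=> // w Sw; rewrite ltNge; apply/negP => wv.
  by apply: now; exists w.
set D := `|v - u| in uv hv.
have D0 : 0 < D.
  rewrite lt0r normr_ge0 andbT; apply/eqP => D0.
  by have := hv u Su; rewrite distrC -/D D0 mulr0 ltxx.
have exm : exists m, 2^-1 ^+ m <= 3 * D :> R.
  have [|m hm] := @half_power_lt R (3 * D); first by rewrite mulr_gt0.
  by exists m; exact: ltW.
(* m is the first order at which the dyadic scale drops below 3 |v - u|. *)
case: (ex_minnP exm) => m hm kmin.
have mk0 : (k0 < m)%N.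
  rewrite ltnNge; apply/negP => mk; have : 2^-1 ^+ k0 <= 2^-1 ^+ m :> R.
    by rewrite ler_wiXn2l// invf_le1// ler1n.
  by move: uv; rewrite ltr_pdivlMr// => uv; lra.
case: m => // k in hm kmin mk0 *.
have kD : 3 * D < 2^-1 ^+ k.
  by rewrite ltNge; apply/negP => /kmin; rewrite ltnn.
have hb (j : 'I_d) : exists b : bool, let t := if b then 3^-1 else 0 in
    Num.floor (2 ^+ k * (u 0 j - t)) = Num.floor (2 ^+ k * (v 0 j - t)).
  apply: third_shift_separates; apply: le_lt_trans kD.
  rewrite mulrC ler_wpM2l// distrC.
  by have := coord_le_norm (v - u) j; rewrite !mxE.
have [b {}hb] := choice hb; exists k, [ffun j => b j]; split=> //.
set t := third_shift _; have uvt : in_cell t (k, dyadic_index t k u) v.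
  by apply/ffunP => j; rewrite !ffunE !mxE ffunE -hb.
have [c hc] := subcell_of l uvt; exists c => w Sw wc.
have := hv w Sw; apply/negP; rewrite -leNgt.
apply: le_trans (cell_norm wc hc) _; rewrite /= exprD.
have kD' : 2^-1 ^+ k <= 6 * D by move: hm; rewrite exprS; lra.
apply: (@le_trans _ _ (6 * D * (e / 6))).
  by rewrite ler_pM ?exprn_ge0// ltW.
by rewrite le_eqVlt; apply/orP; left; apply/eqP; field.
Qed.

Lemma pigeonhole_frequently (I : finType) (P : I -> nat -> Prop) :
  (forall k0, exists k b, (k0 <= k)%N /\ P b k) ->
  exists b, forall k0, exists2 k, (k0 <= k)%N & P b k.
Proof.
move=> hP; apply: contrapT => nb.
have H b : exists k0, forall k, (k0 <= k)%N -> ~ P b k.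
  apply: contrapT => h; apply: nb; exists b => k0; apply: contrapT => h'.
  by apply: h; exists k0 => k k0k Pk; apply: h'; exists k.
have [f hf] := choice H.
have [k [b [hk /hf]]] := hP (\sum_b f b)%N; apply.
by rewrite (leq_trans _ hk)// (bigD1 b)//= leq_addr.
Qed.

End porosity.

(** Porous sets are negligible for the Hausdorff measure of the dimension of the
    chart; the shifts and the depths of the holes form a countable family. *)
Lemma porous_null {R : realType} {n d : nat} (X E : set 'rV[R]_n)
    (h : 'rV[R]_n -> 'rV[R]_d) (C : R) (S : set 'rV[R]_d) :
  (0 < d)%N -> 0 < C ->
  (forall x y, X x -> X y -> enorm (x - y) <= C * `|h x - h y|) ->
  E `<=` X -> (forall x, E x -> S (h x) /\ ~ filled_at S (h x)) ->
  hausdorff d E = 0%E.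
Proof.
move=> d0 C0 chart EX ES.
pose F l b := [set x | E x /\ forall k0, exists2 k, (k0 <= k)%N &
  has_hole (third_shift b) S l (k, dyadic_index (third_shift b) k (h x))].
pose G i := if unpickle i is Some lb then F lb.1 lb.2 else set0.
have EG : E `<=` \bigcup_i G i.
  move=> x Ex; have [Sx /(not_filled_hole Sx)[l /pigeonhole_frequently[b hb]]] := ES x Ex.
  by exists (pickle (l, b)) => //; rewrite /G pickleK.
apply/eqP; rewrite eq_le hausdorff_ge0 andbT.
apply: le_trans (le_hausdorff _ EG) _.
apply: le_trans (hausdorff_sigma_subadditive _ _) _.
rewrite eseries0// => i _ _; rewrite /G; case: unpickle => [[l b]|]; last first.
  exact: hausdorff0.
apply: (chart_null C0 chart d0 (S := S) (l := l) (tau := third_shift b)).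
- by move=> x [/EX].
- by move=> x [/ES[]].
- by move=> x [].
Qed.

(** * Central charts of the boundary *)

Section central_chart.
Context {R : realType} {d : nat}.
Local Notation n := d.+1.
Implicit Types (x y z w u p : 'rV[R]_n) (V I U : set 'rV[R]_n).

(** The central projection to the hyperplanes where the coordinate of index i
    is 1 or -1. *)
Definition central_chart (i : 'I_n) x : 'rV[R]_d :=
  \row_j (x 0 (lift i j) / `|x 0 i|).

Definition half_space (i : 'I_n) (b : bool) : set 'rV[R]_n :=
  [set x | 0 < (-1) ^+ b * x 0 i].

Lemma half_space_coord i b x : half_space i b x -> x 0 i = (-1) ^+ b * `|x 0 i|.
Proof.
rewrite /half_space/= => x0.
have := gtr0_norm x0; rewrite normrM normr_sign mul1r => ->.
by rewrite mulrA -expr2 sqrr_sign mul1r.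
Qed.

Lemma half_space_neq0 i b x : half_space i b x -> 0 < `|x 0 i|.
Proof.
rewrite /half_space/= => x0; rewrite normr_gt0; apply: contraTneq x0 => ->.
by rewrite mulr0 ltxx.
Qed.

(** The supporting hyperplane at x bounds the radial growth of the boundary in
    nearby directions. *)
Lemma central_chart_lipschitz V (rho M : R) i b : 0 < rho -> 0 < M ->
  eball 0 rho `<=` V -> (forall x, V x -> enorm x <= M) ->
  exists2 C : R, 0 < C & forall x y,
    V x -> (exists u, outer_unit_normal V x u) ->
    V y -> (exists u, outer_unit_normal V y u) ->
    half_space i b x -> half_space i b y ->
    enorm (x - y) <= C * `|central_chart i x - central_chart i y|.
Proof.
move=> rho0 M0 rhoV VM; exists ((M * M / rho + M) * n%:R).
  by rewrite mulr_gt0// addr_gt0// divr_gt0// mulr_gt0.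
suff H x y : `|x 0 i| <= `|y 0 i| ->
    V x -> (exists u, outer_unit_normal V x u) -> V y ->
    half_space i b x -> half_space i b y ->
    enorm (x - y) <= (M * M / rho + M) * n%:R * `|central_chart i x - central_chart i y|.
  move=> x y Vx nx Vy ny bx by'; have [xy|/ltW yx] := leP `|x 0 i| `|y 0 i|.
    exact: H.
  by rewrite enormB distrC; exact: H.
move=> st Vx [u nu] Vy bx by'.
pose s : R := `|x 0 i|; pose t : R := `|y 0 i|; rewrite -/s -/t in st *.
have s0 : 0 < s by exact: half_space_neq0 bx.
have t0 : 0 < t by exact: half_space_neq0 by'.
have tM : t <= M by rewrite (le_trans (coord_le_enorm _ _))// VM.
pose a := s^-1 *: x; pose c := t^-1 *: y.
have xE : x = s *: a by rewrite scalerA mulfV ?gt_eqF// scale1r.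
have yE : y = t *: c by rewrite scalerA mulfV ?gt_eqF// scale1r.
have ac : enorm (a - c) <= n%:R * `|central_chart i x - central_chart i y|.
  apply: le_trans (enorm_le_norm _) _; rewrite ler_wpM2l//.
  apply: norm_le_coord => // j; rewrite /a /c !mxE.
  case: (unliftP i j) => [k ->|->].
    by have := coord_le_norm (central_chart i x - central_chart i y) k;
      rewrite !mxE ![_ * (_)^-1]mulrC.
  rewrite (half_space_coord bx) (half_space_coord by') -/s -/t.
  by rewrite mulrCA mulVf ?gt_eqF// mulrCA mulVf ?gt_eqF// subrr normr0.
clearbody a c s t; set e := enorm (a - c) in ac *; have e0 : 0 <= e by exact: enorm_ge0.
have u1 := nu.1.
have rad : (t - s) * rho <= t * s * e.
  have h1 : dot x u >= rho by exact: support_ge (ltW rho0) rhoV nu.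
  have h2 := nu.2 y Vy.
  have h3 : dot (a - c) u <= e.
    by rewrite (le_trans (cauchy_schwarz _ _))// u1 mulr1.
  rewrite {1}xE {1}yE !dotE in h2; rewrite xE dotZl in h1; rewrite !dotE in h3.
  apply: (@le_trans _ _ ((t - s) * (s * dot a u))).
    by rewrite ler_wpM2l// subr_ge0.
  have h4 : t * s * (dot a u - dot c u) <= t * s * e.
    by rewrite ler_wpM2l// ltW// mulr_gt0.
  apply: le_trans h4.
  have h5 : s * (t * dot c u - s * dot a u) <= 0 by rewrite pmulr_rle0.
  lra.
rewrite -mulrA; apply: le_trans (_ : (M * M / rho + M) * e <= _); last first.
  by rewrite ler_wpM2l// addr_ge0 ?divr_ge0 ?mulr_ge0 ?ltW.
rewrite (_ : x - y = (s - t) *: a + t *: (a - c)); last first.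
  by rewrite {1}xE {1}yE scalerBl scalerBr addrA subrK.
apply: le_trans (enormD _ _) _; rewrite !enormZ (ger0_norm (ltW t0)).
rewrite ler0_norm ?subr_le0// opprB [leRHS]mulrDl lerD//; last by rewrite ler_wpM2r.
have aM : s * enorm a <= M.
  by rewrite -{1}(gtr0_norm s0) -enormZ -xE VM.
rewrite mulrAC ler_pdivlMr//.
have h1 : (t - s) * rho * enorm a <= t * s * e * enorm a.
  by rewrite ler_wpM2r// enorm_ge0.
apply: (@le_trans _ _ (t * s * e * enorm a)); first by rewrite mulrAC.
rewrite (_ : t * s * e * enorm a = t * (s * enorm a) * e); last by ring.
by rewrite ler_wpM2r// ler_pM// ?mulr_ge0 ?enorm_ge0// ltW.
Qed.

Lemma central_chart_local i b x : half_space i b x -> exists2 C : R, 0 < C &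
  exists2 e : R, 0 < e & forall p, enorm (p - x) < e -> half_space i b p /\
    `|central_chart i p - central_chart i x| <= C * enorm (p - x).
Proof.
move=> bx; have t0 := half_space_neq0 bx; pose t : R := `|x 0 i|; rewrite -/t in t0 *.
exists (2 / t + enorm x * 2 / t ^+ 2).
  by rewrite ltr_pwDl ?divr_gt0// divr_ge0 ?mulr_ge0 ?exprn_ge0 ?enorm_ge0// ltW.
exists (t / 2); first by rewrite divr_gt0.
move=> p px; set e := enorm (p - x) in px *; have e0 : 0 <= e by exact: enorm_ge0.
have pe j : `|p 0 j - x 0 j| <= e.
  by have := coord_le_enorm (p - x) j; rewrite !mxE.
have bp : half_space i b p.
  rewrite /half_space/=; have h : `|(-1) ^+ b * p 0 i - t| <= e.
    have -> : (-1) ^+ b * p 0 i - t = (-1) ^+ b * (p 0 i - x 0 i).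
      by rewrite (half_space_coord bx) -/t mulrBr mulrA -expr2 sqrr_sign mul1r.
    by rewrite normrM normr_sign mul1r.
  by move: h; rewrite ler_norml => /andP[]; lra.
split=> //; pose q : R := `|p 0 i|; have q0 : 0 < q by exact: half_space_neq0 bp.
have qt : `|q - t| <= e by apply: le_trans (ler_dist_dist _ _) _; exact: pe.
have q2 : t / 2 <= q by move: qt; rewrite ler_norml => /andP[]; lra.
have q2' : q^-1 <= 2 / t.
  by rewrite -[2 / t]invf_div lef_pV2// ?posrE// divr_gt0.
apply: norm_le_coord => [|j].
  by rewrite mulr_ge0// addr_ge0 ?divr_ge0 ?mulr_ge0 ?exprn_ge0 ?enorm_ge0// ltW.
rewrite !mxE -/q -/t; set k := lift i j.
rewrite (_ : _ - _ = (p 0 k - x 0 k) * q^-1 + x 0 k * (t - q) * (q^-1 * t^-1)); last first.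
  by field; rewrite !gt_eqF.
apply: le_trans (ler_normD _ _) _; rewrite [leRHS]mulrDl lerD//.
  by rewrite normrM (gtr0_norm (_ : 0 < q^-1)) ?invr_gt0// mulrC ler_pM// invr_ge0 ltW.
rewrite !normrM !normfV distrC !(gtr0_norm q0) (gtr0_norm t0).
rewrite (_ : enorm x * 2 / t ^+ 2 * e = enorm x * e * (2 / t * t^-1)); last first.
  by field; rewrite gt_eqF.
rewrite ler_pM// ?mulr_ge0 ?invr_ge0 ?(ltW t0) ?(ltW q0)//.
  by rewrite ler_pM// coord_le_enorm.
by rewrite ler_wpM2r// invr_ge0 ltW.
Qed.

End central_chart.

(** * Measure and density of the boundary *)

Section boundary_measure.
Context {R : realType} {d : nat}.
Local Notation n := d.+1.
Implicit Types (x y z w u p : 'rV[R]_n) (V I U : set 'rV[R]_n).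

Lemma max_coord_half_space x : x != 0 -> exists i b,
  half_space i b x /\ forall j, `|central_chart i x 0 j| <= 1.
Proof.
move=> x0; pose i := [arg max_(k > ord0) `|x 0 k|]%O.
have imax k : `|x 0 k| <= `|x 0 i|.
  by rewrite /i; case: arg_maxP => // m _; apply.
have xi : 0 < `|x 0 i|.
  rewrite lt0r normr_ge0 andbT; apply: contra x0 => /eqP xi.
  apply/eqP/rowP => k; apply/eqP; rewrite mxE -normr_le0.
  by rewrite (le_trans (imax k))// xi.
exists i, (x 0 i < 0); split=> [|j].
  rewrite /half_space/=; have [x0i|x0i] := ltP (x 0 i) 0.
    by rewrite expr1 mulN1r oppr_gt0.
  by rewrite expr0 mul1r; move: xi; rewrite ger0_norm.
rewrite mxE normrM normfV normr_id ler_pdivrMr// mul1r.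
exact: imax.
Qed.

Lemma hausdorff_bigcup_fin s (J : finType) (F : J -> set 'rV[R]_n) :
  (hausdorff s (\bigcup_j F j) <= \sum_j hausdorff s (F j))%E.
Proof.
apply: (@le_trans _ _ (hausdorff s (\big[setU/set0]_(j <- enum J) F j))).
  apply: le_hausdorff => x [j _ Fx]; rewrite -bigcup_seq; exists j => //=.
  by rewrite mem_enum.
rewrite -big_enum; elim: (enum J) => [|j e ih].
  by rewrite !big_nil hausdorff0.
rewrite !big_cons; apply: le_trans (outer_measureU2 _ _ _) _.
by apply: leeD => //; exact: ih.
Qed.

(** Finitely many central charts, each over a bounded set, cover the boundary. *)
Lemma boundary_finite V (rho M : R) : closed V -> 0 < rho -> 0 < M ->
  eball 0 rho `<=` V -> (forall x, V x -> enorm x <= M) ->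
  (forall x, boundary V x -> exists u, outer_unit_normal V x u) ->
  (hausdorff d (boundary V) < +oo)%E.
Proof.
move=> cV rho0 M0 rhoV VM nV.
pose X i b := boundary V `&` half_space i b.
have chart i b : exists2 C : R, 0 < C & forall x y, X i b x -> X i b y ->
    enorm (x - y) <= C * `|central_chart i x - central_chart i y|.
  have [C C0 hC] := central_chart_lipschitz i b rho0 M0 rhoV VM.
  exists C => // x y [bx hx] [by' hy].
  by apply: hC => //; [case/closed_boundaryP: bx|exact: nV|
    case/closed_boundaryP: by'|exact: nV].
(* Chart coordinates in [-1, 1] have integral part -1, 0 or 1. *)
pose F (j : 'I_n * bool * {ffun 'I_d -> 'I_3}) := [set x | X j.1.1 j.1.2 x /\
  in_cell 0 (0%N, [ffun k => (j.2 k)%:Z - 1]) (central_chart j.1.1 x)].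
apply: le_lt_trans (_ : hausdorff d (\bigcup_j F j) < _)%E.
  apply: le_hausdorff => x bx; have x0 : x != 0.
    apply/eqP => x0; have /closed_boundaryP[//|_ []] := bx.
    apply/interior_enorm; exists rho => // y; rewrite x0 => yr; apply: rhoV.
    exact: ltW.
  have [i [b [hx hc]]] := max_coord_half_space x0.
  have H (k : 'I_d) : exists c : 'I_3, Num.floor (central_chart i x 0 k) = c%:Z - 1.
    have /ler_normlP[h1 h2] := hc k.
    have f1 : -1 <= Num.floor (central_chart i x 0 k).
      by rewrite floor_ge_int rmorphN1; lra.
    have f2 : Num.floor (central_chart i x 0 k) < 2.
      by rewrite floor_lt_int; rewrite (_ : 2%:~R = 2 :> R)//; lra.
    case E : (Num.floor (central_chart i x 0 k) + 1) => [m|m]; last by lia.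
    have m3 : (m < 3)%N by lia.
    by exists (Ordinal m3) => /=; lia.
  have [c hc'] := choice H; exists ((i, b), [ffun k => c k]) => //.
  split=> //=; apply/ffunP => k; rewrite !ffunE /= expr0 mul1r [X in _ - X]mxE subr0.
  exact: hc'.
apply: le_lt_trans (hausdorff_bigcup_fin _ _) _.
apply: lte_sum_pinfty => -[[i b] c] _.
have [C C0 hC] := chart i b; exact: (chart_unit_cell_finite C0 hC).
Qed.

Lemma lowest_point V q u : closed V -> enorm u = 1 ->
  (exists t, V (q - t *: u)) -> (forall t, V (q - t *: u) -> 0 <= t) ->
  exists m, boundary V (q - m *: u) /\ forall t, V (q - t *: u) -> m <= t.
Proof.
move=> cV u1 [t0 Vt0] lb; pose T := [set t | V (q - t *: u)].
have hT : has_inf T by split; [exists t0|exists 0 => t /lb].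
pose m := inf T; have mT t : T t -> m <= t by apply: ge_inf; exists 0 => s /lb.
have dist (t s : R) : enorm (q - t *: u - (q - s *: u)) = `|s - t|.
  rewrite (_ : _ - _ = (s - t) *: u); first by rewrite enormZ u1 mulr1.
  by apply/rowP => i; rewrite !mxE; ring.
have Vm : V (q - m *: u).
  apply: contrapT => nV.
  have /nbhs_enorm[e e0 he] : nbhs (q - m *: u) (~` V).
    by apply: open_nbhs_nbhs; split=> //; exact: closed_openC.
  have [t Tt tm] := inf_adherent e0 hT.
  apply: (he (q - t *: u)) => //; rewrite dist ler0_norm ?subr_le0 ?mT//.
  rewrite opprB ltrBlDl; exact: tm.
exists m; split=> //; apply/closed_boundaryP => //; split=> //.
move=> /interior_eball[e e0 he].
have : m <= m - e; last by lra.
apply: mT; apply: he; rewrite /eball/= dist.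
by rewrite opprB addrC subrK ger0_norm// ltW.
Qed.

(** At a point x of A, the lowest point p of U over x + y is at distance
    o(|y|) from some z in A because A fills its chart at x, and the ball that
    touches I at z forces I to contain a point at distance O(|p - z|^2) above
    p, that is at height o(|y|^2) above p. *)
Lemma filled_sandwich I U A (r rho M : R) i b x u : closed U ->
  0 < r -> 0 < rho -> 0 < M ->
  eball 0 rho `<=` U -> (forall x, U x -> enorm x <= M) ->
  (forall p, boundary U p -> exists v, outer_unit_normal U p v) ->
  I `<=` U ->
  (forall z, A z -> exists v, touching_ball I r z v /\ outer_unit_normal U z v) ->
  (forall z, A z -> I z) ->
  A x -> half_space i b x -> touching_ball I r x u -> outer_unit_normal U x u ->
  filled_at (central_chart i @` (A `&` half_space i b)) (central_chart i x) ->
  forall e : R, 0 < e -> \forall y \near (0 : 'rV[R]_n), dot y u = 0 ->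
    forall t, U (x + y - t *: u) ->
      exists2 s, s <= t + e * dot y y & I (x + y - s *: u).
Proof.
move=> cU r0 rho0 M0 rhoU UM nU IU tA AI Ax bx tx nx filled e e0.
have u1 := nx.1.
have [C C0 lip] := central_chart_lipschitz i b rho0 M0 rhoU UM.
have [D D0 [e1 e10 loc]] := central_chart_local bx.
pose k := C * D * 2; have k0 : 0 < k by rewrite !mulr_gt0.
(* The resulting height is at most 4 (k e2)^2 / r times |y|^2. *)
pose e2 := Num.min 1 (r * e / (4 * k ^+ 2)).
have e20 : 0 < e2.
  by rewrite lt_min ltr01 divr_gt0 ?mulr_gt0 ?exprn_gt0.
have e21 : e2 <= 1 by rewrite ge_min lexx.
have e2e : 4 * (k * e2) ^+ 2 / r <= e.
  have h : e2 <= r * e / (4 * k ^+ 2) by rewrite ge_min lexx orbT.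
  move: h; rewrite ler_pdivlMr ?mulr_gt0 ?exprn_gt0// => h.
  rewrite ler_pdivrMr// [leRHS]mulrC; apply: le_trans h.
  rewrite exprMn (_ : 4 * (_ * _) = e2 * (4 * k ^+ 2) * e2); last by ring.
  by rewrite ler_piMr// mulr_ge0 ?ltW// mulr_gt0// exprn_gt0.
have /nbhs_ballP[e3 /= e30 fill] := filled e2 e20.
near=> y => yu t Ut.
have qr : enorm y < r by near: y; exact: near_norm_lt.
have q1 : enorm y < e1 / 2 by near: y; apply: near_norm_lt; rewrite divr_gt0.
have q3 : enorm y < e3 / (D * 2) by near: y; apply: near_norm_lt; rewrite divr_gt0// mulr_gt0.
have q4 : enorm y < r / 4 / k.
  by near: y; apply: near_norm_lt; rewrite divr_gt0// divr_gt0.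
have q5 : enorm y < r / 2 / (k + 2).
  by near: y; apply: near_norm_lt; rewrite divr_gt0 ?divr_gt0// addr_gt0.
set q := enorm y in qr q1 q3 q4 q5; have q0 : 0 <= q by exact: enorm_ge0.
have qq : dot y y = q ^+ 2 by rewrite sqr_enorm.
have eq0 : 0 <= e * dot y y by rewrite mulr_ge0 ?dotxx_ge0// ltW.
have [t1|t1] := leP (dot y y / r) t.
  exists (dot y y / r); first by rewrite (le_trans t1)// lerDl.
  by apply: touching_ball_sagitta => //; exact: ltW.
have [m [bp mt]] : exists m, boundary U (x + y - m *: u) /\
    forall t, U (x + y - t *: u) -> m <= t.
  by apply: lowest_point => // [|s /(tangent_height_ge0 nx yu)//]; exists t.
have m0 : 0 <= m.
  by apply: tangent_height_ge0 nx yu _; case/closed_boundaryP: bp.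
have mq : m <= q.
  apply: le_trans (mt t Ut) _; apply: le_trans (ltW t1) _.
  by rewrite qq ler_pdivrMr// expr2 ler_wpM2l// ltW.
set p := x + y - m *: u in bp.
have px : enorm (p - x) <= 2 * q.
  rewrite (_ : p - x = y + (- m) *: u); last first.
    by apply/rowP => j; rewrite !mxE; ring.
  apply: le_trans (enormD _ _) _; rewrite enormZ u1 mulr1 normrN ger0_norm//.
  by rewrite -/q; lra.
have [bpi Dp] : half_space i b p /\
    `|central_chart i p - central_chart i x| <= D * enorm (p - x).
  by apply: loc; apply: le_lt_trans px _; lra.
have Dq : `|central_chart i p - central_chart i x| <= D * 2 * q.
  by apply: le_trans Dp _; rewrite -mulrA ler_wpM2l// ltW.
have [_ [z [Az bz] <-] zp] : exists2 w, (central_chart i @` (A `&` half_space i b)) w &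
    `|w - central_chart i p| <= e2 * `|central_chart i p - central_chart i x|.
  apply: fill; rewrite -ball_normE /= distrC; apply: le_lt_trans Dq _.
  by rewrite mulrC -ltr_pdivlMr// mulr_gt0.
have [v [tz nz]] := tA z Az; have [Up _] := (closed_boundaryP _ cU).1 bp.
have wk : enorm (p - z) <= k * e2 * q.
  rewrite enormB; apply: le_trans (lip z p _ _ _ _ bz bpi) _.
  - by apply/IU/AI.
  - by exists v.
  - by [].
  - exact: nU.
  rewrite /k -!mulrA ler_wpM2l ?(ltW C0)//; apply: le_trans zp _.
  rewrite [leRHS](_ : _ = e2 * (D * 2 * q)); last by ring.
  by rewrite ler_wpM2l// ltW.
have wkq : enorm (p - z) <= k * q.
  apply: le_trans wk _; rewrite -mulrA ler_wpM2l ?(ltW k0)//.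
  by rewrite ler_piMl.
have uv : 2^-1 <= dot u v.
  have := touching_ball_normals r0 tx (outer_unit_normal_subset IU nz).
  have zx : enorm (z - x) <= (k + 2) * q.
    apply: le_trans (enorm_dist z p x) _; rewrite enormB mulrDl lerD//.
  have : (k + 2) * q < r / 2 by rewrite mulrC -ltr_pdivlMr// addr_gt0.
  move=> h1 h2; have : r * (1 - dot u v) <= r * 2^-1 by lra.
  rewrite ler_pM2l//; lra.
have wv : dot (p - z) v <= 0 by exact: nz.2.
have wr : enorm (p - z) <= r / 4.
  by apply: le_trans wkq _; rewrite mulrC -ler_pdivlMr// ltW.
have := touching_ball_enter r0 tz u1 uv wv wr.
rewrite [z + _]addrC subrK => Ip.
exists (m + 4 * dot (p - z) (p - z) / r).
  rewrite lerD ?mt// qq -sqr_enorm.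
  apply: (@le_trans _ _ (4 * (k * e2) ^+ 2 / r * q ^+ 2)); last first.
    by rewrite ler_wpM2r// exprn_ge0.
  rewrite [leRHS]mulrAC ler_wpM2r ?invr_ge0 ?(ltW r0)// -[leRHS]mulrA -exprMn ler_wpM2l//.
  by rewrite lerXn2r// nnegrE ?enorm_ge0// mulr_ge0// mulr_ge0// ltW.
by rewrite scalerDl opprD addrA.
Unshelve. all: by end_near. Qed.

End boundary_measure.

(** * The common boundary of two bodies with convex union *)

Section common_boundary.
Context {R : realType} {d : nat}.
Local Notation n := d.+1.
Variables (K L : set 'rV[R]_n) (r rho M : R).
Hypotheses (r0 : 0 < r) (rho0 : 0 < rho) (M0 : 0 < M).
Hypotheses (cK : closed K) (cL : closed L).
Hypothesis touchK : forall x, boundary K x -> touching_ball K r x (normal K x).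
Hypothesis touchL : forall x, boundary L x -> touching_ball L r x (normal L x).
Hypotheses (rhoK : eball 0 rho `<=` K) (rhoL : eball 0 rho `<=` L).
Hypothesis KLM : forall x, (K `|` L) x -> enorm x <= M.
Hypothesis cvxU : convex (K `|` L).
Implicit Types (x y z w u : 'rV[R]_n).

Let A := boundary K `&` boundary L.
Let U := K `|` L.
Let I := K `&` L.

Lemma union_boundary_normal x : boundary U x -> exists u, outer_unit_normal U x u.
Proof.
move=> /(boundary_setU_sub cK cL)[[[bK bL]|[bK nL]]|[bL nK]].
- have [_ nU] := common_touching_ball r0 rho0 touchK touchL rhoK rhoL cvxU bK bL.
  by exists (normal K x).
- have [_ _ nU] := outside_union r0 cK cL touchK cvxU bK nL.
  by exists (normal K x).
- have cvxU' : convex (L `|` K) by rewrite setUC.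
  have [_ _ nU] := outside_union r0 cL cK touchL cvxU' bL nK.
  by exists (normal L x); rewrite /U setUC.
Qed.

Let common x : A x -> touching_ball I r x (normal K x) /\
  outer_unit_normal U x (normal K x).
Proof.
by move=> [bK bL]; exact: (common_touching_ball r0 rho0 touchK touchL rhoK rhoL cvxU bK bL).
Qed.

Let filled i b x := filled_at (central_chart i @` (A `&` half_space i b)) (central_chart i x).

Lemma common_boundary_hessians i b x : A x -> half_space i b x -> filled i b x ->
  forall V, I `<=` V -> V `<=` U ->
  normal V x = normal K x /\ curvatures V x = curvatures U x.
Proof.
move=> Ax bx fx V IV VU; have [tI nU] := common Ax.
have nV : outer_unit_normal V x (normal K x) by exact: outer_unit_normal_subset nU.
have tV := touching_ball_subset tI nV IV.
have tU := touching_ball_subset tV nU VU.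
have nVE := touching_ball_normalE r0 tV.
split=> //; apply/curvatures_eq/(boundary_hessian_sandwich VU nVE).
  exact: touching_ball_normalE r0 tU.
move=> e e0; apply: filterS (filled_sandwich (I := I) (A := A) (closedU cK cL) r0
  rho0 M0 _ KLM union_boundary_normal _ _ _ Ax bx tI nU fx e0).
- by move=> y h yu t /(h yu)[s st Is]; exists s => //; exact: IV.
- by move=> y /rhoK Ky; left.
- by move=> y [Ky _]; left.
- by move=> z /common; exists (normal K z).
- by move=> z [/closed_boundaryP-/(_ cK)[Kz _] /closed_boundaryP-/(_ cL)[Lz _]].
Qed.

(** Almost every point of the common boundary is a point where the common
    boundary is not porous, so that the four bodies have there the same normal
    and the same expansion, or all fail to have one. *)
Lemma common_boundary_ae : (0 < d)%N -> exists P, [/\ P `<=` A,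
  hausdorff d P = 0%E & forall x, (A `\` P) x ->
    forall V, I `<=` V -> V `<=` U ->
    normal V x = normal K x /\ curvatures V x = curvatures U x].
Proof.
move=> d0; pose P (j : 'I_n * bool) := [set x | A x /\ half_space j.1 j.2 x /\
  ~ filled j.1 j.2 x].
exists (\bigcup_j P j); split.
- by move=> x [j _ []].
- apply/eqP; rewrite eq_le hausdorff_ge0 andbT.
  apply: le_trans (hausdorff_bigcup_fin _ _) _; rewrite big1// => -[i b] _.
  have rhoU : eball 0 rho `<=` U by move=> y /rhoK Ky; left.
  have [C C0 hC] := central_chart_lipschitz i b rho0 M0 rhoU KLM.
  apply: (porous_null (X := A `&` half_space i b) (h := central_chart i)
    (S := central_chart i @` (A `&` half_space i b)) d0 C0).
  + move=> x y [Ax bx] [Ay by']; apply: hC => //.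
    * by left; case: Ax => /closed_boundaryP-/(_ cK)[].
    * by exists (normal K x); case: (common Ax).
    * by left; case: Ay => /closed_boundaryP-/(_ cK)[].
    * by exists (normal K y); case: (common Ay).
  + by move=> x [Ax [bx _]].
  + by move=> x [Ax [bx nf]]; split=> //; exists x.
- move=> x [Ax nP]; have x0 : x != 0.
    apply/eqP => x0; have [+ _] := Ax => /closed_boundaryP-/(_ cK)[_ []].
    apply/interior_enorm; exists rho => // y; rewrite x0 => yr; apply: rhoK.
    exact: ltW.
  have [i [b [bx _]]] := max_coord_half_space x0.
  have fx : filled i b x by apply: contrapT => nf; apply: nP; exists (i, b).
  exact: common_boundary_hessians bx fx.
Qed.

End common_boundary.

(** * Curvatures *)

Section symmetric_functions.
Context {R : realType}.

Definition elementary_symmetric (m j : nat) (k : 'rV[R]_m) : R :=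
  \sum_(I : {set 'I_m} | #|I| == j) \prod_(i in I) k 0 i.

Lemma elementary_symmetricZ m j a (k : 'rV[R]_m) :
  elementary_symmetric j (a *: k) = a ^+ j * elementary_symmetric j k.
Proof.
rewrite /elementary_symmetric mulr_sumr; apply: eq_bigr => I /eqP <-.
rewrite -prodr_const -big_split/=; apply: eq_bigr => i _.
by rewrite mxE.
Qed.

(** Up to sign, the elementary symmetric functions are the coefficients of the
    polynomial with the given roots. *)
Lemma elementary_symmetric_roots m j (k k' : 'rV[R]_m) :
  \prod_(i < m) ('X - (k 0 i)%:P) = \prod_(i < m) ('X - (k' 0 i)%:P) ->
  elementary_symmetric j k = elementary_symmetric j k'.
Proof.
move=> kk'; have [mj|jm] := ltnP m j.
  rewrite /elementary_symmetric !big1// => I /eqP Ij;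
    by have := max_card (mem I); rewrite card_ord Ij leqNgt mj.
have coefE (q : 'rV[R]_m) : (\prod_(i < m) ('X - (q 0 i)%:P))`_(m - j) =
    (-1) ^+ j * elementary_symmetric j q.
  under eq_bigr => i _ do rewrite addrC -raddfN/=.
  rewrite bigA_distr /= coef_sum.
  transitivity (\sum_(I in {set 'I_m}) if #|I| == j then
                  \prod_(i < m | i \in I) - q 0 i else 0).
    apply: eq_bigr => I _.
    rewrite big_if/= big_const iter_mulr_1 -rmorph_prod/= coefCM coefXn.
    have -> : (m - j == #|[predC I]|)%N = (#|I| == j).
      by have := cardC I; rewrite card_ord; lia.
    by case: ifP; rewrite ?mulr1 ?mulr0.
  rewrite -big_mkcond mulr_sumr/=; apply: eq_big => // I /eqP <-.
  by rewrite prodrN.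
have := congr1 (fun p : {poly R} => p`_(m - j)) kk'; rewrite !coefE.
by apply: mulfI; rewrite signr_eq0.
Qed.

Lemma char_polyZ m (A : 'M[R]_m) c : c != 0 ->
  char_poly (c *: A) \Po (c *: 'X) = c ^+ m *: char_poly A.
Proof.
move=> c0; rewrite /char_poly -[LHS]/(comp_poly _ _) -det_map_mx.
rewrite -[RHS]mul_polyC polyC_exp -detZ; congr (\det _); apply/matrixP => i j.
rewrite !mxE rmorphB rmorphMn /= comp_polyX comp_polyC mulrBr -mul_polyC polyCM.
by rewrite mulrnAr.
Qed.

Lemma char_poly_prodZ m (A : 'M[R]_m.+1) (k : 'rV[R]_m) c : c != 0 ->
  char_poly A = 'X * \prod_(i < m) ('X - (k 0 i)%:P) ->
  char_poly (c *: A) = 'X * \prod_(i < m) ('X - ((c *: k) 0 i)%:P).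
Proof.
move=> c0 Ak.
have K (p : {poly R}) : (p \Po (c *: 'X)) \Po (c^-1 *: 'X) = p.
  by rewrite -comp_polyA comp_polyZ comp_polyX scalerA mulfV// scale1r comp_polyXr.
rewrite -[LHS]K -[RHS]K; congr (_ \Po _).
rewrite char_polyZ// Ak comp_polyM comp_polyX rmorph_prod/=.
under [in RHS]eq_bigr => i _.
  rewrite rmorphB /= comp_polyX comp_polyC mxE polyCM -mul_polyC -mulrBr.
over.
rewrite big_split/= prodr_const card_ord -mul_polyC exprS rmorphM rmorphXn /= -!mul_polyC.
by rewrite mulrACA.
Qed.

Lemma char_poly_orthogonal m (A T : 'M[R]_m) : T *m T^T = 1%:M ->
  char_poly (T^T *m A *m T) = char_poly A.
Proof.
move=> TT; have TT' := mulmx1C TT.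
have pTT : map_mx polyC T^T *m map_mx polyC T = 1%:M.
  by rewrite -map_mxM TT' map_mx1.
rewrite /char_poly.
have -> : char_poly_mx (T^T *m A *m T) =
    map_mx polyC T^T *m char_poly_mx A *m map_mx polyC T.
  rewrite /char_poly_mx mulmxBr mulmxBl !map_mxM; congr (_ - _).
  by rewrite mul_mx_scalar -scalemxAl pTT scalemx1.
rewrite !det_mulmx mulrAC -det_mulmx pTT det1 mul1r//.
Qed.

End symmetric_functions.

Section hessian_theory.
Context {R : realType} {n : nat}.
Implicit Types (x y z w u v : 'rV[R]_n) (K : set 'rV[R]_n) (A B : 'M[R]_n).

Lemma dot_mulmx x y : dot x y = (x *m y^T) 0 0.
Proof. by rewrite mxE; apply: eq_bigr => i _; rewrite mxE. Qed.

Lemma dot_mulmx_trans A x y : dot (x *m A) y = dot x (y *m A^T).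
Proof. by rewrite !dot_mulmx trmx_mul trmxK mulmxA. Qed.

Lemma symmetric_form_eq0 A : A^T = A -> (forall v, dot (v *m A) v = 0) -> A = 0.
Proof.
move=> AT A0; apply/matrixP => i j; rewrite mxE.
have polar u v : dot (u *m A) v = 0.
  have sym : dot (v *m A) u = dot (u *m A) v by rewrite dot_mulmx_trans AT dotC.
  by have := A0 (u + v); rewrite mulmxDl !dotE !A0 sym; lra.
have := polar (delta_mx 0 i) (delta_mx 0 j).
by rewrite dot_mulmx -rowE trmx_delta -colE !mxE.
Qed.

Lemma near0_line (Q : set 'rV[R]_n) w : (\forall y \near (0 : 'rV[R]_n), Q y) ->
  exists2 t : R, 0 < t & Q (t *: w).
Proof.
move=> /nbhs_enorm[d d0 hd].
have w1 : 0 < enorm w + 1 by have := enorm_ge0 w; lra.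
exists (d / (enorm w + 1)); first by rewrite divr_gt0.
apply: hd; rewrite subr0 enormZ gtr0_norm ?divr_gt0//.
by rewrite mulrAC ltr_pdivrMr// ltr_pM2l// ltrDl.
Qed.

(** On the tangent hyperplane, half the quadratic form at w is the limit of the
    height at t w divided by t^2; in the normal direction the form vanishes. *)
Lemma boundary_hessian_unique K x A B : enorm (normal K x) = 1 ->
  boundary_hessian K x A -> boundary_hessian K x B -> A = B.
Proof.
move=> N1 [AT NA hA] [BT NB hB].
set N := normal K x in N1 NA NB hA hB; have NN := enorm1_dot N1.
have tang w : dot w N = 0 -> dot (w *m A) w = dot (w *m B) w.
  move=> wN; set a := dot (w *m A) w; set b := dot (w *m B) w.
  apply/eqP; rewrite -subr_eq0 -normr_le0.
  apply/ler_addgt0Pr => e e0; rewrite add0r.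
  set W := dot w w; have W0 : 0 <= W by exact: dotxx_ge0.
  pose f := e / (4 * (W + 1)).
  have f0 : 0 < f by rewrite divr_gt0// mulr_gt0//; lra.
  have [t t0 []] := near0_line w (filterI (hA f f0) (hB f f0)).
  rewrite -!scalemxAl !dotZl !dotZr wN mulr0 -/a -/b -/W.
  move=> /(_ erefl) + /(_ erefl); case: height => [h| |]//.
  rewrite !lee_fin !ler_norml => h1 h2.
  have t20 : 0 < t * t by rewrite mulr_gt0.
  have fW : 4 * f * W <= e.
    have W1 : 0 < W + 1 by lra.
    have -> : 4 * f * W = e * (W / (W + 1)) by rewrite /f; field; rewrite gt_eqF.
    by rewrite ler_piMr ?(ltW e0)// ler_pdivrMr// mul1r lerDl.
  have h5 : t * t * (4 * f * W) <= t * t * e by rewrite ler_pM2l.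
  move: h1 h2 => /andP[h1 h2] /andP[h3 h4].
  by apply/andP; split; rewrite -(ler_pM2l t20); lra.
have CT : (A - B)^T = A - B by rewrite linearB /= AT BT.
have NC : N *m (A - B) = 0 by rewrite mulmxBr NA NB subrr.
apply/eqP; rewrite -subr_eq0; apply/eqP; apply: symmetric_form_eq0 => // v.
set c := dot v N; have vE : v = (v - c *: N) + c *: N by rewrite subrK.
set w := v - c *: N in vE; have wN : dot w N = 0.
  by rewrite /w !dotE NN -/c; ring.
clearbody w; rewrite vE mulmxDl -scalemxAl NC scaler0 addr0 !dotE.
rewrite [dot _ N]dot_mulmx_trans CT NC (dotC w 0) dot0l mulr0 addr0.
by rewrite mulmxBr !dotE tang// subrr.
Qed.

Lemma height_bounds K r x u y : 0 < r -> touching_ball K r x u ->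
  normal K x = u -> dot y u = 0 -> enorm y <= r ->
  (0 <= height K x y <= (dot y y / r)%:E)%E.
Proof.
move=> r0 tK nE yu yr; rewrite /height nE; apply/andP; split.
  apply: le_ereal_inf_tmp => _ [t Kt <-]; rewrite lee_fin.
  exact: tangent_height_ge0 tK.1 yu Kt.
apply: ereal_inf_lbound; exists (dot y y / r) => //; exact: touching_ball_sagitta.
Qed.

(** The lower bound is convexity, the upper bound comes from the touching ball;
    an eigenvector of a nonzero eigenvalue has a nonzero tangential part. *)
Lemma hessian_eigenvalue_bounds K r x u A v (k : R) : 0 < r ->
  touching_ball K r x u -> boundary_hessian K x A ->
  v *m A = k *: v -> v != 0 -> 0 <= k <= 2 / r.
Proof.
move=> r0 tK [AT NA hA] vA v0.
have nE := touching_ball_normalE r0 tK; rewrite nE in NA hA.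
have uu := enorm1_dot tK.1.1; set c := dot v u.
set w := v - c *: u; have wu : dot w u = 0 by rewrite /w !dotE uu -/c; ring.
have wA : w *m A = k *: v by rewrite mulmxBl -scalemxAl NA scaler0 subr0.
have [w0|w0] := eqVneq w 0.
  have : k *: v = 0 by rewrite -wA w0 mul0mx.
  move/eqP; rewrite scaler_eq0 (negbTE v0) orbF => /eqP ->.
  by rewrite lexx divr_ge0// ltW.
have wAw : dot (w *m A) w = k * dot w w.
  rewrite wA dotZl; congr (_ * _); rewrite -[v](subrK (c *: u)) -/w dotDl.
  by rewrite dotZl (dotC u) wu mulr0 addr0.
have W0 : 0 < dot w w by rewrite lt0r dotxx_eq0 w0 dotxx_ge0.
have bound f : 0 < f -> - f <= k / 2 <= 1 / r + f.
  move=> f0; have [t t0 []] := near0_line w (filterI (near_norm_lt r0) (hA f f0)).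
  move=> tr; have twu : dot (t *: w) u = 0 by rewrite dotZl wu mulr0.
  have /andP[h1 h2] := height_bounds r0 tK nE twu (ltW tr).
  move=> /(_ twu); move: h1 h2; rewrite -!scalemxAl !dotZl !dotZr wAw.
  case: height => [h| |]//; rewrite !lee_fin ler_norml => h1 h2 /andP[h3 h4].
  have tW : 0 < t * (t * dot w w) by rewrite !mulr_gt0.
  by apply/andP; split; rewrite -(ler_pM2l tW); lra.
apply/andP; split.
  apply/ler_addgt0Pr => e e0; have e20 : 0 < e / 2 by lra.
  by have /andP[+ _] := bound _ e20; lra.
apply/ler_addgt0Pr => e e0; have e20 : 0 < e / 2 by lra.
by have /andP[_] := bound _ e20; lra.
Qed.

End hessian_theory.

(** * Behaviour under similarities *)

Section similarity.
Context {R : realType} {n : nat}.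
Implicit Types (x y z w u v : 'rV[R]_n) (K : set 'rV[R]_n) (A B T : 'M[R]_n).

Definition similarity (a : R) T : 'rV[R]_n -> 'rV[R]_n := fun x => a *: (x *m T).

Lemma similarityK a T : a != 0 -> T *m T^T = 1%:M ->
  cancel (similarity a T) (similarity a^-1 T^T).
Proof.
move=> a0 TT x; rewrite /similarity -scalemxAl scalerA mulVf// scale1r.
by rewrite -mulmxA TT mulmx1.
Qed.

Lemma orthogonal_trmx T : T *m T^T = 1%:M -> T^T *m T^T^T = 1%:M.
Proof. by move=> /mulmx1C; rewrite trmxK. Qed.

Lemma similarityVK a T : a != 0 -> T *m T^T = 1%:M ->
  cancel (similarity a^-1 T^T) (similarity a T).
Proof.
move=> a0 TT; have := @similarityK a^-1 T^T (invr_neq0 a0) (orthogonal_trmx TT).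
by rewrite invrK trmxK.
Qed.

Lemma similarity_preimage a T K : a != 0 -> T *m T^T = 1%:M ->
  similarity a^-1 T^T @` (similarity a T @` K) = K.
Proof.
move=> a0 TT; apply/seteqP; split=> [_ [_ [x Kx <-] <-]|x Kx].
  by rewrite similarityK.
by exists (similarity a T x); [exists x|exact: similarityK].
Qed.

Lemma dot_orthogonal T x y : T *m T^T = 1%:M -> dot (x *m T) (y *m T) = dot x y.
Proof. by move=> TT; rewrite dot_mulmx_trans -mulmxA TT mulmx1. Qed.

Lemma enorm_orthogonal T x : T *m T^T = 1%:M -> enorm (x *m T) = enorm x.
Proof. by move=> TT; rewrite /enorm dot_orthogonal. Qed.

Lemma similarityB a T x y : similarity a T (x - y) = similarity a T x - similarity a T y.
Proof. by rewrite /similarity mulmxBl scalerBr. Qed.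

Lemma enorm_similarity a T x : 0 < a -> T *m T^T = 1%:M ->
  enorm (similarity a T x) = a * enorm x.
Proof. by move=> a0 TT; rewrite enormZ gtr0_norm// enorm_orthogonal. Qed.

Lemma interior_similarity_sub a T K x : 0 < a -> T *m T^T = 1%:M ->
  interior K x -> interior (similarity a T @` K) (similarity a T x).
Proof.
move=> a0 TT /interior_enorm[e e0 he]; apply/interior_enorm.
exists (a * e); first by rewrite mulr_gt0.
move=> y; rewrite -(similarityVK (lt0r_neq0 a0) TT y) -similarityB enorm_similarity//.
by rewrite ltr_pM2l// => /he Ky; eexists; [exact: Ky|].
Qed.

Lemma interior_similarity a T K x : 0 < a -> T *m T^T = 1%:M ->
  interior (similarity a T @` K) (similarity a T x) <-> interior K x.
Proof.
move=> a0 TT; split; last exact: interior_similarity_sub.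
have ai : 0 < a^-1 by rewrite invr_gt0.
move=> /(interior_similarity_sub ai (orthogonal_trmx TT)).
by rewrite similarity_preimage ?similarityK// lt0r_neq0.
Qed.

Lemma closed_similarity a T K : 0 < a -> T *m T^T = 1%:M ->
  closed K -> closed (similarity a T @` K).
Proof.
move=> a0 TT cK; rewrite -[X in closed X]setCK; apply: open_closedC.
have -> : ~` (similarity a T @` K) = similarity a T @` (~` K).
  apply/seteqP; split=> [y nKy|_ [x nKx <-] [x' Kx']].
    exists (similarity a^-1 T^T y); last by rewrite similarityVK ?lt0r_neq0.
    by move=> Ky; apply: nKy; eexists; [exact: Ky|rewrite similarityVK ?lt0r_neq0].
  by move=> /(can_inj (similarityK (lt0r_neq0 a0) TT)) xx; rewrite xx in Kx'.
have oK : open (~` K) by exact: closed_openC.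
rewrite openE => _ [x nKx <-]; apply: interior_similarity_sub => //.
by move: oK; rewrite openE; apply.
Qed.

Lemma boundary_similarity a T K : 0 < a -> T *m T^T = 1%:M -> closed K ->
  boundary (similarity a T @` K) = similarity a T @` boundary K.
Proof.
move=> a0 TT cK; have cK' := closed_similarity a0 TT cK.
apply/seteqP; split=> [y /closed_boundaryP-/(_ cK')[[x Kx <-] nK']|_ [x bx <-]].
  exists x => //; apply/closed_boundaryP => //; split=> // iK; apply: nK'.
  exact/interior_similarity.
have [Kx nK] := (closed_boundaryP _ cK).1 bx.
by apply/closed_boundaryP => //; split; [exists x|move/(interior_similarity K x a0 TT)].
Qed.

Lemma touching_ball_similarity a T K r x u : 0 < a -> T *m T^T = 1%:M ->
  touching_ball K r x u ->
  touching_ball (similarity a T @` K) (a * r) (similarity a T x) (u *m T).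
Proof.
move=> a0 TT [[u1 hu] bK]; split; first split.
- by rewrite enorm_orthogonal.
- move=> _ [y Ky <-]; rewrite -similarityB dotZl dot_orthogonal//.
  by rewrite pmulr_rle0//; exact: hu.
- move=> y; rewrite /eball/=.
  rewrite -(similarityVK (lt0r_neq0 a0) TT y); set z := similarity a^-1 _ _.
  rewrite (_ : _ - _ = similarity a T (z - (x - r *: u))); last first.
    rewrite !similarityB; congr (_ - (_ - _)).
    by rewrite /similarity -scalemxAl scalerA.
  by rewrite enorm_similarity// ler_pM2l// => /bK Kz; exists z.
Qed.

Lemma height_similarity a T K x y : 0 < a -> T *m T^T = 1%:M ->
  normal (similarity a T @` K) (similarity a T x) = normal K x *m T ->
  height (similarity a T @` K) (similarity a T x) (similarity a T y) =
  (a%:E * height K x y)%E.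
Proof.
move=> a0 TT nE; rewrite /height nE -ereal_inf_pZl//; congr ereal_inf.
have lineE t : similarity a T x + similarity a T y - (a * t) *: (normal K x *m T) =
    similarity a T (x + y - t *: normal K x).
  by rewrite similarityB /similarity mulmxDl scalerDr -scalemxAl scalerA.
apply/seteqP; split=> [_ [t [z Kz zt] <-]|_ [_ [t Kt <-] <-]].
  have te : t = a * (a^-1 * t) by rewrite mulVKf// lt0r_neq0.
  rewrite te lineE in zt; exists (a^-1 * t)%:E; last by rewrite -EFinM -te.
  exists (a^-1 * t) => //=.
  by rewrite -(can_inj (similarityK (lt0r_neq0 a0) TT) zt).
exists (a * t); last by rewrite EFinM.
by rewrite /= lineE; eexists; [exact: Kt|].
Qed.

Lemma boundary_hessian_similarity a T K x A : 0 < a -> T *m T^T = 1%:M ->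
  normal (similarity a T @` K) (similarity a T x) = normal K x *m T ->
  boundary_hessian K x A ->
  boundary_hessian (similarity a T @` K) (similarity a T x)
    (a^-1 *: (T^T *m A *m T)).
Proof.
move=> a0 TT nE [AT NA hA]; split.
- by rewrite linearZ /= !trmx_mul trmxK AT mulmxA.
- rewrite nE -scalemxAr !mulmxA -[_ *m T *m T^T]mulmxA TT mulmx1 NA.
  by rewrite mul0mx scaler0.
move=> e e0; have /nbhs_enorm[d d0 hd] := hA _ (mulr_gt0 a0 e0).
apply/nbhs_enorm; exists (a * d); first by rewrite mulr_gt0.
move=> y'; rewrite -(similarityVK (lt0r_neq0 a0) TT y'); set y := similarity a^-1 _ _.
rewrite subr0 enorm_similarity// ltr_pM2l// => yd.
rewrite nE {1}/similarity dotZl dot_orthogonal// => /eqP.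
rewrite mulf_eq0 gt_eqF//= => /eqP yN.
have := hd y; rewrite subr0 => /(_ yd yN).
rewrite height_similarity//.
have -> : dot (similarity a T y *m (a^-1 *: (T^T *m A *m T))) (similarity a T y) =
    a * dot (y *m A) y.
  rewrite /similarity -scalemxAl -scalemxAr scalerA mulfV ?gt_eqF// scale1r.
  rewrite !mulmxA -[_ *m T *m T^T]mulmxA TT mulmx1 dotZr dot_orthogonal//.
have -> : dot (similarity a T y) (similarity a T y) = a * (a * dot y y).
  by rewrite /similarity dotZl dotZr dot_orthogonal.
case: height => [h| |]//=.
rewrite !lee_fin => hq.
rewrite (_ : _ - _ = a * (h - 2^-1 * dot (y *m A) y)); last by ring.
rewrite (_ : e * _ = a * (a * e * dot y y)); last by ring.
by rewrite normrM gtr0_norm// ler_pM2l.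
Qed.

End similarity.

Section curvature_theory.
Context {R : realType} {d : nat}.
Local Notation n := d.+1.
Implicit Types (x u : 'rV[R]_n) (K : set 'rV[R]_n) (A T : 'M[R]_n) (k : 'rV[R]_d).

Definition curvature_list K x k : Prop := exists2 A, boundary_hessian K x A &
  char_poly A = 'X * \prod_(i < d) ('X - (k 0 i)%:P).

Lemma curvaturesP K x :
  (exists k, curvature_list K x k) -> curvature_list K x (curvatures K x).
Proof. by move=> h; exact: (xgetPex 0 h). Qed.

Lemma curvatures_none K x :
  ~ (exists k, curvature_list K x k) -> curvatures K x = 0.
Proof.
move=> h; rewrite /curvatures; case: xgetP => [k _ hk|//].
by case: h; exists k.
Qed.

Lemma curvature_list_esym K x k k' j : enorm (normal K x) = 1 ->
  curvature_list K x k -> curvature_list K x k' ->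
  elementary_symmetric j k = elementary_symmetric j k'.
Proof.
move=> N1 [A hA cA] [B hB cB]; apply: elementary_symmetric_roots.
apply: (@mulfI _ 'X); first by rewrite polyX_eq0.
by rewrite -cA -cB (boundary_hessian_unique N1 hA hB).
Qed.

Lemma mean_curvatureE j K x :
  mean_curvature j K x = 'C(d, j)%:R^-1 * elementary_symmetric j (curvatures K x).
Proof. by []. Qed.

Lemma curvature_list_similarity a T K x k : 0 < a -> T *m T^T = 1%:M ->
  normal (similarity a T @` K) (similarity a T x) = normal K x *m T ->
  curvature_list K x k ->
  curvature_list (similarity a T @` K) (similarity a T x) (a^-1 *: k).
Proof.
move=> a0 TT nE [A hA cA]; exists (a^-1 *: (T^T *m A *m T)).
  exact: boundary_hessian_similarity.
apply: char_poly_prodZ; first by rewrite invr_neq0// gt_eqF.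
by rewrite char_poly_orthogonal.
Qed.

(** The list of curvatures is an arbitrary choice, but its symmetric functions
    are coefficients of the characteristic polynomial of the unique Hessian. When
    no list exists, all curvatures are 0 on both sides. *)
Lemma mean_curvature_similarity a T K x r u j : 0 < a -> T *m T^T = 1%:M ->
  0 < r -> touching_ball K r x u ->
  mean_curvature j (similarity a T @` K) (similarity a T x) =
  a^-1 ^+ j * mean_curvature j K x.
Proof.
move=> a0 TT r0 tK; have an0 := lt0r_neq0 a0.
have nK := touching_ball_normalE r0 tK.
have nK' := touching_ball_normalE (mulr_gt0 a0 r0) (touching_ball_similarity a0 TT tK).
have nE : normal (similarity a T @` K) (similarity a T x) = normal K x *m T.
  by rewrite nK nK'.
rewrite !mean_curvatureE mulrCA; congr (_ * _); rewrite -elementary_symmetricZ.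
have [[k hk]|none] := pselect (exists k, curvature_list K x k).
  have h1 := curvature_list_similarity a0 TT nE (curvaturesP (ex_intro _ k hk)).
  apply: (@curvature_list_esym (similarity a T @` K) (similarity a T x)) => //.
    by rewrite nE enorm_orthogonal// nK; exact: tK.1.1.
  by apply: curvaturesP; eexists; exact: h1.
rewrite (curvatures_none none) scaler0 curvatures_none// => -[k hk]; apply: none.
exists (a^-1^-1 *: k); have ai : 0 < a^-1 by rewrite invr_gt0.
have := @curvature_list_similarity a^-1 T^T (similarity a T @` K) (similarity a T x) k
  ai (orthogonal_trmx TT).
rewrite similarity_preimage// similarityK//; apply => //.
by rewrite nE -mulmxA TT mulmx1.
Qed.

Lemma curvatures_bounds K r x u i : 0 < r -> touching_ball K r x u ->
  0 <= curvatures K x 0 i <= 2 / r.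
Proof.
move=> r0 tK; have [ex|none] := pselect (exists k, curvature_list K x k); last first.
  by rewrite (curvatures_none none) mxE lexx divr_ge0// ltW.
have [A hA cA] := curvaturesP ex.
have : root (char_poly A) (curvatures K x 0 i).
  by rewrite cA rootE hornerM horner_prod (bigD1 i)//= hornerXsubC subrr mul0r mulr0.
rewrite -eigenvalue_root_char => /eigenvalueP[v vA v0].
exact: hessian_eigenvalue_bounds tK hA vA v0.
Qed.

Lemma mean_curvature_bounds K r x u j : 0 < r -> touching_ball K r x u ->
  0 <= mean_curvature j K x <= 'C(d, j)%:R^-1 *
    \sum_(I : {set 'I_d} | #|I| == j) (2 / r) ^+ j.
Proof.
move=> r0 tK; have k0 i : 0 <= curvatures K x 0 i.
  by have /andP[] := curvatures_bounds i r0 tK.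
rewrite mulr_ge0 ?invr_ge0//=; last first.
  by apply: sumr_ge0 => I _; apply: prodr_ge0 => i _.
rewrite ler_wpM2l ?invr_ge0//; apply: ler_sum => I /eqP <-.
rewrite -prodr_const; apply: ler_prod => i _.
by have := curvatures_bounds i r0 tK.
Qed.

End curvature_theory.

(** * Steiner quermassintegrals *)

Section integrand.
Context {R : realType} {d : nat}.
Local Notation n := d.+1.
Implicit Types (p : R) (m k : nat) (K : set 'rV[R]_n) (x u : 'rV[R]_n) (T : 'M[R]_n).

Definition steiner_integrand p m k K x : R :=
  dot x (normal K x) `^ (m%:R - k%:R + n%:R * (1 - p) / (n%:R + p)) *
  mean_curvature d K x `^ (p / (n%:R + p)) * steiner_sum p m K x.

Lemma steiner_integrand_local p m k K L x : normal K x = normal L x ->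
  curvatures K x = curvatures L x ->
  steiner_integrand p m k K x = steiner_integrand p m k L x.
Proof.
by move=> nE cE; rewrite /steiner_integrand /steiner_sum /mean_curvature nE cE.
Qed.

Lemma steiner_sum_similarity p m a T K x r u : 0 < a -> T *m T^T = 1%:M ->
  0 < r -> touching_ball K r x u ->
  steiner_sum p m (similarity a T @` K) (similarity a T x) =
  a^-1 ^+ m * steiner_sum p m K x.
Proof.
move=> a0 TT r0 tK; rewrite /steiner_sum mulr_sumr; apply: eq_bigr => i /eqP im.
rewrite mulrCA; congr (_ * _); rewrite -[X in a^-1 ^+ X]im -prodrXr -big_split/=.
apply: eq_bigr => j _; rewrite (mean_curvature_similarity j.+1 a0 TT r0 tK).
by rewrite exprMn exprM mulrCA.
Qed.

Lemma steiner_integrand_similarity p m k a T K x r u : 0 < a -> T *m T^T = 1%:M ->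
  0 < r -> touching_ball K r x u -> 0 <= dot x u ->
  steiner_integrand p m k (similarity a T @` K) (similarity a T x) =
  a `^ (m%:R - k%:R + n%:R * (1 - p) / (n%:R + p)) *
    (a^-1 ^+ d) `^ (p / (n%:R + p)) * a^-1 ^+ m * steiner_integrand p m k K x.
Proof.
move=> a0 TT r0 tK xu.
have nK := touching_ball_normalE r0 tK.
have nK' := touching_ball_normalE (mulr_gt0 a0 r0) (touching_ball_similarity a0 TT tK).
have /andP[H0 _] := mean_curvature_bounds d r0 tK.
rewrite /steiner_integrand (steiner_sum_similarity p m a0 TT r0 tK).
rewrite (mean_curvature_similarity d a0 TT r0 tK) nK nK'.
move: H0; move: (mean_curvature d K x) => H H0.
rewrite /similarity dotZl dot_orthogonal// !powRM ?exprn_ge0 ?invr_ge0// ?(ltW a0)//.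
set s := steiner_sum _ _ _ _; ring.
Qed.

Lemma rolling_data K : rolling_body K -> closed K /\
  exists2 r : R, 0 < r & exists2 rho : R, 0 < rho & exists2 M : R, 0 < M &
  [/\ forall x, boundary K x -> touching_ball K r x (normal K x),
      eball 0 rho `<=` K & forall x, K x -> enorm x <= M].
Proof.
move=> [[[cK _ _] iK] inner _]; have clK := rV_compact_closed cK; split=> //.
have [r r0 tK] := inner_rolling_touching clK inner; exists r => //.
have [rho rho0 hrho] := interior_eball iK; exists rho => //.
have [M [_ hM]] := compact_bounded cK.
exists (n%:R * (`|M| + 1)); first by rewrite mulr_gt0// ltr_pwDr.
split=> // x Kx; apply: le_trans (enorm_le_norm _) _.
rewrite ler_wpM2l//; apply: hM => //.
by rewrite (le_lt_trans (ler_norm _))// ltrDl.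
Qed.

Lemma powR_bounded (b B e x : R) : 0 < b -> b <= x <= B ->
  x `^ e <= expR (`|e| * (`|ln b| + `|ln B|)).
Proof.
move=> b0 /andP[bx xB]; have x0 : 0 < x by exact: lt_le_trans bx.
have B0 : 0 < B by exact: lt_le_trans xB.
rewrite /powR gt_eqF// ler_expR (le_trans (ler_norm _))// normrM ler_wpM2l//.
have h1 : ln b <= ln x by rewrite ler_ln ?posrE.
have h2 : ln x <= ln B by rewrite ler_ln ?posrE.
rewrite ler_norml; apply/andP; split.
  apply: le_trans h1; have := ler_norm (- ln b); rewrite normrN.
  by have := normr_ge0 (ln B); lra.
by apply: le_trans h2 _; have := ler_norm (ln B); have := normr_ge0 (ln b); lra.
Qed.

(** The support function stays between two positive constants, the curvatures
    are bounded by the rolling ball, and the range of p makes the exponent of the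
    Gauss curvature nonnegative. *)
Lemma steiner_integrand_bounded p m k K (r rho M : R) :
  0 <= p \/ p < - n%:R -> 0 < r -> 0 < rho ->
  (forall x, boundary K x -> touching_ball K r x (normal K x)) ->
  eball 0 rho `<=` K -> (forall x, boundary K x -> enorm x <= M) ->
  exists C : R, forall x, boundary K x -> `|steiner_integrand p m k K x| <= C.
Proof.
move=> hp r0 rho0 tK rhoK KM.
have q0 : 0 <= p / (n%:R + p).
  have [p0|pn] := hp; first by rewrite divr_ge0// addr_ge0.
  rewrite -mulrNN mulr_ge0// -?invrN ?invr_ge0; last by lra.
  by have := ler0n R n; lra.
pose B j := 'C(d, j)%:R^-1 * \sum_(I : {set 'I_d} | #|I| == j) (2 / r) ^+ j.
have HB j x : boundary K x -> 0 <= mean_curvature j K x <= B j.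
  by move=> bx; exact: mean_curvature_bounds r0 (tK x bx).
set e := m%:R - k%:R + n%:R * (1 - p) / (n%:R + p).
exists (expR (`|e| * (`|ln rho| + `|ln M|)) * B d `^ (p / (n%:R + p)) *
  \sum_(i : {ffun 'I_n.-1 -> 'I_m.+1} | (\sum_(j < n.-1) j.+1 * i j)%N == m)
    `|steiner_coef p (fun j => i j)| *
    \prod_(j < n.-1) ('C(n.-1, j.+1)%:R ^+ i j * B j.+1 ^+ i j)).
move=> x bx; rewrite /steiner_integrand !normrM ler_pM ?mulr_ge0//.
- rewrite ler_pM// ger0_norm ?powR_ge0//.
    apply: powR_bounded => //; have [nK _] := tK x bx.
    rewrite (support_ge (ltW rho0) rhoK nK)/=.
    rewrite (le_trans (cauchy_schwarz _ _))// nK.1 mulr1; exact: KM.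
  have /andP[h0 hB] := HB d x bx; apply: ge0_ler_powR => //.
  by rewrite nnegrE (le_trans h0).
- apply: le_trans (ler_norm_sum _ _ _) _; apply: ler_sum => i _.
  rewrite normrM ler_wpM2l// normr_prod; apply: ler_prod => j _.
  have /andP[h0 hB] := HB j.+1 x bx.
  rewrite normr_ge0/= normrM !normrX (ger0_norm h0) ger0_norm//.
  by rewrite ler_wpM2l ?exprn_ge0// lerXn2r// nnegrE// (le_trans h0).
Qed.

End integrand.

Section similarity_invariance.
Context {R : realType} {d : nat}.
Local Notation n := d.+1.
Implicit Types (p : R) (m k : nat) (K L : set 'rV[R]_n) (T : 'M[R]_n).

Lemma steiner_WE p m k K : steiner_W p m k K =
  \int[surface_measure]_(x in boundary K) steiner_integrand p m k K x.
Proof. by []. Qed.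

(** The exponents contributed by the support function, the curvatures and the
    surface measure add up to a value in which m cancels. *)
Lemma similarity_exponent p m k (a : R) : 0 < a -> n%:R + p != 0 ->
  a `^ (m%:R - k%:R + n%:R * (1 - p) / (n%:R + p)) *
    (a^-1 ^+ d) `^ (p / (n%:R + p)) * a^-1 ^+ m * a ^+ d =
  a `^ (n%:R * ((n%:R - p) / (n%:R + p)) - k%:R).
Proof.
move=> a0 np; have a1 := gt_eqF a0.
have pw i : a^-1 ^+ i = a `^ (- i%:R).
  by rewrite powRN powR_mulrn ?exprVn// ltW.
rewrite !pw -powRrM -(powR_mulrn d (ltW a0)) -!powRD ?a1 ?implybT//.
congr (_ `^ _); rewrite [n%:R]mulrSr; field.
by rewrite -mulrSr.
Qed.

Lemma steiner_W_similarity p m k a T K : n%:R + p != 0 -> 0 < a ->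
  T *m T^T = 1%:M -> rolling_body K ->
  steiner_W p m k (similarity a T @` K) =
  a `^ (n%:R * ((n%:R - p) / (n%:R + p)) - k%:R) * steiner_W p m k K.
Proof.
move=> np a0 TT /rolling_data[cK [r r0 [rho rho0 [M M0 [tK rhoK KM]]]]].
rewrite !steiner_WE boundary_similarity// -(similarity_exponent m k a0 np).
have an0 := lt0r_neq0 a0.
apply: (@surface_integral_similarity R n (similarity a T) (similarity a^-1 T^T)) => //.
- exact: similarityK.
- exact: similarityVK.
- rewrite !mulr_gt0 ?powR_gt0 ?exprn_gt0 ?invr_gt0//.
- by move=> x y; rewrite -similarityB enorm_similarity.
- move=> x /tK tx; apply: (steiner_integrand_similarity p m k a0 TT r0 tx).
  by have := support_ge (ltW rho0) rhoK tx.1; apply: le_trans; exact: ltW.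
Qed.

Lemma steiner_V_similarity p k a T K : n%:R + p != 0 -> 0 < a ->
  T *m T^T = 1%:M -> rolling_body K ->
  steiner_V p k (similarity a T @` K) =
  a `^ (n%:R * ((n%:R - p) / (n%:R + p)) - k%:R) * steiner_V p k K.
Proof.
move=> np a0 TT rK; rewrite /steiner_V mulr_sumr; apply: eq_bigr => m _.
by rewrite steiner_W_similarity// mulrCA.
Qed.

End similarity_invariance.

Section valuation.
Context {R : realType} {d : nat}.
Local Notation n := d.+1.
Local Notation mu := (@surface_measure R n).
Implicit Types (p : R) (m k : nat) (K L : set 'rV[R]_n).

(** The boundaries of the union and of the intersection are made of the same
    pieces as the two given boundaries. *)
Lemma boundary_integral_valuation K L (g : 'rV[R]_n -> R) (C : R) :
  closed K -> closed L -> (mu (boundary K) < +oo)%E -> (mu (boundary L) < +oo)%E ->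
  boundary (K `|` L) = (boundary K `&` boundary L) `|` (boundary K `&` ~` L)
                         `|` (boundary L `&` ~` K) ->
  (forall x, (boundary K `|` boundary L) x -> `|g x| <= C) ->
  \int[mu]_(x in boundary (K `|` L)) g x + \int[mu]_(x in boundary (K `&` L)) g x =
  \int[mu]_(x in boundary K) g x + \int[mu]_(x in boundary L) g x.
Proof.
move=> cK cL Koo Loo UE gC.
have mbK := closed_surface_measurable (@boundary_closed R n K).
have mbL := closed_surface_measurable (@boundary_closed R n L).
have mK := closed_surface_measurable cK; have mL := closed_surface_measurable cL.
have miK := open_surface_measurable (@open_interior _ K).
have miL := open_surface_measurable (@open_interior _ L).
pose H := caratheodory_type (@hausdorff R n d).
pose A := boundary K `&` boundary L.
pose BK := boundary K `&` ~` L; pose BL := boundary L `&` ~` K.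
pose CK := boundary K `&` interior L; pose CL := boundary L `&` interior K.
pose piece (D : set 'rV[R]_n) := [/\ measurable (D : set H), (mu D < +oo)%E &
  D `<=` boundary K `|` boundary L].
have pieceK (D : set 'rV[R]_n) : measurable (D : set H) -> D `<=` boundary K -> piece D.
  move=> mD DK; split=> //; last by move=> x /DK; left.
  by apply: le_lt_trans Koo; apply: le_measure; rewrite ?inE.
have pieceL (D : set 'rV[R]_n) : measurable (D : set H) -> D `<=` boundary L -> piece D.
  move=> mD DL; split=> //; last by move=> x /DL; right.
  by apply: le_lt_trans Loo; apply: le_measure; rewrite ?inE.
have pA : piece A by apply: pieceK; [exact: measurableI|exact: subIsetl].
have pBK : piece BK.
  by apply: pieceK; [apply: measurableI => //; exact: measurableC|exact: subIsetl].
have pBL : piece BL.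
  by apply: pieceL; [apply: measurableI => //; exact: measurableC|exact: subIsetl].
have pCK : piece CK by apply: pieceK; [exact: measurableI|exact: subIsetl].
have pCL : piece CL by apply: pieceL; [exact: measurableI|exact: subIsetl].
have split3 (D1 D2 D3 : set 'rV[R]_n) : piece D1 -> piece D2 -> piece D3 ->
    (forall x, D1 x -> D2 x -> False) -> (forall x, D1 x -> D3 x -> False) ->
    (forall x, D2 x -> D3 x -> False) ->
    \int[mu]_(x in D1 `|` D2 `|` D3) g x =
    \int[mu]_(x in D1) g x + \int[mu]_(x in D2) g x + \int[mu]_(x in D3) g x.
  move=> [m1 f1 s1] [m2 f2 s2] [m3 f3 s3] d12 d13 d23.
  have m12 : measurable (D1 `|` D2 : set H) by exact: measurableU.
  have f12 : (mu (D1 `|` D2) < +oo)%E.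
    by apply: le_lt_trans (outer_measureU2 _ _ _) _; exact: lte_add_pinfty.
  have e12 : D1 `&` D2 = set0 by apply/seteqP; split=> // x [/d12].
  have e123 : (D1 `|` D2) `&` D3 = set0.
    by apply/seteqP; split=> // x [[/d13|/d23]].
  rewrite (@lower_Rintegral_setU _ H R mu (D1 `|` D2) D3 g C m12 m3 e123 f12 f3); last first.
    by move=> x [[/s1|/s2]|/s3]; exact: gC.
  congr (_ + _); apply: (@lower_Rintegral_setU _ H R mu D1 D2 g C m1 m2 e12 f1 f2).
  by move=> x [/s1|/s2]; exact: gC.
have inK x : boundary K x -> K x /\ ~ interior K x by move=> /(closed_boundaryP _ cK).
have inL x : boundary L x -> L x /\ ~ interior L x by move=> /(closed_boundaryP _ cL).
have -> : \int[mu]_(x in boundary (K `|` L)) g x = \int[mu]_(x in A) g x +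
    \int[mu]_(x in BK) g x + \int[mu]_(x in BL) g x.
  rewrite UE split3// => x.
  - by move=> [_ /inL[Lx _]] [].
  - by move=> [/inK[Kx _] _] [].
  - by move=> [/inK[Kx _] _] [].
have -> : \int[mu]_(x in boundary (K `&` L)) g x = \int[mu]_(x in A) g x +
    \int[mu]_(x in CK) g x + \int[mu]_(x in CL) g x.
  rewrite (boundary_setI cK cL) split3// => x.
  - by move=> [_ /inL[_ nL]] [].
  - by move=> [/inK[_ nK] _] [].
  - by move=> [/inK[_ nK] _] [].
have -> : \int[mu]_(x in boundary K) g x = \int[mu]_(x in A) g x +
    \int[mu]_(x in BK) g x + \int[mu]_(x in CK) g x.
  rewrite [X in Rintegral _ X](boundary_split K cL) split3// => x.
  - by move=> [_ /inL[Lx _]] [].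
  - by move=> [_ /inL[_ nL]] [].
  - by move=> [_ nL] [_ /interior_subset].
have -> : \int[mu]_(x in boundary L) g x = \int[mu]_(x in A) g x +
    \int[mu]_(x in BL) g x + \int[mu]_(x in CL) g x.
  rewrite [X in Rintegral _ X](boundary_split L cK) [boundary L `&` boundary K]setIC.
  rewrite split3// => x.
  - by move=> [/inK[Kx _] _] [].
  - by move=> [/inK[_ nK] _] [].
  - by move=> [_ nK] [_ /interior_subset].
ring.
Qed.

(** Outside a null subset of the common boundary, the four integrands are
    restrictions of a single function g. *)
Lemma steiner_W_valuation p m k K L : (0 < d)%N -> 0 <= p \/ p < - n%:R ->
  rolling_body K -> rolling_body L -> convex (K `|` L) ->
  steiner_W p m k (K `|` L) + steiner_W p m k (K `&` L) =
  steiner_W p m k K + steiner_W p m k L.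
Proof.
move=> d0 hp rK rL cvxU.
have [cK [rk rk0 [rhok rhok0 [Mk Mk0 [tK' rhoK' KM]]]]] := rolling_data rK.
have [cL [rl rl0 [rhol rhol0 [Ml Ml0 [tL' rhoL' LM]]]]] := rolling_data rL.
pose r := Num.min rk rl; have r0 : 0 < r by rewrite lt_min rk0.
pose rho := Num.min rhok rhol; have rho0 : 0 < rho by rewrite lt_min rhok0.
pose M := Num.max Mk Ml; have M0 : 0 < M by rewrite lt_max Mk0.
have tK x : boundary K x -> touching_ball K r x (normal K x).
  by move=> /tK'; apply: touching_ball_shrink; rewrite ?(ltW r0)// ge_min lexx.
have tL x : boundary L x -> touching_ball L r x (normal L x).
  by move=> /tL'; apply: touching_ball_shrink; rewrite ?(ltW r0)// ge_min lexx orbT.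
have rhoK : eball 0 rho `<=` K.
  by move=> y yr; apply: rhoK'; apply: le_trans yr _; rewrite ge_min lexx.
have rhoL : eball 0 rho `<=` L.
  by move=> y yr; apply: rhoL'; apply: le_trans yr _; rewrite ge_min lexx orbT.
have ULM x : (K `|` L) x -> enorm x <= M.
  by move=> [/KM|/LM] h; apply: le_trans h _; rewrite le_max lexx ?orbT.
have bK x : boundary K x -> K x by move=> /(closed_boundaryP _ cK)[].
have bL x : boundary L x -> L x by move=> /(closed_boundaryP _ cL)[].
have [CK hCK] := steiner_integrand_bounded m k hp r0 rho0 tK rhoK
  (fun x h => ULM x (or_introl (bK x h))).
have [CL hCL] := steiner_integrand_bounded m k hp r0 rho0 tL rhoL
  (fun x h => ULM x (or_intror (bL x h))).
have finK : (hausdorff d (boundary K) < +oo)%E.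
  apply: (boundary_finite cK rho0 M0 rhoK (fun x h => ULM x (or_introl h))).
  by move=> x /tK[nx _]; exists (normal K x).
have finL : (hausdorff d (boundary L) < +oo)%E.
  apply: (boundary_finite cL rho0 M0 rhoL (fun x h => ULM x (or_intror h))).
  by move=> x /tL[nx _]; exists (normal L x).
have [P [PA P0 hP]] := common_boundary_ae r0 rho0 M0 cK cL tK tL rhoK rhoL ULM cvxU d0.
have cvxU' : convex (L `|` K) by rewrite setUC.
pose F := @steiner_integrand R d p m k.
pose g x := if x \in boundary K then F K x else F L x.
have gK x : boundary K x -> g x = F K x by move=> bx; rewrite /g mem_set.
have gL x : ~ boundary K x -> g x = F L x by move=> bx; rewrite /g memNset.
have UE : boundary (K `|` L) = (boundary K `&` boundary L) `|`
    (boundary K `&` ~` L) `|` (boundary L `&` ~` K).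
  apply/seteqP; split; first exact: boundary_setU_sub.
  have clU := closedU cK cL; move=> x [[[bKx bLx]|[bKx nLx]]|[bLx nKx]].
  - have [_ nU] := common_touching_ball r0 rho0 tK tL rhoK rhoL cvxU bKx bLx.
    by apply: normal_boundary clU _ nU; left; exact: bK.
  - have [_ _ nU] := outside_union r0 cK cL tK cvxU bKx nLx.
    by apply: normal_boundary clU _ nU; left; exact: bK.
  - have [_ _] := outside_union r0 cL cK tL cvxU' bLx nKx; rewrite setUC => nU.
    by apply: normal_boundary clU _ nU; right; exact: bL.
have common V x : (boundary K `&` boundary L `\` P) x -> K `&` L `<=` V ->
    V `<=` K `|` L -> F V x = F K x.
  move=> Ax IV VU; have [nV cV] := hP x Ax V IV VU.
  have [nK cK'] := hP x Ax K (@subIsetl _ K L) (@subsetUl _ K L).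
  by apply: steiner_integrand_local; rewrite ?nV ?cV ?nK ?cK'.
have IUsub : K `&` L `<=` K `|` L by move=> x [Kx _]; left.
have mP := null_surface_measurable P0.
have replace V : P `<=` boundary V -> (forall x, (boundary V `\` P) x -> F V x = g x) ->
    steiner_W p m k V = \int[mu]_(x in boundary V) g x.
  move=> PV h; rewrite steiner_WE.
  exact: (@lower_Rintegral_ae _ (caratheodory_type (@hausdorff R n d)) R mu (boundary V) P
    (F V) g (closed_surface_measurable (@boundary_closed R n V)) mP PV P0 h).
have IE := boundary_setI cK cL.
rewrite !replace.
- apply: (@boundary_integral_valuation K L g (Num.max CK CL)) => // x bx.
  have [bKx|nKx] := pselect (boundary K x).
    by rewrite gK// le_max hCK.
  by case: bx => // bLx; rewrite gL// le_max hCL ?orbT.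
- by move=> x /PA[].
- move=> x [bLx nP]; have [bKx|nKx] := pselect (boundary K x); last by rewrite gL.
  by rewrite gK// common//.
- by move=> x /PA[].
- by move=> x [bKx _]; rewrite gK.
- by move=> x /PA Ax; rewrite IE; left; left.
- move=> x [+ nP]; rewrite IE => -[[[bKx bLx]|[bKx iLx]]|[bLx iKx]].
  + by rewrite gK// common.
  + have [nE cE] := inside_intersection r0 tK bKx iLx.
    by rewrite gK//; exact: steiner_integrand_local.
  + have [nE cE] := inside_intersection r0 tL bLx iKx; rewrite setIC in nE cE.
    rewrite gL; last by move=> /(closed_boundaryP _ cK)[].
    exact: steiner_integrand_local.
- by move=> x /PA Ax; rewrite UE; left; left.
- move=> x [+ nP]; rewrite UE => -[[[bKx bLx]|[bKx nLx]]|[bLx nKx]].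
  + by rewrite gK// common.
  + have [nE cE _] := outside_union r0 cK cL tK cvxU bKx nLx.
    by rewrite gK//; exact: steiner_integrand_local.
  + have [nE cE _] := outside_union r0 cL cK tL cvxU' bLx nKx; rewrite setUC in nE cE.
    rewrite gL; last by move=> /bK.
    exact: steiner_integrand_local.
Qed.

End valuation.

Theorem mainTheorem1 (R : realType) (n : nat) (p : R) (k : nat)
    (n_ge2 : (2 <= n)%N) (p_range : 0 <= p \/ p < - n%:R) (k_ge1 : (1 <= k)%N) :
  [/\ forall (K : set 'rV[R]_n) (a : R), rolling_body K -> 0 < a ->
        steiner_V p k [set a *: x | x in K] =
        a `^ (n%:R * ((n%:R - p) / (n%:R + p)) - k%:R) * steiner_V p k K,
      forall (K : set 'rV[R]_n) (T : 'M[R]_n), rolling_body K ->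
        T *m T^T = 1%:M ->
        steiner_V p k [set x *m T | x in K] = steiner_V p k K
    & valuation_on (@rolling_body R n) (steiner_V p k)].
Proof.
case: n n_ge2 p_range => [//|d] d1 p_range.
have np : d.+1%:R + p != 0.
  have d0 := ltr0Sn R d; case: p_range => h; first by rewrite gt_eqF//; lra.
  by rewrite lt_eqF//; lra.
split.
- move=> K a rK a0.
  have TT : 1%:M *m 1%:M^T = 1%:M :> 'M[R]_d.+1 by rewrite trmx1 mulmx1.
  have <- : similarity a 1%:M @` K = [set a *: x | x in K].
    by apply: eq_imagel => x _; rewrite /similarity mulmx1.
  exact: steiner_V_similarity.
- move=> K T rK TT.
  have <- : similarity 1 T @` K = [set x *m T | x in K].
    by apply: eq_imagel => x _; rewrite /similarity scale1r.
  by rewrite (steiner_V_similarity k np ltr01 TT rK) powR1 mul1r.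
- move=> K L rK rL cvxU; rewrite /steiner_V -[LHS]big_split -[RHS]big_split.
  apply: eq_bigr => m _ /=.
  have := @steiner_W_valuation R d p m k K L d1 p_range rK rL cvxU.
  move: (steiner_W _ _ _ (K `|` L)) (steiner_W _ _ _ (K `&` L)).
  move: (steiner_W _ _ _ K) (steiner_W _ _ _ L) => wK wL wU wI h.
  by rewrite -[LHS]mulrDr h mulrDr.
Qed.
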